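(* Let $\Omega_1,\Omega_2\subset\mathbb{R}^n$ be open and let $f:\Omega_1\to\Omega_2$ be a bijective mapping such that $f^{-1}:\Omega_2\to\Omega_1$ is Lipschitz. Then there is a constant $K>0$ such that $$|Df|(f^{-1}(A))\le K\,\mathcal{L}^n(A)\quad\text{for all Borel sets } A\subset\Omega_2.$$
   Context: $\mathcal{L}^n$ is Lebesgue measure on $\mathbb{R}^n$. $Df$ is the distributional derivative of $f$ and $|Df|$ its total variation measure. The asserted inequality is understood to include that $f\in BV_{\mathrm{loc}}(\Omega_1,\Omega_2)$, i.e. every $x\in\Omega_1$ has a ball $B\ni x$ such that all components of $f$ are in $BV(B)$ (integrable functions whose distributional partial derivatives are signed measures of finite total variation), so that $|Df|$ is defined. *)

(* Defs.v *)
From HB Require Import structures.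
From mathcomp Require Import all_boot all_order all_algebra.
From mathcomp Require Import all_classical all_reals all_analysis.
From mathcomp Require Import lra.

Set Implicit Arguments.
Unset Strict Implicit.
Unset Printing Implicit Defensive.

Import Order.TTheory GRing.Theory Num.Theory.
Import numFieldNormedType.Exports.

Local Open Scope classical_set_scope.
Local Open Scope ring_scope.

(* R^n is modelled by 'rV[R]_n with the topology of the library; it is given
   here its Borel sigma-algebra. The library norm on 'rV[R]_n is the sup norm,
   so the Euclidean norm is introduced separately below (enorm). *)
Section borel_Rn.
Variables (R : realType) (n : nat).

Let B := <<s (@open 'rV[R]_n) >>.
Let B0 : B set0. Proof. exact: sigma_algebra0. Qed.
Let BC A : B A -> B (~` A). Proof. exact: sigma_algebraC. Qed.
Let BU (F : (set 'rV[R]_n)^nat) : (forall k, B (F k)) -> B (\bigcup_k F k).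
Proof. exact: sigma_algebra_bigcup. Qed.

HB.instance Definition _ :=
  @isMeasurable.Build default_measure_display 'rV[R]_n B B0 BC BU.

End borel_Rn.

Section lebesgue_tuple.
Context {R : realType}.
Local Open Scope ereal_scope.

Let T := measurableTypeR R.

(* lebesgue_tuple is the n-fold product of the Lebesgue measure of R. *)
Definition lebesgue_cons n (mu : set (n.-tuple T) -> \bar R) :
    set (n.+1.-tuple T) -> \bar R :=
  pushforward (@lebesgue_measure R \x mu)
    (fun p : T * n.-tuple T => [tuple of p.1 :: p.2]).

Section instances.
Variable n : nat.
Variable mu : {sigma_finite_measure set (n.-tuple T) -> \bar R}.

Let mcons : measurable_fun setT
  (fun p : T * n.-tuple T => [tuple of p.1 :: p.2]).
Proof. exact: measurable_cons. Qed.

Let lc0 : lebesgue_cons mu set0 = 0.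
Proof. by rewrite /lebesgue_cons /pushforward preimage_set0 measure0. Qed.

Let lc_ge0 A : 0 <= lebesgue_cons mu A.
Proof. exact: measure_ge0. Qed.

Let lc_sigma_additive : semi_sigma_additive (lebesgue_cons mu).
Proof.
move=> F mF tF mUF; rewrite /lebesgue_cons /pushforward preimage_bigcup.
apply: measure_semi_sigma_additive.
- by move=> k; rewrite -[X in measurable X]setTI; exact: mcons.
- apply/trivIsetP => /= i j _ _ ij; rewrite -preimage_setI.
  by move/trivIsetP : tF => /(_ _ _ _ _ ij) ->//; rewrite preimage_set0.
- by rewrite -preimage_bigcup -[X in measurable X]setTI; exact: mcons.
Qed.

HB.instance Definition _ := isMeasure.Build _ _ _ (lebesgue_cons mu)
  lc0 lc_ge0 lc_sigma_additive.

Let lc_sigma_finite : sigma_finite setT (lebesgue_cons mu).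
Proof.
have /sigma_finiteP[F [TF ndF Foo]] := sigma_finiteT (@lebesgue_measure R).
have /sigma_finiteP[G [TG ndG Goo]] := sigma_finiteT mu.
pose H k (t : n.+1.-tuple T) :=
  F k (thead t) /\ G k [tuple of behead t].
exists H.
  apply/seteqP; split=> // t _.
  have [i _ Fi] : (\bigcup_k F k) (thead t) by rewrite -TF.
  have [j _ Gj] : (\bigcup_k G k) [tuple of behead t] by rewrite -TG.
  exists (maxn i j) => //; split.
  - by move: Fi; exact/subsetPset/ndF/leq_maxl.
  - by move: Gj; exact/subsetPset/ndG/leq_maxr.
move=> k; have [mF Fk] := Foo k; have [mG Gk] := Goo k; split.
  apply: measurableI; rewrite -[X in measurable X]setTI.
  - exact: measurable_tnth.
  - exact: measurable_behead.
rewrite /lebesgue_cons /pushforward (_ : _ @^-1` H k = F k `*` G k).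
  by rewrite product_measure1E// lte_mul_pinfty// ge0_fin_numE.
by apply/seteqP; split=> -[x t]; rewrite /H/= (_ : [tuple of _] = t)//;
  exact: val_inj.
Qed.

HB.instance Definition _ := Measure_isSigmaFinite.Build _ _ _
  (lebesgue_cons mu) lc_sigma_finite.

End instances.

Fixpoint lebesgue_tuple n :
    {sigma_finite_measure set (n.-tuple T) -> \bar R} :=
  match n with
  | 0 => \d_([tuple] : 0.-tuple T)
  | m.+1 => lebesgue_cons (lebesgue_tuple m)
  end.

End lebesgue_tuple.

Section lebesgue_Rn.
Context {R : realType} {n : nat}.

Let T := measurableTypeR R.
Definition row_of_tuple (t : n.-tuple T) : 'rV[R]_n := \row_i tnth t i.

Definition lebesgue_Rn : set 'rV[R]_n -> \bar R :=
  pushforward (@lebesgue_tuple R n) row_of_tuple.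

Let mrow_of_tuple : measurable_fun setT row_of_tuple.
Proof.
have mopen (O : set 'rV[R]_n) : open O -> measurable (row_of_tuple @^-1` O).
  move=> oO; pose itv (q : rat * nat) : set R :=
    `]ratr q.1 - q.2.+1%:R^-1, ratr q.1 + q.2.+1%:R^-1[%classic.
  pose box (q : n.-tuple rat * nat) : set (n.-tuple T) :=
    \bigcap_(i in [set: 'I_n])
      (@tnth n T ^~ i @^-1` itv (tnth q.1 i, q.2)).
  have mbox q : measurable (box q).
    apply: fin_bigcap_measurable => // i _; rewrite -[X in measurable X]setTI.
    by apply: (measurable_tnth i) => //; exact: measurable_itv.
  pose C := [set q | box q `<=` row_of_tuple @^-1` O].
  rewrite (_ : row_of_tuple @^-1` O = \bigcup_q (if q \in C then box q else set0)).
    apply: countable_bigcupT_measurable => // q.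
    by case: ifP => // _; exact: measurable0.
  apply/seteqP; split=> [t Ot|t [q _]]; last first.
    by case: ifPn => // /set_mem qO /qO.
  have := oO; rewrite openE => /(_ _ Ot) /nbhs_ballP[e/= e0 eO].
  have [k ke] : exists k, (k.+1%:R^-1 < e / 2)%R.
    have e20 : (0 < e / 2)%R by rewrite divr_gt0.
    by have [k _ /(_ k (leqnn k)) ?] := near_infty_natSinv_lt (PosNum e20); exists k.
  have qex (x : R) : exists q : rat, `|ratr q - x| < k.+1%:R^-1.
    have k0 : 0 < k.+1%:R^-1 :> R by rewrite invr_gt0 ltr0n.
    have [|q] := @rat_in_itvoo R x (x + k.+1%:R^-1); first by rewrite ltrDl.
    rewrite in_itv/= => /andP[q1 q2]; exists q.
    move: q1 q2 k0; move: (ratr q) (k.+1%:R^-1) => y d q1 q2 k0.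
    rewrite ltr_norml; apply/andP; split; lra.
  pose q : n.-tuple rat := [tuple projT1 (cid (qex (tnth t i))) | i < n].
  have qE i : (`|ratr (tnth q i) - tnth t i| < k.+1%:R^-1 :> R)%R.
    by rewrite tnth_mktuple; case: cid.
  exists (q, k) => //; rewrite mem_set.
    by move=> i _; rewrite /itv/= in_itv/= -ltr_distl distrC; exact: qE.
  move=> u qu; apply: eO; split=> // i j; rewrite !mxE /ball/=.
  rewrite (splitr e) (le_lt_trans (ler_distD (ratr (tnth q j)) _ _))// ltrD//.
    by rewrite distrC (lt_trans (qE j)).
  have := qu j I; rewrite /itv/= in_itv/= -ltr_distl distrC => quj.
  exact: lt_trans quj ke.
apply: (@measurability _ _ _ _ setT row_of_tuple (@open 'rV[R]_n)) => //.
by move=> _ [U oU <-]; rewrite setTI; exact: mopen.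
Qed.

Local Open Scope ereal_scope.

Let lebesgue0 : lebesgue_Rn set0 = 0.
Proof. by rewrite /lebesgue_Rn /pushforward preimage_set0 measure0. Qed.

Let lebesgue_ge0 A : 0 <= lebesgue_Rn A.
Proof. exact: measure_ge0. Qed.

Let lebesgue_sigma_additive : semi_sigma_additive lebesgue_Rn.
Proof.
move=> F mF tF mUF; rewrite /lebesgue_Rn /pushforward preimage_bigcup.
apply: measure_semi_sigma_additive.
- by move=> k; rewrite -[X in measurable X]setTI; exact: mrow_of_tuple.
- apply/trivIsetP => /= i j _ _ ij; rewrite -preimage_setI.
  by move/trivIsetP : tF => /(_ _ _ _ _ ij) ->//; rewrite preimage_set0.
- by rewrite -preimage_bigcup -[X in measurable X]setTI; exact: mrow_of_tuple.
Qed.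

HB.instance Definition _ := isMeasure.Build _ _ _ lebesgue_Rn
  lebesgue0 lebesgue_ge0 lebesgue_sigma_additive.

End lebesgue_Rn.

Section BV.
Context {R : realType} {n : nat}.
Implicit Types (U Omega E : set 'rV[R]_n) (u phi : 'rV[R]_n -> R)
  (f : 'rV[R]_n -> 'rV[R]_n) (nu : {charge set 'rV[R]_n -> \bar R}).

(* Euclidean norm on row vectors, Frobenius norm on matrices *)
Definition enorm {m p : nat} (M : 'M[R]_(m, p)) : R :=
  Num.sqrt (\sum_i \sum_j M i j ^+ 2).

Definition eball (c : 'rV[R]_n) (r : R) : set 'rV[R]_n :=
  [set y | enorm (y - c) < r].

Definition elipschitz_on U (g : 'rV[R]_n -> 'rV[R]_n) : Prop :=
  exists L : R, forall x y, U x -> U y -> enorm (g x - g y) <= L * enorm (x - y).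

Definition partial (j : 'I_n) (phi : 'rV[R]_n -> R) : 'rV[R]_n -> R :=
  fun x => 'D_(delta_mx ord0 j) phi x.

Definition smooth phi : Prop :=
  forall s : seq 'I_n, let psi := foldr partial phi s in
    continuous psi /\ forall x j, derivable psi x (delta_mx ord0 j).

Definition test_function U phi : Prop :=
  smooth phi /\
  exists K, [/\ compact K, K `<=` U & forall x, ~ K x -> phi x = 0].

(* integral against a signed measure, through its Jordan decomposition *)
Definition charge_integral nu (D : set 'rV[R]_n) phi : R :=
  let: exist P hP := cid (Hahn_decomposition nu) in
  let: exist N nuPN := cid hP in
  \int[jordan_pos nuPN]_(x in D) phi x - \int[jordan_neg nuPN]_(x in D) phi x.

(* On U, the signed measure nu is the distributional derivative of u in the
   direction j; only the values of nu on Borel subsets of U are relevant. *)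
Definition distr_partial U u (j : 'I_n) nu : Prop :=
  forall phi, test_function U phi ->
    \int[lebesgue_Rn]_(x in U) (u x * partial j phi x) =
    - charge_integral nu U phi.

(* A charge is finite-valued, hence has finite total variation. *)
Definition BV U u : Prop :=
  lebesgue_Rn.-integrable U (EFin \o u) /\
  forall j, exists nu, distr_partial U u j nu.

Definition component f (i : 'I_n) : 'rV[R]_n -> R := fun x => f x ord0 i.

Definition BV_loc Omega f : Prop :=
  forall x, Omega x -> exists c r,
    [/\ eball c r x, eball c r `<=` Omega & forall i, BV (eball c r) (component f i)].

(* M = Df(E). When f is only in BV_loc(Omega), Df is a (matrix-valued) measure
   on each open U on which f is BV; these measures agree on overlaps, so that M
   does not depend on the choice of U. *)
Definition Df_value Omega f E (M : 'M[R]_n) : Prop :=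
  exists U (nu : 'I_n -> 'I_n -> {charge set 'rV[R]_n -> \bar R}),
    [/\ open U, U `<=` Omega, measurable E & E `<=` U] /\
    [/\ forall i, lebesgue_Rn.-integrable U (EFin \o component f i),
        forall i j, distr_partial U (component f i) j (nu i j) &
        M = \matrix_(i, j) fine (nu i j E)].

(* |Df|(E) = sup of \sum_k |Df(E_k)| over the countable Borel partitions
   (E_k) of E into sets on which Df is defined *)
Definition Df_variation Omega f E : \bar R :=
  ereal_sup [set v | exists (F : (set 'rV[R]_n)^nat) (M : nat -> 'M[R]_n),
    [/\ trivIset setT F, \bigcup_k F k = E,
        forall k, Df_value Omega f (F k) (M k) &
        v = (\sum_(0 <= k <oo) (enorm (M k))%:E)%E]].

End BV.

(* Main.v *)
Require Import Defs.
From HB Require Import structures.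
From mathcomp Require Import all_boot all_order all_algebra.
From mathcomp Require Import all_classical all_reals all_analysis.
From mathcomp Require Import measurable_realfun lra ring zify.

Set Implicit Arguments.
Unset Strict Implicit.
Unset Printing Implicit Defensive.

Import Order.TTheory GRing.Theory Num.Theory.
Import numFieldNormedType.Exports.

Local Open Scope classical_set_scope.
Local Open Scope ring_scope.

(** Let g be the inverse of f, with Lipschitz constant L for the sup norm, and let
    lambda be the Lebesgue measure. The whole theorem rests on one inequality: for
    a test function phi on an open subset of Omega1,
        | int f_i d_j phi | <= C int_Omega2 |phi o g| dlambda,    C = C(n, L).
    Its right-hand side is the integral of |phi| for the image m of lambda under
    g, that is, for the measure m(E) = lambda(f(E)).

    The inequality ([weak_derivative_bound]). Approximate d_j phi by a difference
    quotient of step s, and move the quotient to f by translation invariance.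
    Cut a large cube into grid cells of size s. By the intermediate value
    theorem, the increment of f_i along the segment [x, x + s e_j] is at most s
    times the number of cells that the image of the segment meets
    ([grid_variation]). Conversely, since g is Lipschitz, a cell Q is met only
    for x in a cube of radius (L + 1) s around g(y), y in Q, which has volume
    C s^n. Summing over the cells gives C times a Riemann sum for the integral
    of |phi o g|.

    The intermediate value theorem needs f to be continuous. This is invariance
    of domain for the continuous injective map g ([open_inverse_continuous],
    [invariance_of_domain]). It is derived from the Poincare-Miranda theorem
    ([poincare_miranda]), which follows in turn from a purely combinatorial
    statement on lattice cubes ([grid_cube_all_change]), proved by a cup product
    computation modulo 2.

    From the inequality to BV_loc ([component_BV]). On a small ball m is finite,
    and a linear functional bounded by the L1 norm of a finite measure has an
    integrable density h ([bounded_functional_density]; h is the limit of a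
    minimising sequence of a quadratic functional). The signed measure h m is
    then the distributional derivative of f_i in the direction j.

    From the inequality to the bound on the variation ([Df_variation_le]).
    Whatever signed measure nu represents the derivative on an open set, smooth
    bump functions converging to the indicator of a compact set E turn the
    inequality into |nu(E)| <= C lambda(f(E)) ([charge_compact_le]), and inner
    regularity extends this to Borel sets ([charge_le]). For a matrix of such
    measures the norm is at most n^2 times larger, and the estimate adds up over
    a countable partition of g(A), whose images under f partition A. *)

(** * Elementary topology of row vectors *)

Section within_continuity.
Context {R : realType} {V W : normedModType R}.
Implicit Types (A : set V) (f : V -> W).

Lemma within_continuous_epsP A f : {within A, continuous f} <->
  forall x, A x -> forall e, 0 < e -> exists2 d, 0 < d &
    forall y, A y -> `|x - y| < d -> `|f x - f y| < e.
Proof.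
rewrite subspace_continuousP; split=> [cf x Ax e e0|cf x Ax].
  have /cvgrPdist_lt/(_ _ e0) := cf x Ax.
  rewrite /within/= near_withinE => /nbhs_ballP[d /= d0 H].
  by exists d => // y Ay xy; apply: H => //; rewrite -ball_normE.
apply/cvgrPdist_lt => e e0; rewrite near_withinE.
have [d d0 H] := cf x Ax e e0.
apply/nbhs_ballP; exists d => //= y; rewrite -ball_normE/= => xy Ay; exact: H.
Qed.

Lemma within_continuous_norm A f :
  {within A, continuous f} -> {within A, continuous (fun x => `|f x|)}.
Proof.
move=> /within_continuous_epsP cf.
apply/subspace_continuousP => x Ax; apply/cvgrPdist_lt => e e0.
rewrite near_withinE; have [d d0 H] := cf x Ax e e0.
apply/nbhs_ballP; exists d => //= y; rewrite -ball_normE/= => xy Ay.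
by rewrite (le_lt_trans (ler_dist_dist _ _))// H.
Qed.

(** Heine-Cantor. *)
Lemma compact_unif_continuous A f : compact A -> {within A, continuous f} ->
  forall e, 0 < e -> exists2 d, 0 < d &
    forall x y, A x -> A y -> `|x - y| < d -> `|f x - f y| < e.
Proof.
move=> /compact_near_coveringP cA /within_continuous_epsP cf e e0.
have e2 : 0 < e / 2 by rewrite divr_gt0.
have := cA R (0^'+) (fun d x => forall y, A x -> A y -> `|x - y| < d ->
  `|f x - f y| < e) _.
move=> []; last first.
  move=> d [/= d0 /= H].
  exists (d / 2); first by rewrite divr_gt0.
  move=> x y Ax Ay xy; apply: (H (d / 2)) => //=; last by rewrite divr_gt0.
  by rewrite distrC subr0 gtr0_norm ?divr_gt0// ltr_pdivrMr// ltr_pMr// ltr1n.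
move=> x Ax; have [d d0 H] := cf x Ax _ e2.
exists (ball x (d / 2), [set t | 0 < t < d / 2]) => /=.
  split; first by apply: nbhsx_ballx; rewrite divr_gt0.
  near=> t; apply/andP; split; near: t; first exact: nbhs_right_gt.
  by apply: nbhs_right_lt; rewrite divr_gt0.
move=> [z t]/= []; rewrite -ball_normE/= => xz /andP[t0 td] y Az Ay zy.
rewrite (splitr e) (le_lt_trans (ler_distD (f x) _ _))// ltrD//.
  rewrite distrC; apply: H => //; apply: (lt_trans xz).
  by rewrite ltr_pdivrMr// ltr_pMr// ltr1n.
apply: H => //; rewrite (splitr d) (le_lt_trans (ler_distD z _ _))// ltrD//.
exact: lt_trans td.
Unshelve. all: by end_near. Qed.

End within_continuity.

Section rV_norm.
Context {R : realType} {n : nat}.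
Implicit Types (x y c : 'rV[R]_n) (r : R).

Lemma rV_normr_le x r : 0 <= r -> (`|x| <= r) = [forall i, `|x ord0 i| <= r].
Proof.
move=> r0; rewrite [`|x|]/Num.norm/= mx_normrE; apply/bigmax_leP/forallP => /=.
  by move=> [_ H] i; exact: (H (ord0, i)).
by move=> H; split=> // -[i j] _ /=; rewrite (ord1 i).
Qed.

Lemma rV_normr_lt x r : 0 < r -> (`|x| < r) = [forall i, `|x ord0 i| < r].
Proof.
move=> r0; rewrite [`|x|]/Num.norm/= mx_normrE; apply/bigmax_ltP/forallP => /=.
  by move=> [_ H] i; exact: (H (ord0, i)).
by move=> H; split=> // -[i j] _ /=; rewrite (ord1 i).
Qed.

Lemma rV_coord_le x i : `|x ord0 i| <= `|x|.
Proof.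
by have := rV_normr_le x (normr_ge0 x); rewrite lexx => /esym/forallP/(_ i).
Qed.

Definition cube c r : set 'rV[R]_n := [set y | `|y - c| <= r].

Lemma cube_compact c r : compact (cube c r).
Proof.
apply: bounded_closed_compact.
  exists (r + `|c|); split; first exact: num_real.
  move=> M rM y /= yc; rewrite (le_trans _ (ltW rM))//.
  by rewrite -{1}(subrK c y) (le_trans (ler_normD _ _))// lerD2r.
rewrite (_ : cube c r = closed_ball_ (fun x : 'rV[R]_n => `|x|) c r).
  exact: closed_closed_ball_.
by apply/seteqP; split=> y; rewrite /cube /closed_ball_/= distrC.
Qed.

End rV_norm.

(** * The Poincare-Miranda theorem *)

Section lattice_cup_product.
Variable n : nat.
Local Notation pt := ('I_n -> nat).
Implicit Types (S : {set 'I_n}) (s : seq 'I_n) (p q : pt).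
Implicit Types (phi psi : pt -> 'F_2) (phis : seq (pt -> 'F_2)).

Definition lshift_pt (j : 'I_n) p : pt := fun i => (p i + (i == j))%N.
Definition set_coord p (l : 'I_n) (t : nat) : pt :=
  fun i => if i == l then t else p i.
Definition ldiff (j : 'I_n) psi : pt -> 'F_2 :=
  fun p => psi (lshift_pt j p) - psi p.

(** On lattice cochains with coefficients in F_2, this is the cup product of the
    coboundaries of the functions in [phis], evaluated on the unit cube with
    corner [p] spanned by the directions in [S]. *)
Fixpoint cup_diff S phis : pt -> 'F_2 :=
  if phis is phi :: phis' then
    fun p => \sum_(j in S)
      ldiff j phi p * cup_diff (S :\ j) phis' (lshift_pt j p)
  else fun=> 1.

Lemma F2_addxx (x : 'F_2) : x + x = 0.
Proof. by apply/eqP; case: x => -[|[|[]]]. Qed.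

Lemma F2_oppx (x : 'F_2) : - x = x.
Proof. by apply/eqP; rewrite -subr_eq0 -opprD F2_addxx oppr0. Qed.

Lemma lshift_ptC i j p : lshift_pt i (lshift_pt j p) = lshift_pt j (lshift_pt i p).
Proof. by apply/funext => k; rewrite /lshift_pt addnAC. Qed.

Lemma F2_sum_sym (T : Type) (r : seq T) (H : T -> T -> 'F_2) :
  (forall i j, H i j = H j i) ->
  \sum_(i <- r) \sum_(j <- r) H i j = \sum_(i <- r) H i i.
Proof.
move=> sH; elim: r => [|x r IH]; first by rewrite !big_nil.
rewrite !big_cons -IH.
rewrite (_ : \sum_(i <- r) \sum_(j <- x :: r) H i j =
  \sum_(j <- r) H x j + \sum_(i <- r) \sum_(j <- r) H i j).
  by rewrite addrA -[X in X + _]addrA F2_addxx addr0.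
by rewrite -big_split/=; apply: eq_bigr => i _; rewrite big_cons sH.
Qed.

(** The rule d (d phi) = 0 together with the Leibniz rule; working modulo 2
    dispenses with signs. *)
Lemma cup_diff_closed phis S p :
  \sum_(j in S) ldiff j (cup_diff (S :\ j) phis) p = 0.
Proof.
elim: phis S p => [|phi phis IH] S p /=.
  by rewrite big1// => j _; rewrite /ldiff subrr.
pose A i j := ldiff j (ldiff i phi) p *
  cup_diff (S :\ i :\ j) phis (lshift_pt i (lshift_pt j p)).
pose B i j := ldiff i phi p *
  ldiff j (cup_diff (S :\ i :\ j) phis) (lshift_pt i p).
have E j : j \in S -> ldiff j (cup_diff (S :\ j) (phi :: phis)) p =
    \sum_(i in S :\ j) A i j + \sum_(i in S :\ j) B i j.
  move=> jS; rewrite -big_split /ldiff/= -sumrB; apply: eq_bigr => i _.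
  rewrite /A /B (_ : S :\ j :\ i = S :\ i :\ j); last by rewrite !finset.setDDl finset.setUC.
  by rewrite /ldiff !(lshift_ptC j i); ring.
rewrite (eq_bigr _ E) big_split/= [X in X + _](_ : _ = 0) ?add0r; last first.
  pose H i j := if [&& i \in S, j \in S & i != j] then A i j else 0.
  transitivity (\sum_j \sum_i H i j).
    rewrite [LHS]big_mkcond/=; apply: eq_bigr => j _; case: ifP => jS.
      rewrite big_mkcond; apply: eq_bigr => i _; rewrite /H !inE jS.
      by rewrite andbC.
    by rewrite big1// => i _; rewrite /H jS andbF.
  rewrite F2_sum_sym; first by rewrite big1// => i _; rewrite /H eqxx !andbF.
  move=> i j; rewrite /H andbCA eq_sym; case: ifP => // _.
  rewrite /A (_ : S :\ j :\ i = S :\ i :\ j); last by rewrite !finset.setDDl finset.setUC.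
  by rewrite /ldiff !(lshift_ptC j i); ring.
rewrite (exchange_big_dep [in S])/=; last by move=> j i _; rewrite !inE => /andP[].
rewrite big1// => i iS.
transitivity (\sum_(j in S :\ i) B i j).
  by apply: eq_bigl => j; rewrite !inE iS andbT eq_sym andbC.
by rewrite /B -mulr_sumr IH mulr0.
Qed.

(** Since w is closed, d phi . w = d (phi w). *)
Lemma cup_diff_exact phi phis S p :
  cup_diff S (phi :: phis) p =
  \sum_(j in S) ldiff j (fun q => phi q * cup_diff (S :\ j) phis q) p.
Proof.
transitivity (cup_diff S (phi :: phis) p +
    phi p * \sum_(j in S) ldiff j (cup_diff (S :\ j) phis) p).
  by rewrite cup_diff_closed mulr0 addr0.
by rewrite mulr_sumr -big_split/=; apply: eq_bigr => j _; rewrite /ldiff mulrBl mulrBr addrA subrK.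
Qed.

(** The box extends in the directions of [s]; in the other directions the
    coordinates are those of the argument. *)
Fixpoint box_sum (N : nat) s psi : pt -> 'F_2 :=
  if s is l :: s' then
    fun q => \sum_(0 <= t < N) box_sum N s' psi (set_coord q l t)
  else psi.

Lemma eq_box_sum N s psi psi' q : psi =1 psi' ->
  box_sum N s psi q = box_sum N s psi' q.
Proof. by move=> /funext ->. Qed.

Lemma box_sumD N s psi psi' q :
  box_sum N s (fun p => psi p + psi' p) q =
  box_sum N s psi q + box_sum N s psi' q.
Proof.
elim: s q => //= l s IH q; rewrite -big_split/=.
by apply: eq_bigr => t _; exact: IH.
Qed.

Lemma box_sum0 N s q : box_sum N s (fun=> 0) q = 0.
Proof. by elim: s q => //= l s IH q; rewrite big1// => t _; exact: IH. Qed.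

Lemma box_sum_sum N s (I : Type) (r : seq I) (P : pred I) (G : I -> pt -> 'F_2) q :
  box_sum N s (fun p => \sum_(i <- r | P i) G i p) q =
  \sum_(i <- r | P i) box_sum N s (G i) q.
Proof.
elim: r => [|i r IH].
  by under eq_box_sum do rewrite big_nil; rewrite big_nil box_sum0.
under eq_box_sum do rewrite big_cons; rewrite big_cons.
by case: (P i) => //; rewrite box_sumD IH.
Qed.

Lemma set_coordC p l m t u : l != m ->
  set_coord (set_coord p l t) m u = set_coord (set_coord p m u) l t.
Proof.
move=> lm; apply/funext => i; rewrite /set_coord.
by case: (eqVneq i m) => // ->; rewrite eq_sym (negbTE lm).
Qed.

Lemma set_coord_shift p l m t : l != m ->
  set_coord (lshift_pt l p) m t = lshift_pt l (set_coord p m t).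
Proof.
move=> lm; apply/funext => i; rewrite /set_coord /lshift_pt.
by case: eqVneq => // ->; rewrite eq_sym (negbTE lm) addn0.
Qed.

Lemma box_sum_set_coord N s l t psi q : l \notin s ->
  box_sum N s (fun p => psi (set_coord p l t)) q =
  box_sum N s psi (set_coord q l t).
Proof.
elim: s q => //= m s IH q; rewrite inE negb_or => /andP[lm ls].
by apply: eq_bigr => u _; rewrite IH// set_coordC// eq_sym.
Qed.

Lemma box_sum_shift N s l psi q : l \notin s ->
  box_sum N s (fun p => psi (lshift_pt l p)) q =
  box_sum N s psi (lshift_pt l q).
Proof.
elim: s q => //= m s IH q; rewrite inE negb_or => /andP[lm ls].
by apply: eq_bigr => u _; rewrite IH// set_coord_shift.
Qed.

Lemma box_sumB N s psi psi' q :
  box_sum N s (fun p => psi p - psi' p) q =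
  box_sum N s psi q - box_sum N s psi' q.
Proof.
rewrite F2_oppx -box_sumD; apply: eq_box_sum => p; by rewrite F2_oppx.
Qed.

(** Discrete Stokes formula: the sum telescopes in the direction [l]. *)
Lemma box_sum_ldiff N s l psi q : uniq s -> l \in s ->
  box_sum N s (ldiff l psi) q =
  box_sum N (rem l s)
    (fun p => psi (set_coord p l N) - psi (set_coord p l 0)) q.
Proof.
elim: s q => //= m s IH q /andP[ms us]; rewrite inE eq_sym.
case: (eqVneq m l) => /= [ml _|lm ls]; last first.
  by apply: eq_bigr => t _; exact: IH.
subst m; rewrite box_sumB !box_sum_set_coord//.
rewrite -(telescope_sumr (fun t => box_sum N s psi (set_coord q l t)))//.
apply: eq_bigr => t _; rewrite box_sumB box_sum_shift//; congr (box_sum _ _ _ _ - _).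
by apply/funext => i; rewrite /lshift_pt /set_coord; case: eqVneq; rewrite ?addn1 ?addn0.
Qed.

Variables (N : nat) (phi : 'I_n -> pt -> 'F_2).
Hypothesis phi_bot : forall l p, p l = 0%N -> phi l p = 0.
Hypothesis phi_top : forall l p, p l = N -> phi l p = 1.

(** On a face orthogonal to the direction [j] the function [phi j] is constant,
    so the factor d (phi j) vanishes there. *)
Lemma cup_diff_face S s j p : j \in s -> j \notin S -> p j = 0%N \/ p j = N ->
  cup_diff S (map phi s) p = 0.
Proof.
elim: s S p => //= m s IH S p; rewrite inE => /predU1P[<- jS pj|js jS pj].
  rewrite big1// => i iS.
  have ij : i != j by apply: contraNneq jS => <-.
  rewrite /ldiff (_ : _ - _ = 0) ?mul0r//.
  have E : lshift_pt i p j = p j by rewrite /lshift_pt eq_sym (negbTE ij) addn0.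
  case: pj => pj; first by rewrite !phi_bot ?E ?subrr.
  by rewrite !phi_top ?E ?subrr.
rewrite big1// => i iS; rewrite IH ?mulr0 ?inE ?(negbTE jS) ?andbF//.
have ij : i != j by apply: contraNneq jS => <-.
by rewrite /lshift_pt eq_sym (negbTE ij) addn0.
Qed.

(** Evaluating d phi_1 ... d phi_k on the fundamental chain of the box: by
    Stokes only the face where the first function equals 1 contributes, which
    is the same statement in one dimension less. *)
Lemma box_sum_cup_diff s q : uniq s ->
  box_sum N s (cup_diff [set x in s] (map phi s)) q = 1.
Proof.
elim: s q => [//|l s IH] q; rewrite cons_uniq => /andP[ls us].
set S := [set x in l :: s].
have -> : box_sum N (l :: s) (cup_diff S (map phi (l :: s))) q =
    \sum_(j in S) box_sum N (l :: s)
      (ldiff j (fun p => phi l p * cup_diff (S :\ j) (map phi s) p)) q.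
  by rewrite -box_sum_sum; apply: eq_box_sum => p; exact: cup_diff_exact.
have lS : l \in S by rewrite inE inE eqxx.
rewrite (bigD1 l lS) big1 => [|j /andP[]]; last first.
  move=> jS jl; have jls : j \in l :: s by have : j \in S := jS; rewrite inE.
  rewrite box_sum_ldiff ?cons_uniq ?ls//=.
  rewrite (negbTE (_ : l != j)) 1?eq_sym//=.
  have js : j \in s by move: jls; rewrite inE (negbTE jl).
  rewrite big1// => t _; rewrite -[RHS](box_sum0 N (rem j s) (set_coord q l t)).
  apply: eq_box_sum => p; rewrite !(@cup_diff_face _ _ j) ?inE ?eqxx//.
  - by rewrite !mulr0 subr0.
  - by left; rewrite /set_coord eqxx.
  - by right; rewrite /set_coord eqxx.
rewrite [LHS]addr0 box_sum_ldiff ?cons_uniq ?ls ?inE ?eqxx//= ?eqxx.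
rewrite -[RHS](IH (set_coord q l N))// -box_sum_set_coord//.
apply: eq_box_sum => p; rewrite phi_top ?phi_bot /set_coord ?eqxx//.
rewrite mul1r mul0r subr0; congr (cup_diff _ _ _).
by apply/setP => x; rewrite !inE; case: eqVneq => //= ->; rewrite (negbTE ls).
Qed.

Lemma box_sum_neq0 s psi q : box_sum N s psi q != 0 ->
  exists p, [/\ psi p != 0, forall i, i \in s -> (p i < N)%N &
                forall i, i \notin s -> p i = q i].
Proof.
elim: s q => [|l s IH] q /= h; first by exists q.
have [/= t]: exists t : 'I_N, box_sum N s psi (set_coord q l t) != 0.
  apply/existsP; apply: contraNT h => /existsPn h.
  by rewrite big_mkord big1// => t _; apply/eqP; rewrite -[_ == _]negbK.
move=> /IH[p [p0 ps pns]]; exists p; split => // i.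
- rewrite inE; have [/ps//|/pns ->] := boolP (i \in s); rewrite orbF => /eqP->.
  by rewrite /set_coord eqxx.
- by rewrite inE negb_or => /andP[il /pns->]; rewrite /set_coord (negbTE il).
Qed.

Lemma cup_diff_neq0 S s p : cup_diff S (map phi s) p != 0 ->
  forall l, l \in s -> exists a b : pt, phi l a != phi l b /\
    forall i, (p i <= a i <= p i + (i \in S))%N && (p i <= b i <= p i + (i \in S))%N.
Proof.
elim: s S p => //= m s IH S p h l.
have {h}[j jS] : exists2 j, j \in S &
    ldiff j (phi m) p * cup_diff (S :\ j) (map phi s) (lshift_pt j p) != 0.
  apply: contrapT => /forall2NP h'; case/eqP: h; rewrite big1// => j jS.
  by have [//|/negP/negPn/eqP] := h' j.
rewrite mulf_eq0 negb_or => /andP[d0 /IH{}IH].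
have Sj i : (lshift_pt j p i + (i \in S :\ j) <= p i + (i \in S))%N.
  by rewrite /lshift_pt !inE; case: eqVneq => [->|_]; rewrite ?jS//= !addn0.
rewrite inE => /predU1P[->|/IH[a [b [ab h]]]].
  exists (lshift_pt j p), p; split; first by rewrite -subr_eq0.
  move=> i; rewrite leqnn leq_addr !leq_addr/= andbT leq_add2l.
  by case: eqVneq => [->|//]; rewrite jS.
exists a, b; split=> // i; have /andP[/andP[h1 h2] /andP[h3 h4]] := h i.
have := Sj i; rewrite {1 2}/lshift_pt in h1 h3 *; move: h1 h2 h3 h4.
by rewrite /lshift_pt; lia.
Qed.

End lattice_cup_product.

(** Combinatorial Poincare-Miranda theorem: the sum over all unit cubes of the
    cup product of the differences of the [phi l] is 1 modulo 2, so one of these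
    cubes carries a nonzero term. *)
Lemma grid_cube_all_change n N (phi : 'I_n -> ('I_n -> nat) -> bool) :
  (0 < N)%N ->
  (forall l p, p l = 0%N -> phi l p = false) ->
  (forall l p, p l = N -> phi l p = true) ->
  exists p : 'I_n -> nat, (forall i, (p i < N)%N) /\
    forall l, exists a b : 'I_n -> nat, [/\ phi l a, ~~ phi l b &
      forall i, (p i <= a i <= (p i).+1)%N && (p i <= b i <= (p i).+1)%N].
Proof.
move=> N0 bot top.
pose f l p : 'F_2 := (phi l p)%:R.
have fbot l p : p l = 0%N -> f l p = 0 by move=> /bot; rewrite /f => ->.
have ftop l p : p l = N -> f l p = 1 by move=> /top; rewrite /f => ->.
have := box_sum_cup_diff fbot ftop (fun=> 0%N) (enum_uniq 'I_n).
move=> /eqP; move=> h.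
have {h} : box_sum N (enum 'I_n) (cup_diff [set x in enum 'I_n] (map f (enum 'I_n)))
   (fun=> 0%N) != 0 by rewrite (eqP h) oner_neq0.
move=> /box_sum_neq0[p [p0 pN _]]; exists p; split=> [i|l].
  by apply: pN; rewrite mem_enum.
have lE : l \in enum 'I_n by rewrite mem_enum.
have [a [b [ab h]]] := cup_diff_neq0 p0 lE.
have {}h i : (p i <= a i <= (p i).+1)%N && (p i <= b i <= (p i).+1)%N.
  by have := h i; rewrite inE mem_enum addn1.
move: ab; rewrite /f; case fa : (phi l a); case fb: (phi l b); rewrite ?eqxx// => _.
  by exists a, b; split => //; rewrite fb.
by exists b, a; split => //; rewrite ?fa// => i; rewrite andbC.
Qed.

(** Discretising a map on a fine grid turns the combinatorial theorem into
    points where the map is arbitrarily small; compactness then gives a zero. *)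
Theorem poincare_miranda {R : realType} n (c : 'rV[R]_n) (r : R)
    (F : 'rV[R]_n -> 'rV[R]_n) : 0 < r -> {within cube c r, continuous F} ->
  (forall y i, cube c r y -> y ord0 i = c ord0 i + r -> 0 <= F y ord0 i) ->
  (forall y i, cube c r y -> y ord0 i = c ord0 i - r -> F y ord0 i <= 0) ->
  exists2 y, cube c r y & F y = 0.
Proof.
move=> r0 cF Ftop Fbot.
have cubec : cube c r c by rewrite /cube/= subrr normr0 ltW.
have cnF := within_continuous_norm cF.
have [|y0 /set_mem Qy0 y0min] := EVT_min_rV _ (cube_compact (c := c) (r := r)) cnF.
  by exists c.
exists y0 => //; apply/eqP; rewrite -normr_eq0 eq_le normr_ge0 andbT leNgt.
apply/negP => m0; set m := `|F y0| in m0.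
have [d d0 dF] := compact_unif_continuous (cube_compact (c := c) (r := r)) cF m0.
pose N := (Num.truncn (2 * r / d)).+1.
have N0 : 0 < N%:R :> R by rewrite ltr0n.
have Nd : 2 * r / N%:R < d.
  rewrite ltr_pdivrMr// [d * _]mulrC -ltr_pdivrMr//.
  by rewrite /N truncnS_gt.
pose pnt (p : 'I_n -> nat) : 'rV[R]_n :=
  \row_i (c ord0 i - r + (p i)%:R * (2 * r / N%:R)).
have pntQ p : (forall i, (p i <= N)%N) -> cube c r (pnt p).
  move=> pN; rewrite /cube/= rV_normr_le ?ltW//; apply/forallP => i.
  rewrite !mxE addrAC [_ - r]addrC addrK ler_norml.
  have h : 0 <= (p i)%:R * (2 * r / N%:R) by rewrite mulr_ge0// divr_ge0// mulr_ge0// ltW.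
  have : (p i)%:R * (2 * r / N%:R) <= 2 * r.
    rewrite mulrCA ger_pMr; first by rewrite ler_pdivrMr// mul1r ler_nat.
    by rewrite mulr_gt0.
  move: h; set u := _ * _; set w := 2 * r; rewrite /w; move: (u) => z; lra.
pose phi l (p : 'I_n -> nat) :=
  (p l == N) || ((p l != 0%N) && (0 < F (pnt p) ord0 l)).
have [|||p [pN H]] := @grid_cube_all_change n N phi.
- by [].
- by move=> l p p0; rewrite /phi p0.
- by move=> l p p0; rewrite /phi p0 eqxx.
have step (q : 'I_n -> nat) : (forall i, (p i <= q i <= (p i).+1)%N) ->
    cube c r (pnt q) /\ `|F (pnt q) - F (pnt p)| < m.
  move=> pq.
  have Qq : cube c r (pnt q).
    by apply: pntQ => i; have /andP[_ h] := pq i; exact: leq_trans (pN i).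
  split=> //; apply: dF => //; first by apply: pntQ => i; exact: ltnW.
  apply: le_lt_trans Nd; rewrite rV_normr_le; last by rewrite divr_ge0// mulr_ge0// ltW.
  apply/forallP => i; rewrite !mxE opprD addrACA subrr add0r -mulrBl normrM.
  rewrite [X in _ * X]ger0_norm; last by rewrite divr_ge0// mulr_ge0// ltW.
  rewrite ger_pMl ?divr_gt0 ?mulr_gt0//.
  have /andP[h1 h2] := pq i; rewrite -natrB// ger0_norm// -[leRHS]/(1%:R) ler_nat.
  by rewrite leq_subLR addn1.
have : `|F (pnt p)| < m.
  rewrite rV_normr_lt//; apply/forallP => l.
  have [a [b [pa pb ab]]] := H l.
  have [Qa Fa] := step a (fun i => proj1 (andP (ab i))).
  have [Qb Fb] := step b (fun i => proj2 (andP (ab i))).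
  have {}Fa := le_lt_trans (rV_coord_le _ l) Fa.
  have {}Fb := le_lt_trans (rV_coord_le _ l) Fb.
  rewrite !mxE ltr_norml in Fa; rewrite !mxE ltr_norml in Fb.
  have sa : 0 <= F (pnt a) ord0 l.
    move: pa; rewrite /phi => /orP[/eqP aN|/andP[_ /ltW//]].
    apply: Ftop => //; rewrite mxE aN mulrCA divff ?gt_eqF// mulr1.
    by rewrite mulr_natl mulr2n addrA subrK.
  have sb : F (pnt b) ord0 l <= 0.
    move: pb; rewrite /phi negb_or => /andP[_]; rewrite negb_and negbK -leNgt.
    move=> /orP[/eqP b0|//]; apply: Fbot => //.
    by rewrite mxE b0 mul0r addr0.
  rewrite ltr_norml; move: Fa Fb sa sb.
  move: (F (pnt a) ord0 l) (F (pnt b) ord0 l) (F (pnt p) ord0 l) (m) => x y z t.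
  move=> /andP[? ?] /andP[? ?] ? ?; apply/andP; split; lra.
have Qp : cube c r (pnt p) by apply: pntQ => i; exact: ltnW.
have := y0min (pnt p); rewrite inE => /(_ Qp).
by rewrite leNgt => /negP h /h.
Qed.

(** * Lebesgue measure on row vectors *)

Section borel.
Context {R : realType} {n : nat}.
Implicit Types (O D : set 'rV[R]_n) (x y : 'rV[R]_n).

Lemma open_measurable_rV O : open O -> measurable O.
Proof. by move=> oO; exact: sub_sigma_algebra. Qed.

Lemma closed_measurable_rV O : closed O -> measurable O.
Proof.
by move=> cO; rewrite -(setCK O); apply: measurableC; apply: open_measurable_rV; exact: closed_openC.
Qed.

Lemma compact_measurable_rV O : compact O -> measurable O.
Proof. by move=> cO; apply: closed_measurable_rV; apply: compact_closed => //; exact: norm_hausdorff. Qed.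

Lemma within_open_preimage (T : topologicalType) (f : 'rV[R]_n -> T) D (O : set T) :
  open D -> {within D, continuous f} -> open O -> open (D `&` f @^-1` O).
Proof.
move=> oD /subspace_continuousP cf oO; rewrite openE => x [Dx Ox].
have := cf x Dx O (open_nbhs_nbhs (conj oO Ox)).
rewrite /within/= => H.
have Dn : nbhs x D by exact: open_nbhs_nbhs.
by apply: filterS2 Dn H => y Dy; split=> //; auto.
Qed.

Lemma within_continuous_measurable_rV m (f : 'rV[R]_n -> 'rV[R]_m) D :
  open D -> {within D, continuous f} -> measurable_fun D f.
Proof.
move=> oD cf.
apply: (@measurability _ _ _ _ D f (@open 'rV[R]_m)) => //.
move=> _ [U oU <-]; apply: open_measurable_rV; exact: within_open_preimage.
Qed.

Lemma within_continuous_measurable_R (f : 'rV[R]_n -> R) D :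
  open D -> {within D, continuous f} -> measurable_fun D f.
Proof.
move=> oD cf.
apply: (measurability _ (RGenOpens.measurableE R)).
move=> _ [_ [a [b ->] <-]]; apply: open_measurable_rV.
by apply: within_open_preimage => //; exact: interval_open.
Qed.

Lemma continuous_measurable_R (f : 'rV[R]_n -> R) :
  continuous f -> measurable_fun setT f.
Proof.
move=> cf; apply: within_continuous_measurable_R; first exact: openT.
exact: continuous_subspaceT.
Qed.

Lemma coord_measurable (i : 'I_n) : measurable_fun setT (fun x : 'rV[R]_n => x ord0 i).
Proof. by apply: continuous_measurable_R => x; exact: coord_continuous. Qed.

Definition rat_cube (p : 'rV[rat]_n * nat) : set 'rV[R]_n :=
  [set y | forall i, `|y ord0 i - ratr (p.1 ord0 i)| < p.2.+1%:R^-1].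

(** The countability of this family of cubes reduces measurability of maps into
    row vectors to that of their coordinates. *)
Lemma open_bigcup_rat_cube O : open O ->
  O = \bigcup_(p in [set p | rat_cube p `<=` O]) rat_cube p.
Proof.
move=> oO; apply/seteqP; split=> [x Ox|x [p pO px]]; last exact: pO.
have /nbhs_ballP[e/= e0 eO] : nbhs x O by exact: open_nbhs_nbhs.
have [k ke] : exists k, (k.+1%:R^-1 < e / 2)%R.
  have e20 : (0 < e / 2)%R by rewrite divr_gt0.
  by have [k _ /(_ k (leqnn k)) ?] := near_infty_natSinv_lt (PosNum e20); exists k.
have k0 : 0 < k.+1%:R^-1 :> R by rewrite invr_gt0 ltr0n.
have qex (z : R) : exists q : rat, `|z - ratr q| < k.+1%:R^-1.
  have [|q] := @rat_in_itvoo R z (z + k.+1%:R^-1); first by rewrite ltrDl.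
  rewrite in_itv/= => /andP[q1 q2]; exists q.
  move: q1 q2 k0; move: (ratr q) (k.+1%:R^-1) => u d q1 q2 d0.
  by rewrite ltr_norml; apply/andP; split; lra.
have [q qx] := choice (fun i => qex (x ord0 i)).
have qxE i : `|x ord0 i - ratr ((\row_j q j) ord0 i)| < k.+1%:R^-1.
  by rewrite mxE.
exists (\row_j q j, k) => //= y qy; apply: eO; rewrite -ball_normE/=.
rewrite rV_normr_lt//; apply/forallP => i; rewrite !mxE.
rewrite (splitr e) (le_lt_trans (ler_distD (ratr ((\row_j q j) ord0 i)) _ _))// ltrD//.
  exact: lt_trans ke.
by rewrite distrC (lt_trans (qy i)).
Qed.

Lemma measurable_row_of_tuple :
  measurable_fun setT (@row_of_tuple R n).
Proof.
apply: (@measurability _ _ _ _ setT _ (@open 'rV[R]_n)) => //.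
move=> _ [U oU <-]; rewrite setTI (open_bigcup_rat_cube oU) preimage_bigcup.
rewrite bigcup_mkcond; apply: countable_bigcupT_measurable => // p.
case: ifP => // _; rewrite (_ : _ @^-1` _ = \bigcap_(i in [set: 'I_n])
  ((@tnth n (measurableTypeR R) ^~ i) @^-1`
    ball (ratr (p.1 ord0 i) : R) p.2.+1%:R^-1)).
  apply: fin_bigcap_measurable => // i _; rewrite -[X in measurable X]setTI.
  by apply: (measurable_tnth i) => //; by apply: open_measurable; exact: ball_open.
apply/seteqP; split=> [t h i _|t h i]; have := h i.
  by rewrite mxE -ball_normE/= distrC.
by rewrite mxE -ball_normE/= distrC; apply.
Qed.

End borel.

Section boxes.
Context {R : realType}.

Lemma lebesgue_tuple_box n (A : 'I_n -> set R) (l : 'I_n -> R) :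
  (forall i, measurable (A i)) ->
  (forall i, lebesgue_measure (A i) = (l i)%:E) ->
  lebesgue_tuple n [set t : n.-tuple (measurableTypeR R) | forall i, A i (tnth t i)]
  = (\prod_i l i)%:E.
Proof.
elim: n A l => [|n IH] A l mA lA.
  rewrite big_ord0 /= (_ : mkset _ = setT) ?diracT//.
  by apply/seteqP; split=> // t _ [].
rewrite big_ord_recl EFinM -lA.
rewrite -(IH (fun i => A (lift ord0 i)) (fun i => l (lift ord0 i)))//.
rewrite /= /lebesgue_cons /pushforward.
rewrite (_ : _ @^-1` _ = A ord0 `*`
    [set t : n.-tuple (measurableTypeR R) | forall i, A (lift ord0 i) (tnth t i)]).
  rewrite product_measure1E//; first exact: mA.
  rewrite (_ : mkset _ = \bigcap_(i in [set: 'I_n])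
    ((@tnth n (measurableTypeR R) ^~ i) @^-1` A (lift ord0 i))).
    apply: fin_bigcap_measurable => // i _; rewrite -[X in measurable X]setTI.
    by apply: (measurable_tnth i) => //; exact: mA.
  by apply/seteqP; split=> [t h i _|t h i]; have := h i; apply.
apply/seteqP; split=> -[x t]/=.
  move=> h; split=> /=; first by have := h ord0.
  by move=> i; have := h (lift ord0 i); rewrite tnthS.
move=> [Ax h] i; case: (unliftP ord0 i) => [j ->|->]; first by rewrite tnthS.
by [].
Qed.

Lemma lebesgue_Rn_box n (A : 'I_n -> set R) (l : 'I_n -> R) :
  (forall i, measurable (A i)) ->
  (forall i, lebesgue_measure (A i) = (l i)%:E) ->
  lebesgue_Rn [set x : 'rV[R]_n | forall i, A i (x ord0 i)] = (\prod_i l i)%:E.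
Proof.
move=> mA lA; rewrite -(lebesgue_tuple_box mA lA) /lebesgue_Rn /pushforward.
congr (_ _); apply/seteqP; split=> t h i; have := h i; rewrite /row_of_tuple mxE//.
Qed.

Lemma measurable_box n (A : 'I_n -> set R) : (forall i, measurable (A i)) ->
  measurable [set x : 'rV[R]_n | forall i, A i (x ord0 i)].
Proof.
move=> mA; rewrite (_ : mkset _ = \bigcap_(i in [set: 'I_n])
    ((fun x : 'rV[R]_n => x ord0 i) @^-1` A i)).
  apply: fin_bigcap_measurable => // i _; rewrite -[X in measurable X]setTI.
  by apply: coord_measurable => //; exact: mA.
by apply/seteqP; split=> [t h i _|t h i]; have := h i; apply.
Qed.

Lemma lebesgue_itvE (a b : R) (x y : bool) : a <= b ->
  lebesgue_measure [set` Interval (BSide x a) (BSide y b)] = (b - a)%:E.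
Proof.
move=> ab; rewrite lebesgue_measure_itv/= lte_fin EFinB.
by case: ltgtP ab => // -> _; rewrite subee.
Qed.

Lemma measurable_cube n (c : 'rV[R]_n) r : measurable (cube c r).
Proof. by apply: compact_measurable_rV; exact: cube_compact. Qed.

Lemma lebesgue_cube n (c : 'rV[R]_n) r : 0 <= r ->
  lebesgue_Rn (cube c r) = ((2 * r) ^+ n)%:E.
Proof.
move=> r0; pose A i : set R := `[c ord0 i - r, c ord0 i + r]%classic.
rewrite (_ : cube c r = [set x | forall i, A i (x ord0 i)]).
  rewrite (@lebesgue_Rn_box n A (fun=> 2 * r)).
  - by rewrite prodr_const card_ord.
  - by move=> i; rewrite /A; apply: measurable_itv.
  - move=> i; rewrite /A lebesgue_itvE; last by move: (c ord0 i) => z; lra.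
    by congr (_%:E); move: (c ord0 i) => z; ring.
apply/seteqP; split=> x; rewrite /cube/= rV_normr_le// => h.
  move=> i; rewrite /A/= in_itv/= -ler_distl distrC.
  by have /forallP/(_ i) := h; rewrite !mxE distrC.
apply/forallP => i; have := h i; rewrite /A/= in_itv/= -ler_distl distrC.
by rewrite !mxE distrC.
Qed.

Lemma lebesgue_compact_lty n (K : set 'rV[R]_n) : compact K ->
  (lebesgue_Rn K < +oo)%E.
Proof.
move=> cK; have [M [_ MK]] := compact_bounded cK.
have KM : K `<=` cube 0 (`|M| + 1).
  by move=> x Kx; rewrite /cube/= subr0; apply: MK => //; rewrite (le_lt_trans (ler_norm M))// ltrDl.
rewrite (@le_lt_trans _ _ (lebesgue_Rn (cube (0 : 'rV[R]_n) (`|M| + 1))))//.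
  by apply: le_measure => //; rewrite inE; [exact: compact_measurable_rV|exact: measurable_cube].
by rewrite lebesgue_cube ?ltry// addr_ge0.
Qed.

End boxes.

Section translation.
Context {R : realType}.
Local Open Scope ereal_scope.

Notation pushforward_measure :=
  measure_function_pushforward__canonical__measure_function_Measure.

Lemma measurable_shift_R (t : R) : measurable_fun setT
  (fun x : measurableTypeR R => (x + t)%R : measurableTypeR R).
Proof.
by apply: continuous_measurable_fun => x; apply: cvgD; [exact: cvg_id|exact: cvg_cst].
Qed.

Lemma lebesgue_measure_shift (t : R) (A : set (measurableTypeR R)) : measurable A ->
  lebesgue_measure ((fun x => x + t)%R @^-1` A) = lebesgue_measure A.
Proof.
move=> mA; apply/esym.
have := @lebesgue_measure_unique R (pushforward_measure
  (@lebesgue_measure R) (measurable_shift_R t)).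
apply => // _ [[a b] _ <-]/=.
rewrite /pushforward (_ : _ @^-1` _ = `](a - t)%R, (b - t)%R]%classic); last first.
  by apply/seteqP; split=> x/=; rewrite !in_itv/= ltrBlDr lerBrDr.
rewrite !lebesgue_measure_itv/= !lte_fin ltrD2r -!EFinB.
by case: ifP => // _; congr (_%:E); ring.
Qed.

Let shift_tuple n (v : 'I_n -> R) (t : n.-tuple (measurableTypeR R)) :
  n.-tuple (measurableTypeR R) := [tuple (tnth t i + v i)%R | i < n].

Let measurable_shift_tuple n v : measurable_fun setT (@shift_tuple n v).
Proof.
apply/measurable_fun_tnthP => i /=.
rewrite (_ : _ \o _ = (fun x : R => x + v i)%R \o (@tnth n (measurableTypeR R) ^~ i)).
  apply: measurableT_comp; first exact: measurable_shift_R.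
  exact: measurable_tnth.
by apply/funext => t /=; rewrite tnth_mktuple.
Qed.

(** By induction on the dimension: the shifted product measure agrees with the
    product measure on rectangles, and uniqueness of product measures applies. *)
Let lebesgue_tuple_shift n v (A : set (n.-tuple (measurableTypeR R))) :
  measurable A -> lebesgue_tuple n (@shift_tuple n v @^-1` A) = lebesgue_tuple n A.
Proof.
elim: n v A => [|n IH] v A mA.
  by congr (_ _); apply/seteqP; split=> t; rewrite /preimage/= (tuple0 t) [shift_tuple _ _]tuple0.
rewrite /= /lebesgue_cons /pushforward.
pose T2 (p : measurableTypeR R * n.-tuple (measurableTypeR R)) :
    measurableTypeR R * n.-tuple (measurableTypeR R) :=
  ((p.1 + v ord0)%R, shift_tuple (fun i => v (lift ord0 i)) p.2).
have mT2 : measurable_fun setT T2.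
  apply/measurable_fun_pairP; split.
    apply: (measurableT_comp (measurable_shift_R (v ord0))); exact: measurable_fst.
  exact: (measurableT_comp (measurable_shift_tuple _) measurable_snd).
pose cns := fun p : measurableTypeR R * n.-tuple (measurableTypeR R) =>
  [tuple of p.1 :: p.2].
have mcns : measurable_fun setT cns by exact: measurable_cons.
rewrite (_ : _ @^-1` (_ @^-1` _) = T2 @^-1` (cns @^-1` A)); last first.
  apply/seteqP; split=> -[x t]; rewrite /preimage/=.
    rewrite (_ : shift_tuple v _ = cns (T2 (x, t)))//.
    apply: eq_from_tnth => i; rewrite tnth_mktuple.
    by case: (unliftP ord0 i) => [j ->|->]; rewrite /cns/= ?tnthS ?tnth_mktuple.
  rewrite (_ : shift_tuple v _ = cns (T2 (x, t)))//.
  apply: eq_from_tnth => i; rewrite tnth_mktuple.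
  by case: (unliftP ord0 i) => [j ->|->]; rewrite /cns/= ?tnthS ?tnth_mktuple.
apply/esym.
apply: (product_measure_unique (m' := pushforward_measure
   (@lebesgue_measure R \x lebesgue_tuple n) mT2)); last first.
  by rewrite -[X in measurable X]setTI; exact: mcns.
move=> A1 A2 mA1 mA2; rewrite /= /pushforward.
rewrite (_ : T2 @^-1` _ = ((fun x => x + v ord0)%R @^-1` A1) `*`
   (shift_tuple (fun i => v (lift ord0 i)) @^-1` A2))//.
rewrite [LHS]product_measure1E; last 2 first.
- by rewrite -[X in measurable X]setTI; exact: measurable_shift_R.
- by rewrite -[X in measurable X]setTI; exact: measurable_shift_tuple.
by congr (_ * _); [exact: lebesgue_measure_shift|exact: IH].
Qed.

Lemma measurable_shift_rV n (v : 'rV[R]_n) : 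
  measurable_fun setT (fun x : 'rV[R]_n => x + v)%R.
Proof.
apply: within_continuous_measurable_rV; first exact: openT.
apply/within_continuous_epsP => x _ e e0; exists e => // y _.
by rewrite opprD addrACA subrr addr0.
Qed.

Lemma lebesgue_Rn_shift n (v : 'rV[R]_n) (A : set 'rV[R]_n) : measurable A ->
  lebesgue_Rn ((fun x => x + v)%R @^-1` A) = lebesgue_Rn A.
Proof.
move=> mA; rewrite /lebesgue_Rn /pushforward.
rewrite -(lebesgue_tuple_shift (fun i => v ord0 i) (A := @row_of_tuple R n @^-1` A)).
  congr (_ _); apply/funext => t; rewrite /preimage/=; congr (A _).
  by apply/rowP => i; rewrite !mxE tnth_mktuple.
by rewrite -[X in measurable X]setTI; exact: measurable_row_of_tuple.
Qed.

Lemma integral_shift n (v : 'rV[R]_n) (H : 'rV[R]_n -> \bar R) :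
  lebesgue_Rn.-integrable setT H ->
  lebesgue_Rn.-integrable setT (fun x : 'rV[R]_n => H (x + v)%R) /\
  \int[lebesgue_Rn]_x H (x + v)%R = \int[lebesgue_Rn]_x H x.
Proof.
move=> /integrableP[mH iH].
have E (F : 'rV[R]_n -> \bar R) :
    \int[pushforward_measure lebesgue_Rn (measurable_shift_rV v)]_x F x =
    \int[lebesgue_Rn]_x F x.
  by apply: eq_measure_integral => A mA _; rewrite /= /pushforward lebesgue_Rn_shift.
have mHv : measurable_fun setT (fun x : 'rV[R]_n => H (x + v)%R).
  by apply: (measurableT_comp mH); exact: measurable_shift_rV.
have iHv : lebesgue_Rn.-integrable setT (fun x : 'rV[R]_n => H (x + v)%R).
  apply/integrableP; split => //.
  have := ge0_integral_pushforward (measurable_shift_rV v) lebesgue_Rn measurableT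
     (f := fun x => `|H x|) (measurableT_comp (abse_measurable (D := setT)) mH) (fun _ _ => abse_ge0 _).
  by rewrite preimage_setT => /= <-; rewrite E.
split => //.
have := @integral_pushforward _ _ _ _ _ _ (measurable_shift_rV v) lebesgue_Rn setT
  H mH iHv measurableT.
by rewrite preimage_setT => /= <-; rewrite E.
Qed.

End translation.

(** * Grids of cubes *)

Section grid.
Context {R : realType} {n : nat} (rho : R) (M : nat).
Hypotheses (rho_gt0 : 0 < rho) (M_gt0 : (0 < M)%N).
Implicit Types (k : {ffun 'I_n -> 'I_M}) (y z : 'rV[R]_n).

(** The half-open cube [-rho, rho)^n is cut into M^n half-open cubes. *)
Definition mesh : R := 2 * rho / M%:R.

Definition grid_cell k : set 'rV[R]_n :=
  [set y | forall i, y ord0 i \in `[- rho + mesh * (k i)%:R,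
                                    - rho + mesh * (k i).+1%:R[].

Lemma mesh_gt0 : 0 < mesh.
Proof. by rewrite divr_gt0 ?mulr_gt0// ltr0n. Qed.

Lemma measurable_grid_cell k : measurable (grid_cell k).
Proof.
apply: (@measurable_box _ n (fun i =>
  `[- rho + mesh * (k i)%:R, - rho + mesh * (k i).+1%:R[%classic)) => i.
exact: measurable_itv.
Qed.

Lemma lebesgue_grid_cell k : lebesgue_Rn (grid_cell k) = (mesh ^+ n)%:E.
Proof.
rewrite [LHS](@lebesgue_Rn_box _ n (fun i =>
  `[- rho + mesh * (k i)%:R, - rho + mesh * (k i).+1%:R[%classic) (fun=> mesh)).
- by rewrite prodr_const card_ord.
- by move=> i; exact: measurable_itv.
- move=> i; rewrite lebesgue_itvE; last first.
    by rewrite lerD2l ler_pM2l ?mesh_gt0// ler_nat.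
  by congr (_%:E); rewrite -natr1; ring.
Qed.

Lemma grid_coord (t : R) : -rho <= t < rho ->
  exists k : 'I_M, t \in `[- rho + mesh * k%:R, - rho + mesh * k.+1%:R[.
Proof.
move=> /andP[t1 t2].
have s0 := mesh_gt0.
have q0 : 0 <= (t + rho) / mesh by rewrite divr_ge0 ?(ltW s0)// -lerBlDr sub0r.
have /andP[q1 q2] := truncn_itv q0.
have kM : (Num.truncn ((t + rho) / mesh) < M)%N.
  rewrite -(ltr_nat R); apply: le_lt_trans q1 _.
  rewrite ltr_pdivrMr// /mesh mulrCA divff ?pnatr_eq0 -?lt0n// mulr1.
  by rewrite mulr_natl mulr2n ltrD2r.
exists (Ordinal kM); rewrite in_itv/=; apply/andP; split.
  by move: q1; rewrite ler_pdivlMr// mulrC => q1; rewrite addrC lerBlDr.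
by move: q2; rewrite ltr_pdivrMr// mulrC => q2; rewrite addrC ltrBrDr.
Qed.

Lemma grid_cell_cover y : `|y| < rho -> exists k, grid_cell k y.
Proof.
rewrite rV_normr_lt// => /forallP yr.
have H i : exists k : 'I_M, y ord0 i \in `[- rho + mesh * k%:R, - rho + mesh * k.+1%:R[.
  by apply: grid_coord; have := yr i; rewrite ltr_norml => /andP[/ltW-> ->].
have [k kP] := choice H.
by exists [ffun i => k i] => i; rewrite ffunE.
Qed.

Lemma grid_coord_inj (t : R) (j k : nat) :
  t \in `[- rho + mesh * j%:R, - rho + mesh * j.+1%:R[ ->
  t \in `[- rho + mesh * k%:R, - rho + mesh * k.+1%:R[ -> j = k.
Proof.
rewrite !in_itv/= => /andP[h1 h2] /andP[h3 h4].
have := le_lt_trans h1 h4; have := le_lt_trans h3 h2.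
rewrite !ltrD2l !ltr_pM2l ?mesh_gt0// !ltr_nat; lia.
Qed.

Lemma trivIset_grid_cell : trivIset setT grid_cell.
Proof.
move=> j k _ _ [y [yj yk]]; apply/ffunP => i; apply/val_inj.
exact: (grid_coord_inj (yj i) (yk i)).
Qed.

Lemma grid_cell_dist k y z : grid_cell k y -> grid_cell k z -> `|y - z| <= mesh.
Proof.
move=> ky kz; rewrite rV_normr_le ?(ltW mesh_gt0)//; apply/forallP => i.
have := ky i; have := kz i; rewrite !mxE !in_itv/= -natr1 mulrDr mulr1.
move: (mesh) (mesh * _) => s u /andP[h1 h2] /andP[h3 h4].
by rewrite ler_norml; apply/andP; split; lra.
Qed.

Local Open Scope ereal_scope.

(** The cells are disjoint, so the sum is a lower Riemann sum of the integral. *)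
Lemma grid_cell_sum_le (P : pred {ffun 'I_n -> 'I_M}) (D : set 'rV[R]_n)
    (h : 'rV[R]_n -> \bar R) (c : {ffun 'I_n -> 'I_M} -> R) :
  measurable D -> measurable_fun D h -> (forall y, D y -> 0 <= h y) ->
  (forall k, P k -> grid_cell k `<=` D) ->
  (forall k y, P k -> grid_cell k y -> (c k)%:E <= h y) ->
  (forall k, P k -> (0 <= c k)%R) ->
  (\sum_(k | P k) c k * mesh ^+ n)%R%:E <= \int[lebesgue_Rn]_(y in D) h y.
Proof.
move=> mD mh h0 PD ch c0.
pose s := [seq k <- index_enum _ | P k].
have us : uniq s by rewrite filter_uniq// index_enum_uniq.
pose F k := if P k then grid_cell k else set0.
have mF k : measurable (F k).
  by rewrite /F; case: ifP => _; [exact: measurable_grid_cell|exact: measurable0].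
have subFD : \big[setU/set0]_(k <- s) F k `<=` D.
  rewrite -bigcup_seq; apply: bigcup_sub => k _; rewrite /F; case: ifP => [Pk|_]; last exact: sub0set.
  exact: PD.
have mU : measurable (\big[setU/set0]_(k <- s) F k) by exact: bigsetU_measurable.
apply: (le_trans _ (ge0_subset_integral _ mU mD mh h0 subFD)).
rewrite ge0_integral_bigsetU//; last 3 first.
- move=> j k _ _ []; rewrite /F; case: ifP => // _ y [yj]; case: ifP => // _ yk.
  by apply: trivIset_grid_cell => //; exists y.
- exact: measurable_funS mh.
- by move=> x /subFD; exact: h0.
rewrite big_filter -sumEFin; apply: lee_sum => k Pk.
rewrite /F Pk EFinM -(lebesgue_grid_cell k).
rewrite -integral_cst; last exact: measurable_grid_cell.
apply: ge0_le_integral => //.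
- exact: measurable_grid_cell.
- by move=> y _; rewrite lee_fin c0.
- by apply: measurable_funS mh => //; exact: PD.
- by move=> y ky; exact: ch.
Qed.

End grid.

(** * Invariance of domain *)

Section lipschitz_approximation.
Context {R : realType}.

(** Inf-convolution with a steep cone: P x is the infimum of u z + C |x - z|, and
    C is so large that points z far from x do not matter. *)
Lemma lipschitz_approx_real (V : normedModType R) (A : set V) (u : V -> R) (eta : R) :
  compact A -> A !=set0 -> {within A, continuous u} -> 0 < eta ->
  exists (P : V -> R) (C : R), [/\ 0 <= C,
    (forall x y, P x <= P y + C * `|x - y|) &
    forall x, A x -> `|P x - u x| <= eta].
Proof.
move=> cA [a Aa] cu eta0.
have [d d0 du] := compact_unif_continuous cA cu eta0.
have [B0 [_ Bu]] := compact_bounded (continuous_compact cu cA).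
pose B := `|B0| + 1.
have B_gt0 : 0 < B by rewrite ltr_wpDl.
have {Bu}uB x : A x -> `|u x| <= B.
  by move=> Ax; apply: Bu; [rewrite (le_lt_trans (ler_norm B0))// ltrDl|exists x].
pose C := 2 * B / d.
have C0 : 0 <= C by rewrite divr_ge0 ?mulr_ge0// ltW.
pose E x := [set u z + C * `|x - z| | z in A].
have E0 x : E x !=set0 by exists (u a + C * `|x - a|), a.
have lbE x : lbound (E x) (- B).
  move=> _ [z Az <-]; have := uB _ Az; rewrite ler_norml => /andP[h _].
  by rewrite (le_trans h)// lerDl mulr_ge0.
exists (fun x => inf (E x)), C; split => //.
  move=> x y; rewrite -lerBlDr; apply: lb_le_inf => // _ [z Az <-].
  rewrite lerBlDr -addrA; apply: (@le_trans _ _ (u z + C * `|x - z|)).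
    by apply: ge_inf; [exists (- B)|exists z].
  by rewrite lerD2l -mulrDr ler_wpM2l// [leRHS]addrC ler_distD.
move=> x Ax; rewrite ler_norml; apply/andP; split.
  rewrite lerBrDl; apply: lb_le_inf => // _ [z Az <-].
  have [xz|xz] := ltP `|x - z| d.
    have := du x z Ax Az xz; rewrite ltr_norml => /andP[_ h].
    have : 0 <= C * `|x - z| by rewrite mulr_ge0.
    by move: h; move: (u x) (u z) (C * _) eta0 => *; lra.
  have h : 2 * B <= C * `|x - z|.
    by rewrite /C -mulrA ler_peMr ?mulr_ge0// ?(ltW B_gt0)// mulrC ler_pdivlMr// mul1r.
  have := uB _ Ax; have := uB _ Az; rewrite !ler_norml => /andP[h1 h2] /andP[h3 h4].
  by move: h h1 h2 h3 h4; move: (u x) (u z) (C * _) (B) eta0 => *; lra.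
rewrite lerBlDl; apply: (@le_trans _ _ (u x)); last by rewrite lerDl ltW.
apply: ge_inf; first by exists (- B).
by exists x => //; rewrite subrr normr0 mulr0 addr0.
Qed.

Lemma lipschitz_approx n (V : normedModType R) (A : set V) (G : V -> 'rV[R]_n) (eta : R) :
  compact A -> A !=set0 -> {within A, continuous G} -> 0 < eta ->
  exists (P : V -> 'rV[R]_n) (C : R), [/\ 0 <= C,
    (forall x y, `|P x - P y| <= C * `|x - y|) &
    forall x, A x -> `|P x - G x| <= eta].
Proof.
move=> cA A0 cG eta0.
have H i : exists PC : (V -> R) * R, [/\ 0 <= PC.2,
    (forall x y, PC.1 x <= PC.1 y + PC.2 * `|x - y|) &
    forall x, A x -> `|PC.1 x - G x ord0 i| <= eta].
  have ci : {within A, continuous (fun x => G x ord0 i)}.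
    apply/within_continuous_epsP => x Ax e e0.
    have [d d0 H] := (within_continuous_epsP _ _).1 cG x Ax e e0.
    exists d => // y Ay xy; apply: le_lt_trans (H y Ay xy).
    by have := rV_coord_le (G x - G y) i; rewrite !mxE.
  by have [P [C PC]] := lipschitz_approx_real cA A0 ci eta0; exists (P, C).
have [PC PCP] := choice H.
have PC0 i : 0 <= (PC i).2 by have [] := PCP i.
exists (fun x => \row_i (PC i).1 x), (\sum_i (PC i).2); split.
- by apply: sumr_ge0 => i _.
- move=> x y; have s0 : 0 <= (\sum_i (PC i).2) * `|x - y|.
    by rewrite mulr_ge0// sumr_ge0.
  rewrite rV_normr_le//; apply/forallP => i; rewrite !mxE.
  apply: (@le_trans _ _ ((PC i).2 * `|x - y|)); last first.
    by rewrite ler_wpM2r// (bigD1 i)//= lerDl sumr_ge0.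
  have [_ L _] := PCP i.
  rewrite ler_norml; apply/andP; split; last by rewrite lerBlDl; exact: L.
  by rewrite lerBrDr addrC lerBlDr distrC; exact: L.
- move=> x Ax; rewrite rV_normr_le ?ltW//; apply/forallP => i; rewrite !mxE.
  by have [_ _] := PCP i; apply.
Qed.

(** The points of K at distance at least e from y have a compact image, which
    stays away from [g y]. *)
Lemma compact_inverse_continuous (V W : normedModType R) (K : set V)
    (g : V -> W) (h : W -> V) :
  compact K -> {within K, continuous g} ->
  (forall y, K y -> h (g y) = y) -> {within g @` K, continuous h}.
Proof.
move=> cK cg hg; apply/within_continuous_epsP => _ [y Ky <-] e e0.
pose K' := K `&` [set z | e <= `|y - z|].
have cK' : compact K'.
  apply: compact_closedI => //.
  rewrite (_ : [set z | _] = ~` ball y e).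
    by apply: open_closedC; exact: ball_open.
  by apply/seteqP; split=> z; rewrite -ball_normE/= leNgt => /negP.
have cgK' : compact (g @` K').
  apply: continuous_compact => //; apply: continuous_subspaceW cg.
  exact: subIsetl.
have clgK' : closed (g @` K') by apply: compact_closed => //; exact: norm_hausdorff.
have : nbhs (g y) (~` (g @` K')).
  apply: open_nbhs_nbhs; split; first exact: closed_openC.
  move=> [z [Kz /= yz] gzy]; move: yz.
  by rewrite -(hg z)// gzy hg// subrr normr0 leNgt e0.
move=> /nbhs_ballP[d /= d0 dK'].
exists d => // _ [z Kz <-] gyz.
rewrite !hg// ltNge; apply/negP => yz.
apply: (dK' (g z)); first by rewrite -ball_normE.
by exists z.
Qed.

End lipschitz_approximation.

Lemma continuous_expr_comp (R : realType) n (h : R -> R) :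
  continuous h -> continuous (fun s => h s ^+ n).
Proof.
by move=> ch s; exact: (continuous_comp (ch s) (@exprn_continuous R n (h s))).
Qed.

Section sphere_image.
Context {R : realType} {n : nat}.

Lemma measure_bigsetU_le d (T : measurableType d) (mu : {measure set T -> \bar R})
    (I : Type) (s : seq I) (P : pred I) (F : I -> set T) :
  (forall i, measurable (F i)) ->
  (mu (\big[setU/set0]_(i <- s | P i) F i) <= \sum_(i <- s | P i) mu (F i))%E.
Proof.
move=> mF; elim: s => [|i s IH]; first by rewrite !big_nil measure0.
rewrite !big_cons; case: (P i) => //.
by apply: le_trans (measureU2 _ _ _) _ => //; [exact: bigsetU_measurable|rewrite leeD2l].
Qed.

(** A sphere has measure zero, and Lipschitz maps preserve this: the number of
    grid cells of size s that meet the sphere is at most the volume of a shell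
    of width O(s) divided by s^n. *)
Lemma lipschitz_sphere_image (P : 'rV[R]_n -> 'rV[R]_n) (C : R) (c : 'rV[R]_n)
    (delta eta : R) : 0 <= C -> 0 < delta -> 0 < eta ->
  (forall x y, `|P x - P y| <= C * `|x - y|) ->
  exists v, `|v| <= eta /\ forall x, `|x - c| = delta -> P x != v.
Proof.
wlog -> : P c / c = 0 => [hwlog C0 d0 eta0 LP|C0 d0 eta0 LP].
  have [|v [v1 v2]] := hwlog (fun x => P (x + c)) 0 erefl C0 d0 eta0.
    by move=> x y; rewrite (le_trans (LP _ _))// opprD addrACA subrr addr0.
  exists v; split => // x xc; have := v2 (x - c).
  by rewrite subr0 subrK; exact.
apply: contrapT => nex.
have {nex}onto v : `|v| <= eta -> exists2 x, `|x| = delta & P x = v.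
  move=> ve; apply: contrapT => nx; apply: nex; exists v; split=> // x.
  by rewrite subr0 => xd; apply/eqP => Px; apply: nx; exists x.
pose vol (s : R) := (2 * C) ^+ n * ((2 * (delta + s)) ^+ n - (2 * (delta - 2 * s)) ^+ n).
have [d dgt0 dvol] : exists2 d, 0 < d & forall s, 0 < s < d -> vol s < (2 * eta) ^+ n.
  have cvol : continuous vol.
    move=> s; apply: cvgM; [exact: cvg_cst|apply: cvgB].
      apply: (@continuous_expr_comp R n (fun s => 2 * (delta + s))) => t.
      apply: cvgM; first exact: cvg_cst.
      by apply: cvgD; [exact: cvg_cst|exact: cvg_id].
    apply: (@continuous_expr_comp R n (fun s => 2 * (delta - 2 * s))) => t.
    apply: cvgM; first exact: cvg_cst.
    apply: cvgB; first exact: cvg_cst.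
    by apply: cvgM; [exact: cvg_cst|exact: cvg_id].
  have vol0 : vol 0 < (2 * eta) ^+ n.
    by rewrite /vol mulr0 addr0 subr0 subrr mulr0 exprn_gt0// mulr_gt0.
  have /cvgrPdist_lt/(_ ((2 * eta) ^+ n - vol 0)) := cvol 0.
  rewrite subr_gt0 => /(_ vol0) /nbhs_ballP[d /= d0' H]; exists d => // s /andP[s0 sd].
  have := H s; rewrite -ball_normE/= sub0r normrN gtr0_norm// => /(_ sd).
  by rewrite distrC ltr_norml => /andP[_]; rewrite ltrBlDr subrK.
(* the mesh is below d, and the summand 8 makes the inner radius of the shell,
   delta - 2 * s, nonnegative *)
pose M := (Num.truncn (4 * delta / d) + 8)%N.
have M0 : (0 < M)%N by rewrite /M addn_gt0 orbT.
have MR : 0 < M%:R :> R by rewrite ltr0n.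
have rho0 : 0 < 2 * delta by rewrite mulr_gt0.
set s := mesh (2 * delta) M.
have s0 : 0 < s by exact: mesh_gt0.
have sE : s = 4 * delta / M%:R by rewrite /s /mesh mulrA -natrM.
have sd : s < d.
  rewrite sE ltr_pdivrMr// [d * _]mulrC -ltr_pdivrMr// (lt_le_trans (truncnS_gt _))//.
  by rewrite ler_nat /M -addn1 leq_add2l.
have s2 : 2 * s <= delta.
  rewrite sE mulrA ler_pdivrMr//.
  have : delta * 8 <= delta * M%:R by rewrite ler_wpM2l ?(ltW d0)// ler_nat /M leq_addl.
  by move: (delta * M%:R) => u; lra.
have /dvol : 0 < s < d by rewrite s0.
apply/negP; rewrite -leNgt.
pose Q k := `[< exists2 x, grid_cell (n := n) (2 * delta) (M := M) k x & `|x| = delta >].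
have xk_ex k : exists x, Q k -> grid_cell (2 * delta) k x /\ `|x| = delta.
  have [/asboolP[x kx xd]|] := boolP (Q k); first by exists x.
  by exists 0.
have [xk xkP] := choice xk_ex.
pose D : set 'rV[R]_n := cube 0 (delta + s) `\` [set x | `|x| < delta - s].
have D'E : [set x : 'rV[R]_n | `|x| < delta - s] = ball (0 : 'rV[R]_n) (delta - s).
  by apply/seteqP; split => x; rewrite -ball_normE/= sub0r normrN.
have mD' : measurable [set x : 'rV[R]_n | `|x| < delta - s].
  by rewrite D'E; apply: open_measurable_rV; exact: ball_open.
have mD : measurable D by apply: measurableD => //; exact: measurable_cube.
have cellD k : Q k -> grid_cell (2 * delta) k `<=` D.
  move=> /xkP[kx xd] y ky; have yx := grid_cell_dist rho0 M0 ky kx.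
  split; rewrite /cube/=.
    by rewrite subr0 -{1}(subrK (xk k) y) (le_trans (ler_normD _ _))// xd addrC lerD2l.
  apply/negP; rewrite -leNgt lerBlDr -xd.
  by rewrite -{1}(subrK y (xk k)) (le_trans (ler_normD _ _))// addrC lerD2l distrC.
have count : (#|Q|%:R * s ^+ n <= (2 * (delta + s)) ^+ n - (2 * (delta - 2 * s)) ^+ n :> R).
  have := @grid_cell_sum_le _ n (2 * delta) M rho0 M0 Q D (cst 1%E) (fun=> 1) mD.
  rewrite integral_cst// mul1e => /(_ (measurable_cst _) (fun _ _ => lee01) cellD).
  move=> /(_ (fun _ _ _ _ => lexx _) (fun _ _ => ler01)).
  have -> : #|Q|%:R * s ^+ n = \sum_(k | Q k) 1 * s ^+ n.
    transitivity (\sum_(k | Q k) s ^+ n); first by rewrite sumr_const mulr_natl.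
    by apply: eq_bigr => k _; rewrite mul1r.
  move=> h; rewrite -lee_fin (le_trans h)//.
  have subD' : cube (0 : 'rV[R]_n) (delta - 2 * s) `<=` [set x : 'rV[R]_n | `|x| < delta - s].
    move=> x; rewrite /cube/= subr0 => /le_lt_trans; apply.
    by rewrite ltrD2l ltrN2 ltr_pMl// ltr1n.
  have D'sub : [set x : 'rV[R]_n | `|x| < delta - s] `<=` cube 0 (delta + s).
    move=> x; rewrite /cube/= subr0 => /ltW/le_trans; apply.
    by rewrite lerD2l (le_trans _ (ltW s0))// oppr_le0 ltW.
  have fin : (lebesgue_Rn (cube (0 : 'rV[R]_n) (delta + s)) < +oo)%E.
    by apply: lebesgue_compact_lty; exact: cube_compact.
  rewrite measureD//; last exact: measurable_cube.
  rewrite setIidr// EFinB.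
  rewrite -(lebesgue_cube (0 : 'rV[R]_n) (r := delta + s)) ?addr_ge0 ?(ltW d0) ?(ltW s0)//.
  rewrite -(lebesgue_cube (0 : 'rV[R]_n) (r := delta - 2 * s)) ?subr_ge0//.
  apply: leeB => //.
  by apply: le_measure => //; rewrite inE//; exact: measurable_cube.
have cover : cube (0 : 'rV[R]_n) eta `<=`
    \big[setU/set0]_(k <- index_enum _ | Q k) cube (P (xk k)) (C * s).
  move=> v; rewrite /cube/= subr0 => /onto[x xd <-].
  have [|k kx] := @grid_cell_cover _ _ (2 * delta) M rho0 M0 x.
    by rewrite xd ltr_pMl// ltr1n.
  rewrite -bigcup_seq_cond; exists k => /=.
    by rewrite mem_index_enum/=; apply/asboolP; exists x.
  have Qk : Q k by apply/asboolP; exists x.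
  have [kxk _] := xkP k Qk.
  by rewrite (le_trans (LP _ _))// ler_wpM2l// (grid_cell_dist rho0 M0 kx kxk).
have : (lebesgue_Rn (cube (0 : 'rV[R]_n) eta) <= \sum_(k | Q k) ((2 * (C * s)) ^+ n)%:E)%E.
  apply: le_trans (le_measure _ _ _ cover) _.
  - by rewrite inE; exact: measurable_cube.
  - by rewrite inE; apply: bigsetU_measurable => k _; exact: measurable_cube.
  apply: le_trans (measure_bigsetU_le _ _ _ _) _ => [k|]; first exact: measurable_cube.
  by apply: lee_sum => k _; rewrite -(lebesgue_cube (P (xk k)) (r := C * s)) ?(mulr_ge0 C0 (ltW s0)).
rewrite lebesgue_cube ?(ltW eta0)// sumEFin lee_fin => /le_trans; apply.
have -> : \sum_(k | Q k) (2 * (C * s)) ^+ n = (2 * C) ^+ n * (#|Q|%:R * s ^+ n).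
  by rewrite sumr_const -[LHS]mulr_natl [RHS]mulrCA -exprMn mulrA.
by rewrite /vol ler_wpM2l// exprn_ge0// mulr_ge0.
Qed.

End sphere_image.

Lemma within_continuous_comp_sub {R : realType} (U V W : normedModType R)
    (A : set U) (B : set V) (f : U -> V) (h : V -> W) :
  {within A, continuous f} -> (forall x, A x -> B (f x)) ->
  {within B, continuous h} -> {within A, continuous (h \o f)}.
Proof.
move=> /within_continuous_epsP cf AB /within_continuous_epsP ch.
apply/within_continuous_epsP => x Ax e e0.
have [d d0 hd] := ch _ (AB _ Ax) e e0.
have [d' d'0 fd] := cf x Ax d d0.
by exists d' => // y Ay xy; apply: hd; [exact: AB|exact: fd].
Qed.

Lemma continuous_rV {R : realType} n (T : topologicalType) (G : 'I_n -> T -> R) :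
  (forall i, continuous (G i)) -> continuous (fun x => \row_i G i x : 'rV[R]_n).
Proof.
move=> cG x; apply/cvgrPdist_lt => e e0.
have H (i : 'I_n) : \forall y \near x, `|G i x - G i y| < e.
  by have /cvgrPdist_lt := cG i x; apply.
have {}H := filter_forall (nbhs_filter x) H.
apply: filterS H => y Hy; rewrite rV_normr_lt//; apply/forallP => i.
by rewrite !mxE.
Qed.

Section radial_push.
Context {R : realType} {V : normedModType R} (c : V) (delta : R).
Hypothesis delta_gt0 : 0 < delta.

Definition radial_push (x : V) : V :=
  c + Num.max (delta * `|x - c|^-1) 1 *: (x - c).

Lemma radial_push_out x : delta <= `|x - c| -> radial_push x = x.
Proof.
move=> dx; have x0 : 0 < `|x - c| by exact: lt_le_trans dx.
rewrite /radial_push (_ : Num.max _ _ = 1); first by rewrite scale1r addrC subrK.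
by apply/max_idPr; rewrite ler_pdivrMr// mul1r.
Qed.

Lemma radial_push_in x : x != c -> `|x - c| < delta -> `|radial_push x - c| = delta.
Proof.
move=> xc dx; have x0 : 0 < `|x - c| by rewrite normr_gt0 subr_eq0.
rewrite /radial_push addrAC subrr add0r normrZ max_l; last first.
  by rewrite ler_pdivlMr// mul1r ltW.
by rewrite normrM normfV normr_id (gtr0_norm delta_gt0) divfK// gt_eqF.
Qed.

Lemma radial_push_continuous (A : set V) : ~ A c -> {within A, continuous radial_push}.
Proof.
move=> Ac; apply/continuous_in_subspaceT => x /set_mem Ax.
have xc : `|x - c| != 0 by rewrite normr_eq0 subr_eq0; apply: contra_notN Ac => /eqP<-.
have cB : (fun z => z - c) @ x --> x - c by apply: cvgB; [exact: cvg_id|exact: cvg_cst].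
apply: cvgD; first exact: cvg_cst.
apply: cvgZ => //.
have := @continuous_max R V (fun z => delta * `|z - c|^-1) (fun=> 1) x; apply.
  apply: cvgM; first exact: cvg_cst.
  by apply: cvgV => //; apply: cvg_norm.
exact: cvg_cst.
Qed.

End radial_push.

(** Suppose the image X of the cube misses a point c very close to [g y0]. Let
    G extend the inverse of g (shifted so that it vanishes at [g y0]). Pushing X
    radially off a small ball around c, and then applying a Lipschitz map close
    to G whose values on the small sphere avoid a suitable small vector v, gives
    a map on the cube that stays close to [y |-> y - y0] and yet differs from v
    everywhere, against the Poincare-Miranda theorem. *)
Theorem invariance_of_domain {R : realType} n (g : 'rV[R]_n -> 'rV[R]_n)
    (y0 : 'rV[R]_n) (r : R) : 0 < r ->
  {within cube y0 r, continuous g} ->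
  (forall y z, cube y0 r y -> cube y0 r z -> g y = g z -> y = z) ->
  nbhs (g y0) (g @` cube y0 r).
Proof.
move=> r0 cg injg; set Q := cube y0 r; set x0 := g y0; set X := g @` Q.
have Qy0 : Q y0 by rewrite /Q /cube/= subrr normr0 ltW.
have cQ : compact Q by exact: cube_compact.
have cX : compact X by exact: continuous_compact.
have [ginv ginvK] : exists ginv, forall y, Q y -> ginv (g y) = y.
  have H x : exists y, X x -> Q y /\ g y = x.
    have [[y Qy <-]|nX] := pselect (X x); first by exists y.
    by exists y0.
  have [ginv hP] := choice H; exists ginv => y Qy.
  have [|Qh gh] := hP (g y); first by exists y.
  exact: injg.
have ch : {within X, continuous ginv} by exact: compact_inverse_continuous.
have clX : closed X by apply: compact_closed => //; exact: norm_hausdorff.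
have H i : exists Gi : 'rV[R]_n -> R, continuous Gi /\
    forall x, X x -> Gi x = ginv x ord0 i - y0 ord0 i.
  have ci : {within X, continuous (fun x => ginv x ord0 i - y0 ord0 i : R^o)}.
    apply/within_continuous_epsP => x Xx e e0.
    have [d d0 Hd] := (within_continuous_epsP _ _).1 ch x Xx e e0.
    exists d => // y Xy xy; apply: le_lt_trans (Hd y Xy xy).
    by have := rV_coord_le (ginv x - ginv y) i; rewrite !mxE opprB addrA subrK.
  have [|Gi [eG cG _]] := continuous_bounded_extension pseudometric_normal clX r0 ci.
    move=> _ [y Qy <-]; rewrite ginvK//; apply: le_trans Qy.
    by have := rV_coord_le (y - y0) i; rewrite !mxE.
  by exists Gi; split => // x Xx; rewrite -eG ?inE.
have [Gi GiP] := choice H.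
pose G x : 'rV[R]_n := \row_i Gi i x.
have cG : continuous G by apply: continuous_rV => i; have [] := GiP i.
have GX y : Q y -> G (g y) = y - y0.
  move=> Qy; apply/rowP => i; rewrite !mxE; have [_ ->] := GiP i; last by exists y.
  by rewrite ginvK.
have Gx0 : G x0 = 0 by rewrite GX// subrr.
apply: contrapT => nint.
have [d0 d0_gt0 Gd0] : exists2 d, 0 < d & forall x, `|x0 - x| < d -> `|G x| < r / 4.
  have /cvgrPdist_lt/(_ (r / 4)) := cG x0.
  rewrite divr_gt0// => /(_ isT) /nbhs_ballP[d /= d_gt0 Hd]; exists d => // x xd.
  by have := Hd x; rewrite -ball_normE/= Gx0 sub0r normrN; apply.
pose delta := d0 / 3.
have delta0 : 0 < delta by rewrite divr_gt0.
have [c x0c nXc] : exists2 c, `|x0 - c| < delta & ~ X c.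
  apply: contrapT => nc; apply: nint; apply/nbhs_ballP; exists delta => //= c.
  rewrite -ball_normE/= => x0c; apply: contrapT => nXc; apply: nc; by exists c.
pose S1 := X `&` [set x | delta <= `|x - c|].
have cS1 : compact S1.
  apply: compact_closedI => //.
  rewrite (_ : [set x | _] = ~` ball c delta).
    by apply: open_closedC; exact: ball_open.
  by apply/seteqP; split=> z; rewrite -ball_normE/= distrC leNgt => /negP.
have G_neq0 x : S1 x -> G x != 0.
  move=> [[y Qy <-] /= gyc]; rewrite GX// subr_eq0; apply/eqP => yy0.
  by move: gyc; rewrite yy0 leNgt x0c.
have [eta eta0 etaG] : exists2 eta, 0 < eta & forall x, S1 x -> eta <= `|G x|.
  have [S10|/nonemptyPn S10] := pselect (S1 !=set0); last first.
    by exists 1 => // x; rewrite S10.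
  have cnG : {within S1, continuous (fun x => `|G x|)}.
    exact/within_continuous_norm/continuous_subspaceT.
  have [x /set_mem S1x xmin] := EVT_min_rV S10 cS1 cnG.
  exists `|G x|; first by rewrite normr_gt0 G_neq0.
  by move=> z S1z; apply: xmin; rewrite inE.
pose eta' := Num.min eta (r / 4) / 3.
have etam : 0 < Num.min eta (r / 4) by rewrite lt_min eta0 divr_gt0.
have eta'0 : 0 < eta' by rewrite divr_gt0.
have [eta'1 eta'2] : 2 * eta' < eta /\ 2 * eta' < r / 4.
  have h1 : Num.min eta (r / 4) <= eta by rewrite ge_min lexx.
  have h2 : Num.min eta (r / 4) <= r / 4 by rewrite ge_min lexx orbT.
  by rewrite /eta'; split; lra.
pose Y := X `|` cube c delta.
have cY : compact Y by apply: compactU => //; exact: cube_compact.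
have Y0 : Y !=set0 by exists x0; left; exists y0.
have [P [C [C0 LP PG]]] := lipschitz_approx cY Y0 (continuous_subspaceT cG) eta'0.
have [v [v_le Pv]] := lipschitz_sphere_image c C0 delta0 eta'0 LP.
pose Phi := radial_push c delta.
have cPhi : {within X, continuous Phi} by exact: radial_push_continuous.
have gX y : Q y -> X (g y) by move=> Qy; exists y.
pose F y := P (Phi (g y)) - v.
have cF : {within Q, continuous F}.
  apply/within_continuous_epsP => y Qy e e0.
  have C1 : 0 < C + 1 by rewrite ltr_wpDl.
  have [d dgt0 Hd] := (within_continuous_epsP _ _).1
    (within_continuous_comp_sub cg gX cPhi) y Qy (e / (C + 1)) (divr_gt0 e0 C1).
  exists d => // z Qz yz; rewrite /F opprB addrA subrK (le_lt_trans (LP _ _))//.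
  have := Hd z Qz yz; rewrite /= ltr_pdivlMr// => /(le_lt_trans _); apply.
  by rewrite mulrC ler_wpM2l// lerDl.
have near_id y : Q y -> `|F y - (y - y0)| < r.
  move=> Qy; rewrite -GX//; set x := g y; have Xx : X x by exact: gX.
  rewrite /F -/x; have [dx|dx] := leP delta `|x - c|.
    have := PG x (or_introl Xx); rewrite /Phi radial_push_out//.
    rewrite addrAC => h; apply: le_lt_trans (ler_normB _ _) _.
    by move: h v_le eta'2; move: (`|P x - G x|) (`|v|) (eta') => a b t; lra.
  have xc : x != c by apply: contra_notN nXc => /eqP<-.
  have hPhi := radial_push_in delta0 xc dx.
  have Phix0 : `|x0 - Phi x| < d0.
    rewrite (le_lt_trans (ler_distD c _ _))// [`|c - _|]distrC hPhi.
    by move: x0c; rewrite /delta; lra.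
  have xx0 : `|x0 - x| < d0.
    rewrite (le_lt_trans (ler_distD c _ _))// [`|c - _|]distrC.
    by move: x0c dx; rewrite /delta; lra.
  have := PG (Phi x) (or_intror _); rewrite /cube/= hPhi => /(_ (lexx _)).
  have := Gd0 _ Phix0; have := Gd0 _ xx0 => h1 h2 h3.
  have -> : P (Phi x) - v - G x = (P (Phi x) - G (Phi x)) + G (Phi x) - v - G x.
    by rewrite subrK.
  apply: le_lt_trans (ler_normB _ _) _.
  apply: le_lt_trans (lerD (ler_normB _ _) (lexx _)) _.
  apply: le_lt_trans (lerD (lerD (ler_normD _ _) (lexx _)) (lexx _)) _.
  move: h1 h2 h3 v_le eta'2.
  move: (`|G x|) (`|G (Phi x)|) (`|P (Phi x) - G (Phi x)|) (`|v|) (eta').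
  by move=> a b d e t; lra.
have [||y Qy Fy0] := poincare_miranda r0 cF.
- move=> y i Qy yi; have := le_lt_trans (rV_coord_le _ i) (near_id y Qy).
  move: (F y) => u; rewrite !mxE yi ltr_norml => /andP[].
  by move: (u ord0 i) (y0 ord0 i) => a b; lra.
- move=> y i Qy yi; have := le_lt_trans (rV_coord_le _ i) (near_id y Qy).
  move: (F y) => u; rewrite !mxE yi ltr_norml => /andP[].
  by move: (u ord0 i) (y0 ord0 i) => a b; lra.
move/eqP: Fy0; rewrite /F subr_eq0 => /eqP PPhi.
have Xx := gX _ Qy.
have [dx|dx] := leP delta `|g y - c|.
  have PGx := PG _ (or_introl Xx).
  have := etaG (g y) (conj Xx dx).
  move: PPhi; rewrite /Phi radial_push_out// => Pgy.
  have : `|G (g y)| <= eta' + eta'.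
    rewrite -{1}(subKr (P (g y)) (G (g y))) {1}Pgy.
    by rewrite (le_trans (ler_normB _ _))// lerD.
  by move: eta'1; move: (`|_|) (eta') => a t; lra.
have xc : g y != c by apply: contra_notN nXc => /eqP<-.
have := Pv (Phi (g y)) (radial_push_in delta0 xc dx).
by rewrite PPhi eqxx.
Qed.

(** By invariance of domain, the images under [g] of small cubes around [y] are
    neighbourhoods of [g y]. *)
Lemma open_inverse_continuous {R : realType} n (D : set 'rV[R]_n)
    (g f : 'rV[R]_n -> 'rV[R]_n) :
  open D -> {within D, continuous g} -> (forall y, D y -> f (g y) = y) ->
  {within g @` D, continuous f}.
Proof.
move=> oD cg fg; apply/within_continuous_epsP => _ [y Dy <-] e e0.
have /nbhs_ballP[r /= r0 rD] : nbhs y D by exact: open_nbhs_nbhs.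
pose s := Num.min (r / 2) (e / 2).
have s0 : 0 < s by rewrite lt_min !divr_gt0.
have QD : cube y s `<=` D.
  move=> z yz; apply: rD; rewrite -ball_normE/= distrC (le_lt_trans yz)//.
  by rewrite gt_min ltr_pdivrMr// ltr_pMr// ltr1n.
have injg z w : cube y s z -> cube y s w -> g z = g w -> z = w.
  by move=> /QD Dz /QD Dw gzw; rewrite -(fg z)// gzw fg.
have /nbhs_ballP[d /= d0 dQ] :=
  invariance_of_domain s0 (continuous_subspaceW QD cg) injg.
exists d => // _ [z Dz <-] gyz.
have [|w Qw gw] := dQ (g z); first by rewrite -ball_normE.
rewrite -gw (fg _ Dy) (fg _ (QD _ Qw)) distrC (le_lt_trans Qw)// gt_min; apply/orP; right.
by rewrite ltr_pdivrMr// ltr_pMr// ltr1n.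
Qed.

(** * Compactly supported functions *)

Section thickening.
Context {R : realType} {n : nat}.
Implicit Types (K U : set 'rV[R]_n).

(** [K'] is the Minkowski sum of [K] and a small cube. *)
Lemma compact_thicken K U : compact K -> open U -> K `<=` U ->
  exists d, exists K', [/\ 0 < d, compact K', K' `<=` U &
    forall x y, K x -> `|x - y| <= d -> K' y].
Proof.
move=> cK oU KU.
have [d d0 dU] : exists2 d, 0 < d & forall x y, K x -> `|x - y| < d -> U y.
  have := (compact_near_coveringP K).1 cK R (0^'+)
    (fun d x => forall y, `|x - y| < d -> U y) _.
  move=> []; last first.
    move=> d [/= d0 /= H]; exists (d / 2); first by rewrite divr_gt0.
    move=> x y Kx xy; apply: (H (d / 2) _ _ x) => //=; last by rewrite divr_gt0.
    by rewrite distrC subr0 gtr0_norm ?divr_gt0// ltr_pdivrMr// ltr_pMr// ltr1n.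
  move=> x Kx.
  have /nbhs_ballP[d /= d0 H] : nbhs x U by apply: open_nbhs_nbhs; split => //; exact: KU.
  exists (ball x (d / 2), [set t | 0 < t < d / 2]) => /=.
    split; first by apply: nbhsx_ballx; rewrite divr_gt0.
    near=> t; apply/andP; split; near: t; first exact: nbhs_right_gt.
    by apply: nbhs_right_lt; rewrite divr_gt0.
  move=> [z t]/= []; rewrite -ball_normE/= => xz /andP[t0 td] y zy.
  apply: H; rewrite -ball_normE/= (splitr d) (le_lt_trans (ler_distD z _ _))// ltrD//.
  exact: lt_trans zy td.
pose K' := (fun p : 'rV[R]_n * 'rV[R]_n => p.1 + p.2) @` (K `*` cube 0 (d / 2)).
exists (d / 2), K'; split.
- by rewrite divr_gt0.
- apply: continuous_compact; last by apply: compact_setX => //; exact: cube_compact.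
  by apply: continuous_subspaceT => p; exact: add_continuous.
- move=> z [[x v]/= [Kx]]; rewrite /cube/= subr0 => vd <-; apply: (dU x) => //.
  rewrite opprD addNKr normrN (le_lt_trans vd)//.
  by rewrite ltr_pdivrMr// ltr_pMr// ltr1n.
- move=> x y Kx xy; exists (x, y - x) => /=; last by rewrite addrC subrK.
  by split => //; rewrite /cube/= subr0 distrC.
Unshelve. all: by end_near. Qed.

Lemma compact_support_unif (phi : 'rV[R]_n -> R) K : compact K -> continuous phi ->
  (forall x, ~ K x -> phi x = 0) ->
  forall e, 0 < e -> exists2 d, 0 < d &
    forall x y, `|x - y| < d -> `|phi x - phi y| < e.
Proof.
move=> cK cphi K0 e e0.
have [d1 [K' [d10 cK' _ KK']]] := compact_thicken cK openT (@subsetT _ K).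
have [d d0 H] := compact_unif_continuous cK' (continuous_subspaceT cphi) e0.
exists (Num.min d1 d); first by rewrite lt_min d10.
move=> x y; rewrite lt_min => /andP[xy1 xy].
have [Kx|nKx] := pselect (K x).
  by apply: H => //; apply: (KK' x) => //; [rewrite subrr normr0 ltW|exact: ltW].
have [Ky|nKy] := pselect (K y).
  by apply: H => //; apply: (KK' y) => //; [rewrite distrC ltW|rewrite subrr normr0 ltW].
by rewrite !K0// subrr normr0.
Qed.

Lemma compact_rV_norm_lt K : compact K -> exists2 M, 0 < M & forall x, K x -> `|x| < M.
Proof.
move=> cK; have [M [_ MK]] := compact_bounded cK.
exists (`|M| + 2); first by rewrite ltr_wpDl.
move=> x Kx; apply: (@le_lt_trans _ _ (`|M| + 1)); last by rewrite ltrD2l ltr1n.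
by apply: MK => //; rewrite (le_lt_trans (ler_norm M))// ltrDl.
Qed.

Lemma continuous_compact_bounded (phi : 'rV[R]_n -> R) K : compact K ->
  {within K, continuous phi} -> exists2 B, 0 < B & forall x, K x -> `|phi x| <= B.
Proof.
move=> cK cphi; have [B0 [_ Bu]] := compact_bounded (continuous_compact cphi cK).
exists (`|B0| + 1); first by rewrite ltr_wpDl.
by move=> x Kx; apply: Bu; [rewrite (le_lt_trans (ler_norm B0))// ltrDl|exists x].
Qed.

End thickening.

Section bounded_support.
Context {d : measure_display} {T : measurableType d} {R : realType}.
Implicit Types (mu : {measure set T -> \bar R}) (D : set T) (u : T -> R).

Lemma measurable_fun_support D u : measurable D -> measurable_fun D u ->
  (forall x, ~ D x -> u x = 0) -> measurable_fun setT u.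
Proof.
move=> mD mDu u0; rewrite -(setvU D); apply/measurable_funU => //.
  exact: measurableC.
split=> //; have : measurable_fun (~` D) (cst 0 : T -> R) by exact: measurable_cst.
by apply: eq_measurable_fun => x /set_mem /u0 ->.
Qed.

Lemma integrable_support mu D u (B : R) : measurable D -> (mu D < +oo)%E ->
  measurable_fun setT u -> (forall x, `|u x| <= B) ->
  (forall x, ~ D x -> u x = 0) -> mu.-integrable setT (EFin \o u).
Proof.
move=> mD muD mu_u uB u0.
have E : EFin \o u = (EFin \o u) \_ D.
  apply/funext => x; rewrite patchE; case: ifPn => // /negP xD /=.
  by rewrite u0// => Dx; apply: xD; rewrite inE.
rewrite E -integrable_mkcond//.
apply: measurable_bounded_integrable => //; first exact: measurable_funTS.
exists B; split; first exact: num_real.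
by move=> M BM x Dx /=; apply: (le_trans (uB x)); exact: ltW.
Qed.

Lemma Rintegral_support mu D u : measurable D ->
  (forall x, ~ D x -> u x = 0) ->
  \int[mu]_(x in D) u x = \int[mu]_x u x.
Proof.
move=> mD u0; rewrite Rintegral_mkcond; apply: eq_Rintegral => x _.
by rewrite patchE; case: ifPn => // /negP xD; rewrite u0// => Dx; apply: xD; rewrite inE.
Qed.

End bounded_support.

(** * The basic estimate *)

Section grid_variation.
Context {R : realType} {n : nat} (rho : R) (M : nat).
Hypotheses (rho_gt0 : 0 < rho) (M_gt0 : (0 < M)%N).
Local Notation mesh := (mesh rho M).

(** By the intermediate value theorem, the cells met by the curve project onto
    intervals covering the segment between the two coordinates. *)
Lemma grid_variation (gam : R -> 'rV[R]_n) (i : 'I_n) (s : R)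
    (T : pred {ffun 'I_n -> 'I_M}) :
  0 <= s -> {within `[0, s], continuous (fun t => gam t ord0 i)} ->
  (forall t, 0 <= t <= s -> `|gam t| < rho) ->
  (forall t k, 0 <= t <= s -> grid_cell rho k (gam t) -> T k) ->
  `|gam s ord0 i - gam 0 ord0 i| <= mesh * #|T|%:R.
Proof.
move=> s0 cgam grho gT; set u := fun t => gam t ord0 i.
rewrite -/(u s) -/(u 0) in cgam *.
pose a := Num.min (u 0) (u s); pose b := Num.max (u 0) (u s).
have ab : a <= b by rewrite ge_min !le_max lexx.
have -> : `|u s - u 0| = b - a.
  rewrite /a /b; case: (leP (u 0) (u s)) => h; first by rewrite ger0_norm// subr_ge0.
  by rewrite ltr0_norm ?subr_lt0// opprB.
pose J (k : {ffun 'I_n -> 'I_M}) : set R :=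
  `[- rho + mesh * (k i)%:R, - rho + mesh * (k i).+1%:R[%classic.
have cover : `[a, b]%classic `<=`
    \big[setU/set0]_(k <- index_enum _ | T k) J k.
  move=> v /=; rewrite in_itv/= => avb.
  have [t /[!in_itv]/= t0s uv] := IVT s0 cgam avb.
  have [k kt] := grid_cell_cover rho_gt0 M_gt0 (grho t t0s).
  rewrite -bigcup_seq_cond; exists k => /=.
    by rewrite mem_index_enum/=; exact: gT t0s kt.
  by rewrite -uv; exact: kt.
have mJ k : measurable (J k) by exact: measurable_itv.
have lJ k : lebesgue_measure (J k) = mesh%:E.
  rewrite lebesgue_itvE; first by congr (_%:E); rewrite -natr1; ring.
  by rewrite lerD2l ler_pM2l ?mesh_gt0// ler_nat.
rewrite -lee_fin -(lebesgue_itvE true false ab).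
apply: (@le_trans _ _ (lebesgue_measure
    (\big[setU/set0]_(k <- index_enum _ | T k) J k))).
  apply: le_measure => //; rewrite inE; first exact: measurable_itv.
  by apply: bigsetU_measurable => k _; exact: mJ.
apply: le_trans (measure_bigsetU_le lebesgue_measure _ _ _) _ => [k|].
  exact: mJ.
rewrite (eq_bigr (fun=> mesh%:E)) => [|k _]; last exact: lJ.
by rewrite sumEFin sumr_const mulr_natr.
Qed.

End grid_variation.

Lemma integral_sum_indic d (T : measurableType d) (R : realType)
    (mu : {measure set T -> \bar R}) (I : Type) (s : seq I) (P : pred I)
    (c : I -> R) (B : I -> set T) (b : I -> R) :
  (forall k, P k -> 0 <= c k) -> (forall k, measurable (B k)) ->
  (forall k, mu (B k) = (b k)%:E) ->
  (\int[mu]_x (\sum_(k <- s | P k) c k * \1_(B k) x)%:E =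
   (\sum_(k <- s | P k) c k * b k)%:E)%E.
Proof.
move=> c0 mB muB.
under eq_integral do rewrite -sumEFin big_mkcond.
have h k x : (0 <= if P k then (c k * \1_(B k) x)%:E else 0)%E.
  by case: ifP => // Pk; rewrite lee_fin mulr_ge0 ?c0.
rewrite ge0_integral_sum//; last first.
  move=> k; case: (P k); last exact: measurable_cst.
  by apply/measurable_EFinP; apply: measurable_funM.
rewrite -sumEFin [RHS]big_mkcond; apply: eq_bigr => k _.
case: ifPn => [Pk|_]; last by rewrite integral0.
under eq_integral do rewrite EFinM.
rewrite ge0_integralZl_EFin ?c0//.
  by rewrite integral_indic// setIT muB EFinM.
by apply/measurable_EFinP.
Qed.

Section directional.
Context {R : realType} {V : normedModType R}.

Lemma is_derive_line (phi : V -> R) (v x : V) (t : R) (df : R) :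
  is_derive (x + t *: v) v phi df ->
  is_derive t 1 (fun t => phi (x + t *: v)) df.
Proof.
move=> [dphi vphi].
have E : (fun h : R => h^-1 *: (phi (x + (h *: 1 + t) *: v) - phi (x + t *: v))) =
    (fun h => h^-1 *: (phi (h *: v + (x + t *: v)) - phi (x + t *: v))).
  apply/funext => h; rewrite [h *: 1]mulr1 scalerDl.
  by congr (_ *: (phi _ - _)); rewrite addrCA.
split; first by rewrite /derivable/= E.
by rewrite -vphi /derive/= E.
Qed.

Lemma difference_quotient_close (phi psi : V -> R) (v x : V) (s w : R) :
  0 < s -> (forall z, is_derive z v phi (psi z)) ->
  (forall t, 0 <= t <= s -> `|psi (x - t *: v) - psi x| <= w) ->
  `|(phi x - phi (x - s *: v)) / s - psi x| <= w.
Proof.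
move=> s0 dphi psiw.
pose F t := phi (x - s *: v + t *: v).
have dF (t : R) : is_derive t 1 F (psi (x - s *: v + t *: v)) by exact: is_derive_line.
have [c /[!in_itv]/= /andP[c0 cs] Fc] : exists2 c, c \in `]0, s[ &
    F s - F 0 = psi (x - s *: v + c *: v) * (s - 0).
  apply: MVT => //.
  apply: derivable_within_continuous => t _; have := dF t => -[] //.
move: Fc; rewrite /F subrK scale0r addr0 subr0 => ->.
rewrite mulfK ?gt_eqF//.
rewrite -addrA -scaleNr -scalerDl (_ : - s + c = - (s - c)); last by ring.
rewrite scaleNr; apply: psiw; rewrite subr_ge0 (ltW cs)/=.
by rewrite lerBlDr lerDl ltW.
Qed.

End directional.

Lemma delta_norm_le {R : realType} n (j : 'I_n) :
  `|delta_mx ord0 j : 'rV[R]_n| <= 1.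
Proof.
rewrite rV_normr_le//; apply/forallP => i; rewrite mxE.
by case: (_ && _); rewrite ?normr1// normr0.
Qed.

Lemma continuous_subr_cst {R : realType} (V : normedModType R) (v : V) :
  continuous (fun x => x - v).
Proof. by move=> x; apply: cvgB; [exact: cvg_id|exact: cvg_cst]. Qed.

Lemma continuous_line {R : realType} (V : normedModType R) (x v : V) :
  continuous (fun t : R => x + t *: v).
Proof.
move=> t; apply: cvgD; first exact: cvg_cst.
by apply: cvgZ; [exact: cvg_id|exact: cvg_cst].
Qed.

Section weak_derivative_bound.
Context {R : realType} {n : nat}.
Variables (Omega1 Omega2 : set 'rV[R]_n) (f g : 'rV[R]_n -> 'rV[R]_n) (L : R).
Hypotheses (openO1 : open Omega1) (openO2 : open Omega2) (L_ge0 : 0 <= L).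
Hypothesis lip_g : forall y z, Omega2 y -> Omega2 z ->
  `|g y - g z| <= L * `|y - z|.
Hypothesis fO : forall x, Omega1 x -> Omega2 (f x).
Hypothesis gf : forall x, Omega1 x -> g (f x) = x.
Hypothesis cf : {within Omega1, continuous f}.

Let cfi i : {within Omega1, continuous (fun x => f x ord0 i)}.
Proof.
apply/within_continuous_epsP => x Ax e e0.
have [d d0 H] := (within_continuous_epsP _ _).1 cf x Ax e e0.
exists d => // y Ay xy; apply: le_lt_trans (H y Ay xy).
by have := rV_coord_le (f x - f y) i; rewrite !mxE.
Qed.

(** The volume of a cube of radius (L + 1) s is this constant times that of a grid
    cell of size s. *)
Definition growth_const : R := (2 * (L + 1)) ^+ n.

Lemma growth_const_gt0 : 0 < growth_const.
Proof. by rewrite exprn_gt0// mulr_gt0// ltr_wpDl. Qed.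

Lemma lip_g_continuous : {within Omega2, continuous g}.
Proof.
apply/within_continuous_epsP => y Oy e e0.
have L1 : 0 < L + 1 by rewrite ltr_wpDl.
exists (e / (L + 1)); first by rewrite divr_gt0.
move=> z Oz; rewrite ltr_pdivlMr// => yz; apply: le_lt_trans yz.
by rewrite (le_trans (lip_g Oy Oz))// mulrC ler_wpM2l// lerDl.
Qed.

Lemma component_mul_integrable (i : 'I_n) (w : 'rV[R]_n -> R) K : compact K ->
  K `<=` Omega1 -> continuous w -> (forall x, ~ K x -> w x = 0) ->
  lebesgue_Rn.-integrable setT (EFin \o (fun x => f x ord0 i * w x)).
Proof.
move=> cK KO cw w0.
have [Bf Bf0 fB] := continuous_compact_bounded cK (continuous_subspaceW KO (@cfi i)).
have [Bw Bw0 wB] := continuous_compact_bounded cK (continuous_subspaceT cw).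
apply: (@integrable_support _ _ _ lebesgue_Rn K _ (Bf * Bw)).
- exact: compact_measurable_rV.
- exact: lebesgue_compact_lty.
- apply: (@measurable_fun_support _ _ _ Omega1).
  + exact: open_measurable_rV.
  + apply: measurable_funM; first by apply: within_continuous_measurable_R.
    by apply: measurable_funTS; exact: continuous_measurable_R.
  + by move=> x nO; rewrite w0 ?mulr0// => /KO.
- move=> x; have [Kx|nKx] := pselect (K x).
    by rewrite normrM ler_pM ?fB ?wB.
  by rewrite w0// mulr0 normr0 mulr_ge0// ltW.
- by move=> x nK; rewrite w0 ?mulr0.
Qed.

(** Replace the derivative of [phi] by a difference quotient of step s, move it
    to [f] by translation invariance, and bound the increments of [f] by s times
    the number of grid cells of size s met by the image of the segment. A given
    cell Q is met only if x lies in a cube of side O(s) around the point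
    g(Q), so that summing over the cells produces a Riemann sum for the integral
    of |phi o g|. *)
Theorem weak_derivative_bound (i j : 'I_n) (phi psi : 'rV[R]_n -> R) K :
  compact K -> K `<=` Omega1 -> continuous phi -> continuous psi ->
  (forall x, is_derive x (delta_mx ord0 j) phi (psi x)) ->
  (forall x, ~ K x -> phi x = 0) -> (forall x, ~ K x -> psi x = 0) ->
  (`| \int[lebesgue_Rn]_x (f x ord0 i * psi x) |%:E <=
   growth_const%:E * \int[lebesgue_Rn]_(y in Omega2) `|phi (g y)|%:E)%E.
Proof.
move=> cK KO cphi cpsi dphi phi0 psi0; set C := growth_const.
have C0 : 0 < C by exact: growth_const_gt0.
set e : 'rV[R]_n := delta_mx ord0 j.
have e1 : `|e| <= 1 by exact: delta_norm_le.
have te (t s : R) : 0 <= t <= s -> `|t *: e| <= s.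
  move=> /andP[t0 ts]; rewrite normrZ ger0_norm// (le_trans _ ts)//.
  by rewrite ler_piMr.
apply/lee_addgt0Pr => eta eta0.
have [d1 [K1 [d1_gt0 cK1 K1O KK1]]] := compact_thicken cK openO1 KO.
have sKK1 : K `<=` K1 by move=> x Kx; apply: (KK1 x) => //; rewrite subrr normr0 ltW.
have cfK1 : compact (f @` K1).
  by apply: continuous_compact => //; exact: continuous_subspaceW cf.
have fK1O : f @` K1 `<=` Omega2 by move=> _ [x K1x <-]; apply: fO; exact: K1O.
have [d2 [K2 [d2_gt0 cK2 K2O fKK2]]] := compact_thicken cfK1 openO2 fK1O.
have [rho rho0 K2rho] := compact_rV_norm_lt cK2.
have fK1K2 x : K1 x -> K2 (f x).
  by move=> K1x; apply: (fKK2 (f x)); [exists x|rewrite subrr normr0 ltW].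
have [Bf Bf0 fB] := continuous_compact_bounded cK1 (continuous_subspaceW K1O (@cfi i)).
have mK1 := compact_measurable_rV cK1; have mK2 := compact_measurable_rV cK2.
have lK1 := lebesgue_compact_lty cK1; have lK2 := lebesgue_compact_lty cK2.
set V1 := fine (lebesgue_Rn K1); set V2 := fine (lebesgue_Rn K2).
have V1_ge0 : 0 <= V1 by rewrite fine_ge0.
have V2_ge0 : 0 <= V2 by rewrite fine_ge0.
have V2E : lebesgue_Rn K2 = V2%:E by rewrite fineK// ge0_fin_numE.
(* om and om' make each of the two error terms below at most eta / 2, and the
   step s < m0 is small enough for the uniform continuity of phi and psi and for
   the thickened compact sets *)
pose om := eta / (4 * C * (V2 + 1)).
have om0 : 0 < om by rewrite divr_gt0 ?mulr_gt0// ltr_wpDl.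
pose om' := eta / (2 * (Bf * V1 + 1)).
have BV0 : 0 <= Bf * V1 by rewrite mulr_ge0// ltW.
have om'0 : 0 < om' by rewrite divr_gt0 ?mulr_gt0// ltr_wpDl.
have [dphi0 dphi_gt0 uphi] := compact_support_unif cK cphi phi0 om0.
have [dpsi0 dpsi_gt0 upsi] := compact_support_unif cK cpsi psi0 om'0.
pose m0 := Num.min (Num.min d1 d2) (Num.min (dphi0 / (L + 2)) dpsi0).
have m00 : 0 < m0 by rewrite !lt_min d1_gt0 d2_gt0 dpsi_gt0 andbT/= divr_gt0// ltr_wpDl.
pose M := (Num.truncn (2 * rho / m0)).+1.
have M0 : (0 < M)%N by [].
set s := mesh rho M.
have s0 : 0 < s by exact: mesh_gt0.
have sm0 : s < m0.
  by rewrite /s /mesh ltr_pdivrMr ?ltr0n// [m0 * _]mulrC -ltr_pdivrMr// truncnS_gt.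
move: sm0; rewrite !lt_min => /andP[/andP[sd1 sd2] /andP[sphi spsi]].
have {}sphi : (L + 2) * s < dphi0 by rewrite mulrC -ltr_pdivlMr// ltr_wpDl.
have K1shift x t : K x -> 0 <= t <= s -> K1 (x + t *: e).
  move=> Kx ts; apply: (KK1 x) => //; rewrite opprD addNKr normrN.
  by rewrite (le_trans (te _ _ ts))// ltW.
pose a (x : 'rV[R]_n) := f x ord0 i * phi x.
pose b (x : 'rV[R]_n) := f x ord0 i * phi (x - s *: e).
pose b' (x : 'rV[R]_n) := f (x + s *: e) ord0 i * phi x.
have ss : 0 <= s <= s by rewrite lexx ltW.
have phis0 x : ~ K1 x -> phi (x - s *: e) = 0.
  move=> nK1; apply: phi0 => Kx; apply: nK1.
  by rewrite -(subrK (s *: e) x); exact: K1shift.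
have cphis : continuous (fun x : 'rV[R]_n => phi (x - s *: e)).
  move=> x; apply: (continuous_comp (f := fun x : 'rV[R]_n => x - s *: e)).
    exact: continuous_subr_cst.
  exact: cphi.
have ia : lebesgue_Rn.-integrable setT (EFin \o a).
  exact: (@component_mul_integrable i phi K).
have ib : lebesgue_Rn.-integrable setT (EFin \o b).
  exact: (@component_mul_integrable i (fun x => phi (x - s *: e)) K1).
have iu1 : lebesgue_Rn.-integrable setT (EFin \o (fun x => f x ord0 i * psi x)).
  exact: (@component_mul_integrable i psi K).
have b'E : EFin \o b' = (fun x : 'rV[R]_n => (EFin \o b) (x + s *: e)).
  by apply/funext => x; rewrite /b' /b/= addrK.
have [ib' intb'] := integral_shift (s *: e) ib.
rewrite -b'E in ib' intb'.
have Rintb' : \int[lebesgue_Rn]_x b' x = \int[lebesgue_Rn]_x b x.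
  by rewrite /Rintegral; congr fine.
pose u2 x := (a x - b x) * s^-1.
pose u3 x := (b' x - a x) * s^-1.
have iab : lebesgue_Rn.-integrable setT (EFin \o (fun x => a x - b x)).
  by apply: (@integrableB _ _ _ _ _ _ (EFin \o a) (EFin \o b)).
have iba : lebesgue_Rn.-integrable setT (EFin \o (fun x => b' x - a x)).
  by apply: (@integrableB _ _ _ _ _ _ (EFin \o b') (EFin \o a)).
have iu2 : lebesgue_Rn.-integrable setT (EFin \o u2).
  have := integrableZr measurableT s^-1 iab; exact: eq_integrable.
have iu3 : lebesgue_Rn.-integrable setT (EFin \o u3).
  have := integrableZr measurableT s^-1 iba; exact: eq_integrable.
have u23 : \int[lebesgue_Rn]_x u2 x = - \int[lebesgue_Rn]_x u3 x.
  rewrite /u2 /u3 !RintegralZr// !RintegralB// Rintb'; ring.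
(* by the mean value theorem the quotient is uniformly close to psi on K1 *)
have step1 : `| \int[lebesgue_Rn]_x (f x ord0 i * psi x) - \int[lebesgue_Rn]_x u2 x |
    <= eta / 2.
  have idiff : lebesgue_Rn.-integrable setT (EFin \o (fun x => f x ord0 i * psi x - u2 x)).
    by apply: (@integrableB _ _ _ _ _ _ (EFin \o (fun x => f x ord0 i * psi x)) (EFin \o u2)).
  rewrite -RintegralB//.
  apply: le_trans (le_normr_Rintegral measurableT idiff) _.
  have u2E x : f x ord0 i * psi x - u2 x =
      f x ord0 i * (psi x - (phi x - phi (x - s *: e)) / s).
    by rewrite /u2 /a /b; ring.
  have u20 x : ~ K1 x -> f x ord0 i * psi x - u2 x = 0.
    move=> nK1; have nK : ~ K x by move=> /sKK1.
    by rewrite u2E psi0// phi0// phis0// subrr mul0r subrr mulr0.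
  rewrite -(@Rintegral_support _ _ _ lebesgue_Rn K1) => [|//|x nK1]; last by rewrite u20// normr0.
  have idiffK1 : lebesgue_Rn.-integrable K1 (EFin \o (fun x => `|f x ord0 i * psi x - u2 x|)).
    by apply: (integrableS measurableT) => //; exact: integrable_norm.
  apply: (@le_trans _ _ (\int[lebesgue_Rn]_(x in K1) (Bf * om'))).
    apply: le_Rintegral => //.
      apply: measurable_bounded_integrable => //.
      by exists `|Bf * om'|; split; [exact: num_real|move=> ? /ltW ? ? _].
    move=> x K1x; rewrite u2E normrM ler_pM//; first exact: fB.
    rewrite distrC; apply: difference_quotient_close => // t ts.
    apply/ltW/upsi; rewrite addrC addKr normrN.
    by rewrite (le_lt_trans (te _ _ ts)).
  rewrite Rintegral_cst// -/V1 /om' mulrAC mulrA.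
  rewrite ler_pdivrMr ?mulr_gt0 ?ltr_wpDl//.
  rewrite (_ : eta / 2 * _ = eta * (Bf * V1 + 1)); last by field.
  by rewrite mulrC ler_wpM2l ?(ltW eta0)// lerDl.
(* P selects the cells met by f(K1), and yk k is a point of f(K1) in the cell k;
   om absorbs the oscillation of phi on the cube B k *)
pose P (k : {ffun 'I_n -> 'I_M}) := `[< exists2 y, (f @` K1) y & grid_cell rho k y >].
have yk_ex k : exists y, P k -> (f @` K1) y /\ grid_cell rho k y.
  have [/asboolP[y ? ?]|] := boolP (P k); first by exists y.
  by exists 0.
have [yk ykP] := choice yk_ex.
pose c k := `|phi (g (yk k))| + om.
have c0 k : 0 <= c k by rewrite addr_ge0// ltW.
pose B k : set 'rV[R]_n := cube (g (yk k)) ((L + 1) * s).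
have L1s : 0 <= (L + 1) * s by rewrite mulr_ge0 ?addr_ge0// ltW.
have mB k : measurable (B k) by exact: measurable_cube.
have muB k : lebesgue_Rn (B k) = (C * s ^+ n)%:E.
  by rewrite lebesgue_cube// mulrA exprMn.
have cellK2 k : P k -> grid_cell rho k `<=` K2.
  move=> /ykP[fy ky] y yky; apply: (fKK2 (yk k)) => //.
  by rewrite (le_trans (grid_cell_dist rho0 M0 ky yky))// ltW.
have step3 x : `|u3 x| <= \sum_(k | P k) c k * \1_(B k) x.
  have [Kx|nKx] := pselect (K x); last first.
    rewrite /u3 /b' /a phi0// !mulr0 subrr mul0r normr0 sumr_ge0// => k _.
    by rewrite mulr_ge0.
  pose gam t := f (x + t *: e).
  pose T (k : {ffun 'I_n -> 'I_M}) :=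
    `[< exists2 t, 0 <= t <= s & grid_cell rho k (gam t) >].
  have cgam : {within `[0, s], continuous (fun t => gam t ord0 i)}.
    have cline : {within `[0, s], continuous (fun t : R => x + t *: e)}.
      by apply: continuous_subspaceT; exact: continuous_line.
    have lineO (t : R) : `[0, s]%classic t -> Omega1 (x + t *: e).
      by rewrite /= in_itv/= => ts; apply: K1O; exact: K1shift.
    exact: (within_continuous_comp_sub (U := R^o) (W := R^o) cline lineO (@cfi i)).
  have := @grid_variation _ _ rho M rho0 M0 gam i s T (ltW s0) cgam.
  move=> /(_ _ _)/wrap[].
    by move=> t ts; apply: K2rho; apply: fK1K2; exact: K1shift.
    by move=> t k ts kt; apply/asboolP; exists t.
  rewrite -/s /gam scale0r addr0 => incr.
  have -> : u3 x = phi x * ((f (x + s *: e) ord0 i - f x ord0 i) / s).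
    by rewrite /u3 /b' /a; ring.
  rewrite normrM normrM normfV (gtr0_norm s0).
  apply: (@le_trans _ _ (`|phi x| * #|T|%:R)).
    by rewrite ler_wpM2l// ler_pdivrMr// mulrC.
  rewrite mulr_natr -sumr_const.
  rewrite [leLHS]big_mkcond [leRHS]big_mkcond; apply: ler_sum => k _.
  have [/asboolP[t ts kt]|_] := boolP (k \in T); last first.
    by case: ifP => // _; rewrite mulr_ge0.
  have Pk : P k by apply/asboolP; exists (gam t) => //; exists (x + t *: e) => //; exact: K1shift.
  rewrite Pk; have [fyk kyk] := ykP k Pk.
  have O2yk : Omega2 (yk k) by exact: fK1O.
  have xB : `|x - g (yk k)| <= (L + 1) * s.
    rewrite -(addrK (t *: e) x) addrAC (le_trans (ler_normB _ _))//.
    rewrite mulrDl mul1r lerD//; last exact: te.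
    rewrite -{1}(gf (K1O _ (K1shift _ _ Kx ts))).
    have O1t : Omega1 (x + t *: e) by apply: K1O; exact: K1shift.
    rewrite (le_trans (lip_g (fO O1t) O2yk))// ler_wpM2l//.
    exact: (grid_cell_dist rho0 M0 kt kyk).
  rewrite indicE mem_set// mulr1 /c -lerBlDl (le_trans (lerB_dist _ _))//.
  apply/ltW/uphi; rewrite (le_lt_trans xB)// (le_lt_trans _ sphi)//.
  by rewrite ler_wpM2r ?(ltW s0)// lerD2l ler1n.
(* up to 2 om, c k is a lower bound of |phi o g| on the cell k *)
have mphig : measurable_fun Omega2 (fun y => `|phi (g y)|%:E).
  apply/measurable_EFinP; apply: measurableT_comp => //.
  apply: measurableT_comp; first exact: continuous_measurable_R.
  exact: within_continuous_measurable_rV lip_g_continuous.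
have step4 : ((\sum_(k | P k) c k * s ^+ n)%:E <=
    \int[lebesgue_Rn]_(y in Omega2) `|phi (g y)|%:E + (2 * om * V2)%:E)%E.
  have mphigK2 : measurable_fun K2 (fun y => `|phi (g y)|%:E).
    by apply: measurable_funS mphig => //; exact: open_measurable_rV.
  apply: le_trans (@grid_cell_sum_le _ n rho M rho0 M0 P K2
    (fun y => `|phi (g y)|%:E + (2 * om)%:E)%E c mK2 _ _ cellK2 _ _) _.
  - by apply: emeasurable_funD => //; exact: measurable_cst.
  - by move=> y _; rewrite adde_ge0// lee_fin// mulr_ge0// ltW.
  - move=> k y Pk ky; rewrite -EFinD lee_fin /c.
    have [fyk kyk] := ykP k Pk.
    have O2yk : Omega2 (yk k) by exact: fK1O.
    have O2y : Omega2 y by apply: K2O; exact: cellK2 ky.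
    have : `|phi (g (yk k)) - phi (g y)| < om.
      apply: uphi; rewrite (le_lt_trans _ sphi)// (le_trans (lip_g O2yk O2y))//.
      rewrite (le_trans (ler_wpM2l L_ge0 (grid_cell_dist rho0 M0 kyk ky)))//.
      by rewrite ler_wpM2r ?(ltW s0)// lerDl.
    have := lerB_dist (phi (g (yk k))) (phi (g y)).
    move: (`|phi (g (yk k))|) (`|phi (g y)|) (`|_ - _|) (om) => p q r t; lra.
  - by move=> k _.
  rewrite ge0_integralD//; last by move=> y _; rewrite lee_fin mulr_ge0// ltW.
  have cstE : (\int[lebesgue_Rn]_(y in K2) (2 * om)%:E = (2 * om * V2)%:E)%E.
    by rewrite integral_cst// [RHS]EFinM -V2E.
  rewrite cstE leeD2r//.
  by apply: ge0_subset_integral => //; exact: open_measurable_rV.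
have step5 : (`| \int[lebesgue_Rn]_x u3 x |%:E <= (C * \sum_(k | P k) c k * s ^+ n)%:E)%E.
  rewrite EFin_normr_Rintegral//.
  apply: le_trans (le_abse_integral _ measurableT _) _; first exact: measurable_int iu3.
  apply: (@le_trans _ _ (\int[lebesgue_Rn]_x (\sum_(k | P k) c k * \1_(B k) x)%:E)%E).
    apply: ge0_le_integral => //.
    - by apply: measurableT_comp => //; exact: measurable_int iu3.
    - apply/measurable_EFinP; under eq_fun do rewrite -big_filter.
      apply: measurable_sum => k.
      apply: measurable_funM; first exact: measurable_cst.
      exact: measurable_indic.
    - by move=> x _; rewrite lee_fin step3.
  rewrite (integral_sum_indic _ _ _ muB)//.
  rewrite lee_fin mulr_sumr; apply: ler_sum => k _.
  by rewrite mulrCA.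
apply: (@le_trans _ _ ((C * \sum_(k | P k) c k * s ^+ n)%:E + (eta / 2)%:E)%E).
  apply: (@le_trans _ _ (`|\int[lebesgue_Rn]_x u3 x|%:E + (eta / 2)%:E)%E); last exact: leeD.
  rewrite -EFinD lee_fin.
  rewrite -[X in `|X|](subrK (\int[lebesgue_Rn]_x u2 x)).
  by rewrite (le_trans (ler_normD _ _))// addrC u23 normrN -u23 lerD2l.
rewrite EFinM.
apply: (@le_trans _ _ (C%:E * (\int[lebesgue_Rn]_(y in Omega2) `|phi (g y)|%:E +
    (2 * om * V2)%:E) + (eta / 2)%:E)%E).
  by rewrite leeD2r// lee_pmul2l// lte_fin.
rewrite ge0_muleDr; last 2 first.
- by apply: integral_ge0 => y _; rewrite lee_fin.
- by rewrite lee_fin mulr_ge0// mulr_ge0// ltW.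
rewrite -addeA leeD2l// -EFinM -EFinD lee_fin.
have : C * (2 * om * V2) <= eta / 2.
  rewrite (_ : C * _ = eta / 2 * (V2 / (V2 + 1))); last first.
    by rewrite /om; field; rewrite !gt_eqF//= ltr_wpDl.
  by rewrite ger_pMr ?divr_gt0// ler_pdivrMr ?ltr_wpDl// mul1r lerDl.
by move: (C * _) => t; lra.
Qed.

End weak_derivative_bound.

(** * Smooth bump functions *)

Section flat_exponential.
Context {R : realType}.
Implicit Types (p : {poly R}) (t : R).

(** These functions are flat at 0 and form a class stable under derivation. *)
Definition flat_exp p t : R :=
  if 0 < t then p.[t^-1] * expR (- t^-1) else 0.

Definition flat_deriv p : {poly R} := 'X ^+ 2 * (p - p^`()).

(** The constant comes from exp u >= (1 + u / (k + 1)) ^ (k + 1). *)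
Lemma expR_dominates_pow k (u : R) : 0 <= u -> u ^+ k * expR (- u) <= k.+1%:R ^+ k.+1.
Proof.
move=> u0; have k0 : 0 < k.+1%:R :> R by rewrite ltr0n.
rewrite expRN ler_pdivrMr ?expR_gt0//.
have e1 : (1 + u / k.+1%:R) ^+ k.+1 <= expR u.
  rewrite -{2}(divfK (lt0r_neq0 k0) u) expRM_natr lerXn2r// ?nnegrE ?expR_ge0//.
    by rewrite addr_ge0// divr_ge0// ltW.
  exact: expR_ge1Dx.
apply: le_trans (_ : k.+1%:R ^+ k.+1 * (1 + u / k.+1%:R) ^+ k.+1 <= _); last first.
  by rewrite ler_wpM2l// exprn_ge0// ltW.
rewrite -exprMn mulrDr mulr1 mulrCA divff ?lt0r_neq0// mulr1.
apply: (@le_trans _ _ ((k.+1%:R + u) ^+ k)).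
  by rewrite lerXn2r ?nnegrE ?addr_ge0 ?(ltW k0)// lerDr ltW.
rewrite [leRHS]exprSr ler_peMr// ?exprn_ge0 ?addr_ge0 ?(ltW k0)//.
by rewrite (le_trans _ (_ : k.+1%:R <= _))// ?lerDl// ler1n.
Qed.

Lemma poly_exp_bounded p : exists2 C, 0 <= C &
  forall u : R, 0 <= u -> `|p.[u]| * expR (- u) <= C.
Proof.
exists (\sum_(i < size p) `|p`_i| * i.+1%:R ^+ i.+1).
  by apply: sumr_ge0 => i _; rewrite mulr_ge0// exprn_ge0.
move=> u u0; rewrite horner_coef.
apply: (@le_trans _ _ ((\sum_(i < size p) `|p`_i| * u ^+ i) * expR (- u))).
  rewrite ler_wpM2r ?expR_ge0// (le_trans (ler_norm_sum _ _ _))//.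
  by apply: ler_sum => i _; rewrite normrM [`|u ^+ i|]ger0_norm// exprn_ge0.
rewrite mulr_suml; apply: ler_sum => i _.
by rewrite -mulrA ler_wpM2l// expR_dominates_pow.
Qed.

(** A quadratic bound at 0 is what makes the derivative there equal to 0. *)
Lemma flat_exp_quadratic p : exists2 C, 0 <= C & forall t, `|flat_exp p t| <= C * t ^+ 2.
Proof.
have [C C0 CP] := poly_exp_bounded ('X ^+ 2 * p); exists C => // t.
rewrite /flat_exp; case: ifPn => [t0|_]; last by rewrite normr0 mulr_ge0// sqr_ge0.
have := CP t^-1; rewrite invr_ge0 => /(_ (ltW t0)).
rewrite hornerM hornerXn; set q := t^-1 ^+ 2.
rewrite [`|q * _|]normrM [`|_ * expR _|]normrM (ger0_norm (expR_ge0 _)).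
rewrite [`|q|]ger0_norm ?sqr_ge0// -mulrA /q exprVn mulrC.
by rewrite -ler_pdivlMr ?invr_gt0 ?exprn_gt0// invrK.
Qed.

Lemma is_derive_flat_exp p t : is_derive t 1 (flat_exp p) (flat_exp (flat_deriv p) t).
Proof.
have [t0|t0|<-] := ltgtP 0 t.
- have nt : \forall s \near t,
      p.[s^-1] * expR (- s^-1) = flat_exp p s.
    near=> s; rewrite /flat_exp ifT//; near: s; exact: lt_nbhsr.
  apply: near_eq_is_derive nt _.
  have dinv : is_derive t 1 (fun s : R => s^-1) (- t ^- 2 *: 1).
    by apply: (is_deriveV (f := id)); rewrite ?gt_eqF//; exact: is_derive_id.
  have dexp : is_derive t 1 (expR \o (fun s : R => - s^-1)) (expR (- t^-1) * - (- t ^- 2 *: 1)).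
    apply: is_derive1_comp; exact: is_deriveN.
  have dp : is_derive t 1 (horner p \o (fun s : R => s^-1)) (p^`().[t^-1] * (- t ^- 2 *: 1)).
    have dh : is_derive t^-1 1 (horner p) p^`().[t^-1].
      by apply: DeriveDef; [exact: derivable_horner|rewrite derivE derive1E].
    exact: (is_derive1_comp dh dinv).
  apply: (is_derive_eq (is_deriveM dp dexp)).
  rewrite /flat_exp t0 /flat_deriv !hornerE /= /GRing.scale/= mulr1 !exprVn; ring.
- have nt : \forall s \near t, cst 0 s = flat_exp p s.
    near=> s; rewrite /flat_exp ifF//; apply/negbTE; rewrite -leNgt; apply/ltW.
    near: s; exact: lt_nbhsl.
  apply: near_eq_is_derive nt _; rewrite /flat_exp ltNge (ltW t0)/=.
  exact: is_derive_cst.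
- have [C C0 CP] := flat_exp_quadratic p.
  have cv : h^-1 *: (flat_exp p (h *: 1 + 0) - flat_exp p 0) @[h --> 0^'] --> (0 : R).
    apply/cvgrPdist_lt => e e0; near=> h.
    rewrite sub0r normrN [h *: 1]mulr1 addr0 {2}/flat_exp ltxx subr0.
    have h0 : h != 0 by near: h; exact: nbhs_dnbhs_neq.
    rewrite normrZ normfV mulrC ltr_pdivrMr ?normr_gt0//.
    apply: (le_lt_trans (CP h)).
    rewrite -real_normK ?num_real// expr2 mulrA ltr_pM2r ?normr_gt0//.
    apply: (@le_lt_trans _ _ ((C + 1) * `|h|)); first by rewrite ler_wpM2r// lerDl.
    rewrite mulrC -ltr_pdivlMr ?ltr_wpDl//; near: h.
    apply/nbhs_ballP; exists (e / (C + 1)) => /=; first by rewrite divr_gt0 ?ltr_wpDl.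
    by move=> h; rewrite -ball_normE/= sub0r normrN.
  rewrite {2}/flat_exp ltxx; apply: DeriveDef; first exact: (cvgP _ cv).
  by rewrite /derive; apply: cvg_lim => //.
Unshelve. all: by end_near. Qed.

Lemma flat_exp_continuous p : continuous (flat_exp p).
Proof.
move=> t; apply: differentiable_continuous; apply/derivable1_diffP.
by have [] := is_derive_flat_exp p t.
Qed.

End flat_exponential.

Section bump_algebra.
Context {R : realType} {n : nat}.
Implicit Types (phi psi : 'rV[R]_n -> R) (C U : set 'rV[R]_n).

(** The algebra generated by flat exponentials of affine functions of one
    coordinate: it is stable under all partial derivatives. *)
Inductive bump_alg : ('rV[R]_n -> R) -> Prop :=
| bump_cst c : bump_alg (fun=> c)
| bump_flat p (i : 'I_n) a b : bump_alg (fun x => flat_exp p (a * x ord0 i + b))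
| bump_add phi psi : bump_alg phi -> bump_alg psi -> bump_alg (phi + psi)
| bump_mul phi psi : bump_alg phi -> bump_alg psi -> bump_alg (phi * psi).

Lemma bump_alg_continuous phi : bump_alg phi -> continuous phi.
Proof.
elim=> {phi} [c|p i a b|phi psi _ IH1 _ IH2|phi psi _ IH1 _ IH2] x.
- exact: cst_continuous.
- have caff : continuous (fun t : R => flat_exp p (a * t + b)).
    move=> t; apply: (continuous_comp (f := fun t : R => a * t + b)).
      by apply: cvgD; [apply: cvgM; [exact: cvg_cst|exact: cvg_id]|exact: cvg_cst].
    exact: flat_exp_continuous.
  by have := continuous_comp (@coord_continuous _ _ _ ord0 i x) (caff (x ord0 i)).
- exact: (continuousD (IH1 x) (IH2 x)).
- exact: (continuousM (IH1 x) (IH2 x)).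
Qed.

Lemma is_derive_of_line (V : normedModType R) (phi : V -> R) (x v : V) (df : R) :
  is_derive (0 : R) 1 (fun h : R => phi (h *: v + x)) df -> is_derive x v phi df.
Proof.
move=> [d1 d2]; have E : (fun h : R => h^-1 *: (phi (h *: v + x) - phi x)) =
    (fun h : R => h^-1 *: (phi ((h *: 1 + 0 : R) *: v + x) - phi ((0 : R) *: v + x))).
  by apply/funext => h; rewrite addr0 scale0r add0r [_%:A]mulr1.
by apply: DeriveDef; [rewrite /derivable E|rewrite -d2 /derive E].
Qed.

Lemma bump_alg_derive phi (v : 'rV[R]_n) : bump_alg phi ->
  exists2 phi', bump_alg phi' & forall x, is_derive x v phi (phi' x).
Proof.
elim=> {phi} [c|p i a b|phi psi b1 [phi' b1' d1] b2 [psi' b2' d2]|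
              phi psi b1 [phi' b1' d1] b2 [psi' b2' d2]].
- by exists (fun=> 0); [exact: bump_cst|move=> x; exact: (is_derive_cst c x v)].
- exists ((fun x => flat_exp (flat_deriv p) (a * x ord0 i + b)) *
          (fun=> a * v ord0 i)).
    by apply: bump_mul; [exact: bump_flat|exact: bump_cst].
  move=> x; apply: is_derive_of_line.
  pose aff : R -> R := (a * v ord0 i) *: (@idfun R) + cst (a * x ord0 i + b).
  have daff : is_derive (0 : R) 1 aff (a * v ord0 i).
    have d1 := is_deriveZ (a * v ord0 i) (is_derive_id (0 : R) 1).
    apply: (is_derive_eq (is_deriveD d1 (is_derive_cst (a * x ord0 i + b) (0 : R) 1))).
    by rewrite addr0 [_ *: _]mulr1.
  have affE : (fun h : R => flat_exp p (a * (h *: v + x) ord0 i + b)) =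
      flat_exp p \o aff.
    by apply/funext => h /=; congr flat_exp; rewrite !mxE /aff /= !fctE /GRing.scale /=; ring.
  rewrite affE.
  have aff0 : aff 0 = a * x ord0 i + b.
    by rewrite /aff !fctE /GRing.scale/= mulr0 add0r.
  have := is_derive1_comp (is_derive_flat_exp p (aff 0)) daff.
  by rewrite aff0.
- exists (phi' + psi'); first exact: bump_add.
  by move=> x; exact: is_deriveD.
- exists (phi * psi' + psi * phi'); first by apply: bump_add; exact: bump_mul.
  by move=> x; apply: is_deriveM.
Qed.

Lemma bump_alg_smooth phi : bump_alg phi -> smooth phi.
Proof.
move=> bphi s.
have bs : bump_alg (foldr partial phi s).
  elim: s => //= j s IH; have [psi bpsi dpsi] := bump_alg_derive (delta_mx ord0 j) IH.
  rewrite (_ : partial j _ = psi)//; apply/funext => x.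
  by rewrite /partial; have [_ ->] := dpsi x.
split; first exact: bump_alg_continuous.
by move=> x j; have [psi _ dpsi] := bump_alg_derive (delta_mx ord0 j) bs; have [] := dpsi x.
Qed.

Lemma bump_prod (I : Type) (s : seq I) (F : I -> 'rV[R]_n -> R) :
  (forall i, bump_alg (F i)) -> bump_alg (fun x => \prod_(i <- s) F i x).
Proof.
move=> bF; elim: s => [|i s IH].
  by under eq_fun do rewrite big_nil; exact: bump_cst.
under eq_fun do rewrite big_cons.
by have := bump_mul (bF i) IH.
Qed.

Lemma bump_exp phi N : bump_alg phi -> bump_alg (fun x => phi x ^+ N).
Proof.
move=> bphi; elim: N => [|N IH].
  by under eq_fun do rewrite expr0; exact: bump_cst.
under eq_fun do rewrite exprS.
by have := bump_mul bphi IH.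
Qed.

Lemma flat_exp1_ge0 t : 0 <= flat_exp (1 : {poly R}) t.
Proof. by rewrite /flat_exp; case: ifP => // _; rewrite hornerC mul1r expR_ge0. Qed.

Lemma flat_exp1_gt0 t : (0 < flat_exp (1 : {poly R}) t) = (0 < t).
Proof.
by rewrite /flat_exp; case: ifP => t0; rewrite ?ltxx// hornerC mul1r expR_gt0.
Qed.

Lemma flat_exp1_le1 t : flat_exp (1 : {poly R}) t <= 1.
Proof.
rewrite /flat_exp; case: ifP => // t0; rewrite hornerC mul1r -expR0 ler_expR.
by rewrite oppr_le0 invr_ge0 ltW.
Qed.

Definition cube_bump (c : 'rV[R]_n) (r : R) (x : 'rV[R]_n) : R :=
  \prod_(i < n) (flat_exp 1 (1 * x ord0 i + (r - c ord0 i)) *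
                 flat_exp 1 (- 1 * x ord0 i + (r + c ord0 i))).

Lemma bump_alg_cube_bump c r : bump_alg (cube_bump c r).
Proof.
apply: bump_prod => i.
exact: (bump_mul (bump_flat 1 i 1 (r - c ord0 i)) (bump_flat 1 i (-1) (r + c ord0 i))).
Qed.

Lemma cube_bump_ge0 c r x : 0 <= cube_bump c r x.
Proof. by apply: prodr_ge0 => i _; rewrite mulr_ge0// flat_exp1_ge0. Qed.

Lemma cube_bump_le1 c r x : cube_bump c r x <= 1.
Proof.
apply: prodr_ile1 => i _; rewrite mulr_ge0 ?flat_exp1_ge0//=.
by rewrite mulr_ile1// ?flat_exp1_ge0 ?flat_exp1_le1.
Qed.

Lemma cube_bump_gt0 c r x : 0 < r -> (0 < cube_bump c r x) = (`|x - c| < r).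
Proof.
move=> r0; rewrite rV_normr_lt//.
have E i : (0 < flat_exp 1 (1 * x ord0 i + (r - c ord0 i)) *
                 flat_exp 1 (- 1 * x ord0 i + (r + c ord0 i))) =
           (`|(x - c) ord0 i| < r).
  rewrite !mxE ltr_norml.
  have -> : (- r < x ord0 i - c ord0 i) = (0 < flat_exp 1 (1 * x ord0 i + (r - c ord0 i))).
    rewrite flat_exp1_gt0; move: (x _ _) (c _ _) => u w.
    by apply/idP/idP => ?; lra.
  have -> : (x ord0 i - c ord0 i < r) = (0 < flat_exp 1 (- 1 * x ord0 i + (r + c ord0 i))).
    rewrite flat_exp1_gt0; move: (x _ _) (c _ _) => u w.
    by apply/idP/idP => ?; lra.
  have := flat_exp1_ge0 (1 * x ord0 i + (r - c ord0 i)).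
  rewrite le_eqVlt => /predU1P[<-|h]; first by rewrite mul0r ltxx.
  by rewrite pmulr_rgt0// h.
apply/idP/forallP => [h i|h]; last by apply: prodr_gt0 => i _; rewrite E.
rewrite -E lt_neqAle mulr_ge0 ?flat_exp1_ge0// andbT eq_sym.
apply/eqP => h0; move: h; rewrite /cube_bump (bigD1 i)//= h0 mul0r ltxx//.
Qed.

(** Finitely many bumps cover C, and 1 - (prod (1 - bump))^N stays between 0 and 1
    and, by compactness, tends to 1 uniformly on C as N grows. *)
Lemma test_function_near_compact C U (eps : R) : compact C -> open U -> C `<=` U ->
  0 < eps -> exists phi, [/\ test_function U phi, forall x, 0 <= phi x <= 1 &
    forall x, C x -> 1 - eps <= phi x].
Proof.
move=> cC oU CU eps0.
have [d [K' [d0 cK' K'U CK']]] := compact_thicken cC oU CU.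
have := cC; rewrite compact_cover => /(_ _ C (fun c => ball c d)) [].
- by move=> c _; exact: ball_open.
- by move=> x Cx; exists x => //; exact: ballxx.
move=> D DC Ccov.
pose F (x : 'rV[R]_n) := \prod_(c <- finmap.enum_fset D) (1 - cube_bump c d x).
have bF : bump_alg F.
  apply: bump_prod => c.
  rewrite (_ : (fun x => _) = (fun=> 1) + (fun=> -1) * cube_bump c d).
    apply: bump_add; first exact: bump_cst.
    by apply: bump_mul; [exact: bump_cst|exact: bump_alg_cube_bump].
  by apply/funext => x; rewrite !fctE mulN1r.
have t01 c x : 0 <= 1 - cube_bump c d x <= 1.
  by rewrite subr_ge0 cube_bump_le1/= gerBl cube_bump_ge0.
have F0 x : 0 <= F x by apply: prodr_ge0 => c _; have /andP[] := t01 c x.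
have F1 x : F x <= 1 by apply: prodr_ile1 => c _.
have FC x : C x -> F x < 1.
  move=> /Ccov[c /= cD]; rewrite -ball_normE/= distrC -cube_bump_gt0// => h.
  rewrite /F (big_rem c)//= -[ltRHS](mulr1 1).
  apply: (@le_lt_trans _ _ ((1 - cube_bump c d x) * 1)).
    by rewrite ler_wpM2l//; [have /andP[] := t01 c x|apply: prodr_ile1 => c' _].
  by rewrite !mulr1 gtrBl.
have F_out x : ~ K' x -> F x = 1.
  move=> nK; rewrite /F big_seq big1// => c cD.
  have Cc : C c by have /set_mem := DC c cD.
  suff -> : cube_bump c d x = 0 by rewrite subr0.
  apply/eqP; rewrite eq_le cube_bump_ge0 andbT leNgt cube_bump_gt0//.
  by apply/negP => /ltW; rewrite distrC => /(CK' _ _ Cc)/nK.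
have [q [q0 q1 Fq]] : exists q, [/\ 0 <= q, q < 1 & forall x, C x -> F x <= q].
  have [C0|/nonemptyPn C0] := pselect (C !=set0); last first.
    by exists 0; split => // x; rewrite C0.
  have [x /set_mem Cx xmax] := EVT_max_rV C0 cC
    (continuous_subspaceT (bump_alg_continuous bF)).
  exists (F x); split => //; first exact: FC.
  by move=> y Cy; apply: xmax; rewrite inE.
have [N qN] : exists N, q ^+ N <= eps.
  have : `|q| < 1 by rewrite ger0_norm.
  move=> /cvg_expr/cvgrPdist_le/(_ _ eps0) [N _ /(_ N (leqnn N))]/=.
  by rewrite sub0r normrN ger0_norm ?exprn_ge0//; exists N.
exists (fun x => 1 - F x ^+ N.+1); split.
- split.
    apply: bump_alg_smooth.
    rewrite (_ : (fun x => _) = (fun=> 1) + (fun=> -1) * (fun x => F x ^+ N.+1)).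
      apply: bump_add; first exact: bump_cst.
      by apply: bump_mul; [exact: bump_cst|exact: bump_exp].
    by apply/funext => x; rewrite !fctE mulN1r.
  by exists K'; split => // x nK; rewrite F_out// expr1n subrr.
- by move=> x; rewrite subr_ge0 exprn_ile1//= gerBl exprn_ge0.
- move=> x Cx; rewrite lerD2l lerN2; apply: le_trans qN.
  apply: (@le_trans _ _ (q ^+ N.+1)); first by rewrite lerXn2r ?nnegrE// Fq.
  by rewrite exprS ler_piMl ?exprn_ge0// ltW.
Qed.

(** The supports shrink to C inside one compact set K, whose indicator will serve
    as a dominating function. *)
Lemma test_functions_cvg_indic C U : compact C -> open U -> C `<=` U ->
  exists (phi : nat -> 'rV[R]_n -> R) K, [/\ compact K, K `<=` U,
    (forall m, [/\ test_function U (phi m), (forall x, 0 <= phi m x <= 1) &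
       forall x, ~ K x -> phi m x = 0]) &
    forall x, phi m x @[m --> \oo] --> (\1_C x : R)].
Proof.
move=> cC oU CU.
have [d [K [d0 cK KU CK]]] := compact_thicken cC oU CU.
pose e (m : nat) := Num.min d m.+1%:R^-1.
have e0 m : 0 < e m by rewrite lt_min d0 invr_gt0 ltr0n.
pose V m := \bigcup_(x in C) ball x (e m).
have oV m : open (V m) by apply: bigcup_open => x _; exact: ball_open.
have CV m : C `<=` V m by move=> x Cx; exists x => //; exact: ballxx.
have VK m : V m `<=` K.
  move=> y [x Cx]; rewrite -ball_normE/= => xy; apply: (CK x) => //.
  by rewrite (le_trans (ltW xy))// ge_min lexx.
have m0 (m : nat) : 0 < m.+1%:R^-1 :> R by rewrite invr_gt0 ltr0n.
have [phi phiP] := choice (fun m => test_function_near_compact cC (oV m) (CV m) (m0 m)).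
have phi0 m x : ~ V m x -> phi m x = 0.
  have [[_ [K' [_ K'V K'0]]] _ _] := phiP m => nV.
  by apply: K'0 => /K'V.
exists phi, K; split => //.
  move=> m; have [[sphi [K' [cK' K'V K'0]]] phi01 _] := phiP m; split => //.
    by split => //; exists K'; split => // x /K'V/VK/KU.
  by move=> x nK; apply: phi0 => /VK.
move=> x; rewrite indicE; have [Cx|nCx] := pselect (C x).
  rewrite mem_set//; apply/cvgrPdist_le => eps eps0.
  have [N _ HN] := near_infty_natSinv_lt (PosNum eps0).
  exists N => // m /= Nm; have [_ phi01 phiC] := phiP m.
  have /andP[_ h1] := phi01 x; rewrite ger0_norm ?subr_ge0// lerBlDr -lerBlDl.
  by rewrite (le_trans _ (phiC x Cx))// lerD2l lerN2 ltW// HN.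
rewrite memNset//.
have /nbhs_ballP[r /= r0 rC] : nbhs x (~` C).
  apply: open_nbhs_nbhs; split => //; apply: closed_openC.
  by apply: compact_closed => //; exact: norm_hausdorff.
apply: cvg_near_cst; have [N _ HN] := near_infty_natSinv_lt (PosNum r0).
exists N => // m /= Nm; apply: phi0 => -[y Cy]; rewrite -ball_normE/= => yx.
apply: (rC y) => //; rewrite -ball_normE/= distrC (lt_le_trans yx)//.
by rewrite ge_min (ltW (HN _ Nm)) orbT.
Qed.

End bump_algebra.

(** * Inner regularity of finite Borel measures *)

Section regularity.
Context {R : realType} {n : nat}.
Variable mu : {finite_measure set 'rV[R]_n -> \bar R}.
Implicit Types (A E : set 'rV[R]_n).
Local Open Scope ereal_scope.

Lemma finite_measure_exhaust (F : (set 'rV[R]_n)^nat) A :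
  (forall k, measurable (F k)) -> (forall k, F k `<=` F k.+1) ->
  \bigcup_k F k = A -> forall e : R, (0 < e)%R -> exists k, mu (A `\` F k) < e%:E.
Proof.
move=> mF ndF FA e e0.
have mA : measurable A by rewrite -FA; exact: bigcup_measurable.
have mAF k : measurable (A `\` F k) by exact: measurableD.
have cap0 : \bigcap_k (A `\` F k) = set0.
  apply/seteqP; split=> // x AFx; have [Ax _] := AFx 0%N I.
  by move: Ax; rewrite -FA => -[k _ Fkx]; have [_ /(_ Fkx)] := AFx k I.
have := @nonincreasing_cvg_mu _ _ _ mu (fun k => A `\` F k).
rewrite cap0 measure0 => /(_ _ mAF measurable0 _).
have h1 : mu (A `\` F 0%N) < +oo by rewrite -ge0_fin_numE// fin_num_measure.
have h2 : nonincreasing_seq (fun k => A `\` F k).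
  apply/nonincreasing_seqP => k; apply/subsetPset => x [Ax nFx].
  by split => // /ndF.
move=> /(_ h1 h2) cv0.
have : \forall k \near \oo, mu (A `\` F k) < e%:E.
  have e0E : 0 < e%:E by rewrite lte_fin.
  apply: (cv0 [set z | z < e%:E]); exact: (open_nbhs_nbhs (conj (@open_ereal_lt _ _) e0E)).
by case=> k _ /(_ k (leqnn k)) h; exists k.
Qed.

(** Sets that closed sets approximate from inside and open sets from outside form
    a sigma-algebra that contains the open sets. *)
Let regular E := measurable E /\ forall e : R, (0 < e)%R ->
  exists F G, [/\ closed F, open G, F `<=` E, E `<=` G & mu (G `\` F) < e%:E].

Let regular_open E : open E -> regular E.
Proof.
move=> oE; split; first exact: open_measurable_rV.
move=> e e0.
pose F k := ~` \bigcup_(y in ~` E) ball y (k.+1%:R^-1 : R).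
have clF k : closed (F k).
  by apply: open_closedC; apply: bigcup_open => y _; exact: ball_open.
have ndF k : F k `<=` F k.+1.
  move=> x nx [y Ey yx]; apply: nx; exists y => //.
  apply: le_ball yx; rewrite lef_pV2 ?posrE// ler_nat; lia.
have FE : \bigcup_k F k = E.
  apply/seteqP; split=> [x [k _ Fx]|x Ex].
    by apply: contrapT => nEx; apply: Fx; exists x => //; exact: ballxx.
  have /nbhs_ballP[r /= r0 rE] : nbhs x E by exact: open_nbhs_nbhs.
  have [k _ /(_ k (leqnn k)) kr] := near_infty_natSinv_lt (PosNum r0).
  exists k => // -[y nEy] /ball_sym xy; apply: nEy; apply: rE.
  by apply: le_ball xy; exact: ltW.
have [k kE] := finite_measure_exhaust (fun k => closed_measurable_rV (clF k)) ndF FE e0.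
by exists (F k), E; split => //; rewrite -FE; exact: bigcup_sup.
Qed.

Let regularC E : regular E -> regular (~` E).
Proof.
move=> [mE rE]; split; first exact: measurableC.
move=> e e0; have [F [G [cF oG FE EG lt]]] := rE e e0.
exists (~` G), (~` F); split; [exact: open_closedC|exact: closed_openC|
  exact: subsetC|exact: subsetC|].
by rewrite setDE setCK setIC -setDE.
Qed.

Let regular_bigcup (E : (set 'rV[R]_n)^nat) :
  (forall k, regular (E k)) -> regular (\bigcup_k E k).
Proof.
move=> rE; have mE k : measurable (E k) by have [] := rE k.
split; first exact: bigcup_measurable.
move=> e e0; have e2 : (0 < e / 2)%R by rewrite divr_gt0.
have H k : exists FG, [/\ closed FG.1, open FG.2, FG.1 `<=` E k, E k `<=` FG.2 &
    mu (FG.2 `\` FG.1) < ((e / 2) / (2 ^ k.+1)%:R)%:E].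
  have [|F [G FG]] := (rE k).2 ((e / 2) / (2 ^ k.+1)%:R)%R; last by exists (F, G).
  by rewrite divr_gt0// ltr0n expn_gt0.
have [FG FGP] := choice H.
pose F k := (FG k).1; pose G k := (FG k).2.
have clF k : closed (F k) by have [] := FGP k.
have oG k : open (G k) by have [] := FGP k.
have mF k : measurable (F k) by exact: closed_measurable_rV.
have mG k : measurable (G k) by exact: open_measurable_rV.
pose H' k := \big[setU/set0]_(i < k) F i.
have clH k : closed (H' k) by rewrite /H' -(big_mkord xpredT); apply: closed_bigsetU.
have HF : \bigcup_k H' k = \bigcup_k F k.
  apply/seteqP; split=> [x [k _]|x [k _ Fx]]; first exact: bigsetU_bigcup.
  by exists k.+1 => //; rewrite /H' big_ord_recr/=; right.
have ndH k : H' k `<=` H' k.+1 by rewrite /H' big_ord_recr/=; exact: subsetUl.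
have [k kF] := finite_measure_exhaust (fun k => closed_measurable_rV (clH k)) ndH HF e2.
exists (H' k), (\bigcup_k G k); split => //.
- by apply: bigcup_open => i _.
- apply: subset_trans (_ : \bigcup_k F k `<=` _).
    by rewrite -HF; exact: bigcup_sup.
  by apply: subset_bigcup => i _; have [] := FGP i.
- by apply: subset_bigcup => i _; have [] := FGP i.
have mFU : measurable (\bigcup_k F k) by exact: bigcup_measurable.
have mGU : measurable (\bigcup_k G k) by exact: bigcup_measurable.
have mHk : measurable (H' k) by exact: closed_measurable_rV.
have sub : \bigcup_k G k `\` H' k `<=`
   (\bigcup_k (G k `\` F k)) `|` (\bigcup_k F k `\` H' k).
  move=> x [[i _ Gx] nHx]; have [Fx|nFx] := pselect ((\bigcup_k F k) x).
    by right.
  by left; exists i => //; split => // Fx; apply: nFx; exists i.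
rewrite (splitr e) EFinD.
apply: (@le_lt_trans _ _ (mu (\bigcup_k (G k `\` F k)) + mu (\bigcup_k F k `\` H' k))).
  apply: (le_trans _ (measureU2 _ _ _)); last 2 first.
  - by apply: bigcup_measurable => i _; exact: measurableD.
  - exact: measurableD.
  apply: le_measure => //; rewrite inE.
  - exact: measurableD.
  - apply: measurableU; last exact: measurableD.
    by apply: bigcup_measurable => i _; exact: measurableD.
apply: lee_ltD => //.
  by rewrite ge0_fin_numE// -ge0_fin_numE// fin_num_measure//;
    apply: bigcup_measurable => i _; exact: measurableD.
apply: le_trans (epsilon_trick0 xpredT (ltW e2)).
apply: (@le_trans _ _ (\sum_(i <oo) mu (G i `\` F i))).
  apply: measure_sigma_subadditive => //.
  - by move=> i; exact: measurableD.
  - by apply: bigcup_measurable => i _; exact: measurableD.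
by apply: lee_nneseries => // i _; apply/ltW; have [] := FGP i.
Qed.

Let measurable_regular E : measurable E -> regular E.
Proof.
apply: smallest_sub; last exact: regular_open.
split; first by apply: regular_open; exact: open0.
- by move=> A rA; rewrite setTD; exact: regularC.
- exact: regular_bigcup.
Qed.

(** A closed set is exhausted by its intersections with large cubes. *)
Lemma compact_inner_regular E (e : R) : measurable E -> (0 < e)%R ->
  exists C, [/\ compact C, C `<=` E & mu (E `\` C) < e%:E].
Proof.
move=> mE e0; have e2 : (0 < e / 2)%R by rewrite divr_gt0.
have [F [G [cF oG FE EG FGe]]] := (measurable_regular mE).2 _ e2.
pose H k := F `&` cube 0 k%:R.
have cH k : compact (H k).
  rewrite /H setIC; apply: compact_closedI => //; exact: cube_compact.
have ndH k : H k `<=` H k.+1.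
  move=> x [Fx xk]; split => //; apply: (le_trans xk); by rewrite ler_nat.
have HF : \bigcup_k H k = F.
  apply/seteqP; split=> [x [k _ []]//|x Fx].
  exists (Num.truncn `|x|).+1 => //; split => //.
  by rewrite /cube/= subr0 ltW// truncnS_gt.
have [k kF] := finite_measure_exhaust (fun k => compact_measurable_rV (cH k)) ndH HF e2.
exists (H k); split => //; first by move=> x [/FE].
have mF := closed_measurable_rV cF; have mH := compact_measurable_rV (cH k).
have sub : E `\` H k `<=` (G `\` F) `|` (F `\` H k).
  move=> x [Ex nHx]; have [Fx|nFx] := pselect (F x); first by right.
  by left; split => //; exact: EG.
have mG := open_measurable_rV oG.
rewrite (splitr e) EFinD.
apply: (@le_lt_trans _ _ (mu (G `\` F) + mu (F `\` H k))); last first.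
  by apply: lteD.
apply: (le_trans _ (measureU2 _ _ _)); last 2 first.
- exact: measurableD.
- exact: measurableD.
apply: le_measure => //; rewrite inE; first exact: measurableD.
by apply: measurableU; exact: measurableD.
Qed.

End regularity.

(** * Representation of integral-bounded functionals *)

Section fast_cauchy.
Context d (T : measurableType d) (R : realType) (mu : {measure set T -> \bar R}).
Local Open Scope ereal_scope.

(** A sequence with summable L1 increments converges almost everywhere and is
    dominated, hence converges in L1 and weakly. *)
Lemma fast_cauchy_weak_limit (u : nat -> T -> R) :
  (forall k, mu.-integrable setT (EFin \o u k)) ->
  \sum_(k <oo) \int[mu]_x `|u k.+1 x - u k x|%:E < +oo ->
  exists h : T -> R, mu.-integrable setT (EFin \o h) /\
    forall (psi : T -> R) (B : R), measurable_fun setT psi ->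
      (forall x, `|psi x| <= B)%R ->
      \int[mu]_x (psi x * u k x)%:E @[k --> \oo] --> \int[mu]_x (psi x * h x)%:E.
Proof.
move=> iu sumu.
have mu_ k : measurable_fun setT (u k) by apply/measurable_EFinP; exact: measurable_int (iu k).
pose dd k x := `|u k.+1 x - u k x|%:E.
have mdd k : measurable_fun setT (dd k).
  by apply/measurable_EFinP; apply: measurableT_comp => //; exact: measurable_funB.
have dd0 k x : 0 <= dd k x by rewrite lee_fin.
pose S x := \sum_(k <oo) dd k x.
have S0 x : 0 <= S x by apply: nneseries_ge0 => k _ _; exact: dd0.
have mS : measurable_fun setT S by apply: ge0_emeasurable_sum.
have iS : mu.-integrable setT S.
  apply/integrableP; split => //.
  under eq_integral do rewrite gee0_abs//.
  by rewrite integral_nneseries.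
have [N [mN N0 SN]] := integrable_ae measurableT iS.
pose A := ~` N.
have mA : measurable A by exact: measurableC.
have Afin x : A x -> S x \is a fin_num.
  by move=> Ax; apply: contrapT => nS; apply: Ax; apply: SN => /(_ I).
pose u' k x := (u k x * \1_A x)%R.
have u'A k x : A x -> u' k x = u k x by move=> Ax; rewrite /u' indicE mem_set// mulr1.
have u'nA k x : ~ A x -> u' k x = 0%R by move=> Ax; rewrite /u' indicE memNset// mulr0.
have partial_le k x : A x -> (\sum_(0 <= i < k) `|u i.+1 x - u i x| <= fine (S x))%R.
  move=> Ax; rewrite -lee_fin fineK ?Afin// -sumEFin.
  exact: nneseries_lim_ge.
have cvgA x : A x -> cvgn (fun k => u k x).
  move=> Ax; have cs : cvgn (series (fun i => u i.+1 x - u i x)%R).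
    apply: normed_cvg; apply: nondecreasing_is_cvgn.
      by apply: nondecreasing_series => i _ _ /=.
    by exists (fine (S x)) => _ [k _ <-]; exact: partial_le.
  have -> : (fun k => u k x) = (fun k => u 0%N x + series (fun i => u i.+1 x - u i x) k)%R.
    apply/funext => k; rewrite /series/= telescope_sumr// addrC subrK//.
  apply: is_cvgD => //; exact: is_cvg_cst.
have cvgu' x : cvgn (fun k => u' k x).
  have [Ax|nAx] := pselect (A x).
    by under eq_fun do rewrite u'A//; exact: cvgA.
  under eq_fun do rewrite u'nA//; exact: is_cvg_cst.
pose h x := limn (fun k => u' k x).
have mu' k : measurable_fun setT (u' k) by apply: measurable_funM => //; exact: measurable_indic.
have mh : measurable_fun setT h.
  by apply: (measurable_fun_cvg mu') => x _; exact: cvgu'.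
have bound k x : (`|u' k x|%:E <= `|u 0%N x|%:E + S x).
  have [Ax|nAx] := pselect (A x); last first.
    by rewrite u'nA// normr0 adde_ge0// lee_fin.
  rewrite u'A// -(fineK (Afin x Ax)) -EFinD lee_fin.
  rewrite (_ : u k x = u 0%N x + \sum_(0 <= i < k) (u i.+1 x - u i x))%R; last first.
    by rewrite telescope_sumr// addrC subrK.
  rewrite (le_trans (ler_normD _ _))// lerD2l (le_trans (ler_norm_sum _ _ _))//.
  exact: partial_le.
pose G x := `|u 0%N x|%:E + S x.
have iG : mu.-integrable setT G.
  apply: integrableD => //; exact: integrable_norm (iu 0%N).
have dom (psi : T -> R) (B : R) : measurable_fun setT psi -> (forall x, `|psi x| <= B)%R ->
    mu.-integrable setT (fun x => (psi x * h x)%:E) /\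
    \int[mu]_x (psi x * u k x)%:E @[k --> \oo] --> \int[mu]_x (psi x * h x)%:E.
  move=> mpsi psiB.
  have B0 : (0 <= `|B|)%R by [].
  have [| | | | |i1 _ c1] := @dominated_convergence _ _ _ mu setT measurableT
    (fun k x => (psi x * u' k x)%:E) (fun x => (psi x * h x)%:E)
    (fun x => `|B|%:E * G x).
  - by move=> k; apply/measurable_EFinP; exact: measurable_funM.
  - by apply/measurable_EFinP; exact: measurable_funM.
  - apply: aeW => x _; apply: cvg_EFin; first exact: nearW.
    apply: cvgM; first exact: cvg_cst.
    exact: cvgu'.
  - exact: integrableZl.
  - apply: aeW => x k _; rewrite /= normrM EFinM; apply: lee_pmul => //.
      by rewrite lee_fin (le_trans (psiB x))// ler_norm.
    exact: bound.
  split => //.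
  move: c1; rewrite (_ : [sequence _]_k = fun k => \int[mu]_x (psi x * u k x)%:E)//.
  apply/funext => k /=; apply: ae_eq_integral => //.
  - by apply/measurable_EFinP; exact: measurable_funM.
  - by apply/measurable_EFinP; exact: measurable_funM.
  - exists N; split => // x /= nx; apply: contrapT => Ax; apply: nx => _.
    by rewrite u'A.
exists h; split.
  have [|x|i1 _] := dom (cst 1%R) 1%R; first exact: measurable_cst.
    by rewrite normr1.
  by apply: eq_integrable i1 => // x _; rewrite mul1r.
by move=> psi B mpsi psiB; have [] := dom psi B mpsi psiB.
Qed.

End fast_cauchy.

Section riesz.
Context d (T : measurableType d) (R : realType).
Variable mu : {finite_measure set T -> \bar R}.
Implicit Types (phi psi u v : T -> R).

Definition bounded_measurable u :=
  measurable_fun setT u /\ exists B, forall x, `|u x| <= B.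

Lemma bounded_measurable_integrable u (E : set T) : measurable E ->
  bounded_measurable u -> mu.-integrable E (EFin \o u).
Proof.
move=> mE [mu_ [B uB]]; apply: (integrableS measurableT) => //.
apply: (@integrable_support _ _ _ mu setT u B) => //.
  by rewrite -ge0_fin_numE// fin_num_measure.
by move=> x /(_ I).
Qed.

Lemma bounded_measurableM u v : bounded_measurable u -> bounded_measurable v ->
  bounded_measurable (fun x => u x * v x).
Proof.
move=> [mu_ [B uB]] [mv [C vC]]; split; first exact: measurable_funM.
by exists (B * C) => x; rewrite normrM ler_pM.
Qed.

Lemma bounded_measurable_lin a u v : bounded_measurable u -> bounded_measurable v ->
  bounded_measurable (fun x => a * u x + v x).
Proof.
move=> [mu_ [B uB]] [mv [C vC]]; split.
  by apply: measurable_funD => //; exact: measurable_funM.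
exists (`|a| * B + C) => x; rewrite (le_trans (ler_normD _ _))//.
by rewrite normrM lerD// ler_wpM2l.
Qed.

Lemma Rintegral_lin a u v : bounded_measurable u -> bounded_measurable v ->
  \int[mu]_x (a * u x + v x) = a * \int[mu]_x u x + \int[mu]_x v x.
Proof.
move=> bu bv; have iu := bounded_measurable_integrable measurableT bu.
have iv := bounded_measurable_integrable measurableT bv.
rewrite RintegralD//; first by rewrite RintegralZl.
exact: (integrableZl measurableT a iu).
Qed.

Let ip phi psi := \int[mu]_x (phi x * psi x).

Let ipC u v : ip u v = ip v u.
Proof. by apply: eq_Rintegral => x _; rewrite mulrC. Qed.

Let ip_lin a u v w : bounded_measurable u -> bounded_measurable v ->
  bounded_measurable w ->
  ip (fun x => a * u x + v x) w = a * ip u w + ip v w.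
Proof.
move=> bu bv bw; rewrite /ip -Rintegral_lin; try exact: bounded_measurableM.
by apply: eq_Rintegral => x _; ring.
Qed.

Let ip_sqr a u v : bounded_measurable u -> bounded_measurable v ->
  ip (fun x => a * u x + v x) (fun x => a * u x + v x) =
  a ^+ 2 * ip u u + 2 * a * ip u v + ip v v.
Proof.
move=> bu bv; have bw := bounded_measurable_lin a bu bv.
rewrite ip_lin// (ipC u) (ipC v (fun _ => _)) !ip_lin// (ipC v u); ring.
Qed.

Let V := fine (mu setT).

Let V_ge0 : 0 <= V. Proof. by rewrite fine_ge0. Qed.

(** Integrate 2 |a| <= t a^2 + 1 / t. *)
Lemma Rintegral_norm_le_sqr u t : 0 < t -> bounded_measurable u ->
  2 * \int[mu]_x `|u x| <= t * (\int[mu]_x (u x * u x)) + V / t.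
Proof.
move=> t0 bu; have [mu_ [B uB]] := bu.
have bnu : bounded_measurable (fun x => `|u x|).
  split; first exact: measurableT_comp.
  by exists B => x; rewrite normr_id.
have buu : bounded_measurable (fun x => u x * u x) by exact: bounded_measurableM.
have bc : bounded_measurable (fun=> t^-1).
  by split; [exact: measurable_cst|exists `|t^-1|].
have -> : V / t = \int[mu]_x t^-1 by rewrite Rintegral_cst// mulrC.
rewrite -RintegralZl//; last exact: bounded_measurable_integrable.
rewrite -Rintegral_lin//; apply: le_Rintegral => //.
- have bz : bounded_measurable (fun=> 0 : R).
    by split; [exact: measurable_cst|exists 0 => x; rewrite normr0].
  have := bounded_measurable_integrable measurableT (bounded_measurable_lin 2 bnu bz).
  by apply: eq_integrable => // x _; rewrite /= addr0.
- exact: bounded_measurable_integrable (bounded_measurable_lin t buu bc).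
- move=> x _; have -> : u x * u x = `|u x| ^+ 2 by rewrite real_normK ?num_real.
  move: (`|u x|) => a.
  rewrite -subr_ge0 (_ : _ - _ = t * (a - t^-1) ^+ 2); last by field; rewrite gt_eqF.
  by rewrite mulr_ge0 ?sqr_ge0// ltW.
Qed.

Variables (D : (T -> R) -> Prop) (Lam : (T -> R) -> R) (K : R).
Hypothesis D_bm : forall phi, D phi -> bounded_measurable phi.
Hypothesis D0 : D (fun=> 0).
Hypothesis D_lin : forall a phi psi, D phi -> D psi -> D (fun x => a * phi x + psi x).
Hypothesis Lam_lin : forall a phi psi, D phi -> D psi ->
  Lam (fun x => a * phi x + psi x) = a * Lam phi + Lam psi.
Hypothesis Lam_le : forall phi, D phi -> `|Lam phi| <= K * \int[mu]_x `|phi x|.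

Let J phi := ip phi phi - 2 * Lam phi.

Let J_ge phi : D phi -> - (`|K| + 1) ^+ 2 * V <= J phi.
Proof.
move=> Dphi; have K0 : 0 < `|K| + 1 by rewrite ltr_wpDl.
have h := Rintegral_norm_le_sqr (divr_gt0 ltr01 K0) (D_bm Dphi).
rewrite -/(ip phi phi) in h.
have i0 : 0 <= \int[mu]_x `|phi x| by exact: Rintegral_ge0.
have hL : Lam phi <= (`|K| + 1) * \int[mu]_x `|phi x|.
  apply: le_trans (ler_norm _) _; apply: le_trans (Lam_le Dphi) _.
  by rewrite ler_wpM2r// (le_trans (ler_norm K))// lerDl.
have : (`|K| + 1) * (2 * \int[mu]_x `|phi x|) <=
    ip phi phi + (`|K| + 1) ^+ 2 * V.
  apply: le_trans (ler_wpM2l (ltW K0) h) _.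
  rewrite le_eqVlt; apply/orP; left; apply/eqP; field; rewrite gt_eqF//.
rewrite /J; move: hL; move: (\int[mu]_x _) (ip phi phi) (Lam phi) => a b l.
move: (`|K| + 1) => k; nra.
Qed.

(** The functional is represented by the limit of a minimising sequence of
    [J phi = int phi^2 - 2 Lam phi] : the parallelogram law makes the sequence
    Cauchy, and the limit satisfies the Euler-Lagrange equation. *)
Theorem bounded_functional_density :
  exists h : T -> R, mu.-integrable setT (EFin \o h) /\
    forall phi, D phi -> Lam phi = \int[mu]_x (phi x * h x).
Proof.
pose I := inf [set J phi | phi in D].
have hI : has_inf [set J phi | phi in D].
  split; first by exists (J (fun=> 0)), (fun=> 0).
  by exists (- (`|K| + 1) ^+ 2 * V) => _ [phi Dphi <-]; exact: J_ge.
have I_le phi : D phi -> I <= J phi.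
  by move=> Dphi; apply: ge_inf; [exact: hI.2|exists phi].
pose dl (k : nat) : R := (2^-1 ^+ k) ^+ 2.
have h0 k : 0 < (2^-1 : R) ^+ k by rewrite exprn_gt0// invr_gt0.
have dl0 k : 0 < dl k by rewrite exprn_gt0.
have H k : exists phi, D phi /\ J phi < I + dl k.
  by have [_ [phi Dphi <-] lt] := inf_adherent (dl0 k) hI; exists phi.
have [u uP] := choice H.
have Du k : D (u k) by have [] := uP k.
have Ju k : J (u k) < I + dl k by have [] := uP k.
have bu k := D_bm (Du k).
have par k l : ip (fun x => -1 * u k x + u l x) (fun x => -1 * u k x + u l x) <=
    2 * (dl k + dl l).
  pose m x := 2^-1 * u k x + (2^-1 * u l x + 0).
  have Dhl : D (fun x => 2^-1 * u l x + 0) by exact: D_lin.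
  have Dm : D m by exact: D_lin.
  have := I_le m Dm; rewrite /J.
  have -> : Lam m = 2^-1 * Lam (u k) + 2^-1 * Lam (u l).
    rewrite /m (Lam_lin _ _ Dhl)// (Lam_lin _ _ D0)//.
    have -> : Lam (fun=> 0) = 0.
      apply/eqP; rewrite -normr_le0 (le_trans (Lam_le D0))//.
      rewrite (_ : \int[mu]_x _ = 0) ?mulr0//.
      under eq_Rintegral do rewrite normr0.
      by rewrite Rintegral_cst// mul0r.
    by rewrite addr0.
  have -> : ip m m = 4^-1 * ip (u k) (u k) + 2^-1 * ip (u k) (u l) + 4^-1 * ip (u l) (u l).
    have -> : m = fun x => 2^-1 * u k x + (2^-1 * u l x).
      by apply/funext => x; rewrite /m addr0.
    have bz : bounded_measurable (fun=> 0 : R) by exact: D_bm.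
    have bl : bounded_measurable (fun x => 2^-1 * u l x).
      rewrite (_ : (fun x => _) = (fun x => 2^-1 * u l x + 0)); first exact: D_bm.
      by apply/funext => x; rewrite addr0.
    rewrite ip_sqr//.
    have -> : ip (u k) (fun x => 2^-1 * u l x) = 2^-1 * ip (u k) (u l).
      rewrite -RintegralZl//; first by apply: eq_Rintegral => x _; ring.
      exact: bounded_measurable_integrable (bounded_measurableM _ _).
    have -> : ip (fun x => 2^-1 * u l x) (fun x => 2^-1 * u l x) = 4^-1 * ip (u l) (u l).
      rewrite -RintegralZl//; first by apply: eq_Rintegral => x _; field.
      exact: bounded_measurable_integrable (bounded_measurableM _ _).
    by field.
  rewrite ip_sqr//; have := Ju k; have := Ju l; rewrite /J.
  move: (ip (u k) (u k)) (ip (u l) (u l)) (ip (u k) (u l)) => a b c.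
  by move: (Lam _) (Lam _) (dl k) (dl l) => p q r s; lra.
have bdiff k : bounded_measurable (fun x => u k.+1 x - u k x).
  rewrite (_ : (fun x => _) = (fun x => -1 * u k x + u k.+1 x)).
    exact: bounded_measurable_lin.
  by apply/funext => x; rewrite mulN1r addrC.
have L1 k : \int[mu]_x `|u k.+1 x - u k x| <= (4 + V) * (2^-1) ^+ k.
  have t0 : 0 < (2 : R) ^+ k by rewrite exprn_gt0.
  have := Rintegral_norm_le_sqr t0 (bdiff k); rewrite -/(ip _ _).
  have -> : ip (fun x => u k.+1 x - u k x) (fun x => u k.+1 x - u k x) =
      ip (fun x => -1 * u k x + u k.+1 x) (fun x => -1 * u k x + u k.+1 x).
    by apply: eq_Rintegral => x _; ring.
  have pk := par k k.+1.
  have dS : dl k.+1 <= dl k.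
    rewrite /dl lerXn2r ?nnegrE ?(ltW (h0 _))// exprS.
    by rewrite ler_piMl ?(ltW (h0 _))// invf_le1// ler1n.
  have p4 := le_trans pk (_ : _ <= 4 * dl k).
  move=> h; have {}h := le_trans h (lerD (ler_wpM2l (ltW t0) (p4 _)) (lexx _)).
  have {}h : 2 * \int[mu]_x `|u k.+1 x - u k x| <= 2 ^+ k * (4 * dl k) + V / 2 ^+ k.
    by apply: h; lra.
  have e1 : 2 ^+ k * (4 * dl k) = 4 * (2^-1) ^+ k.
    by rewrite /dl exprVn; field; rewrite gt_eqF.
  have e2 : V / 2 ^+ k = V * 2^-1 ^+ k by rewrite exprVn.
  rewrite e1 e2 in h; have := h0 k.
  by move: h V_ge0; move: (\int[mu]_x _) (2^-1 ^+ k) => a b; nra.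
have iu k : mu.-integrable setT (EFin \o u k) by exact: bounded_measurable_integrable.
have [|h [ih hP]] := fast_cauchy_weak_limit iu.
  apply: (@le_lt_trans _ _ (\sum_(k <oo) ((2 * (4 + V)) / (2 ^ k.+1)%:R)%:E)%E).
    apply: lee_nneseries => // k _; first by rewrite integral_ge0.
    have -> : (\int[mu]_x `|u k.+1 x - u k x|%:E =
        (\int[mu]_x `|u k.+1 x - u k x|)%:E)%E.
      rewrite fineK//; apply: integrable_fin_num => //.
      exact: integrable_norm (bounded_measurable_integrable measurableT (bdiff k)).
    rewrite lee_fin (le_trans (L1 k))// natrX exprS invfM exprVn.
    by rewrite le_eqVlt; apply/orP; left; apply/eqP; field; rewrite gt_eqF// exprn_gt0.
  apply: (@le_lt_trans _ _ (2 * (4 + V))%:E); last exact: ltry.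
  by apply: epsilon_trick0; rewrite mulr_ge0// addr_ge0.
exists h; split => // phi Dphi.
have [mphi [B phiB]] := D_bm Dphi.
have iphih : mu.-integrable setT (EFin \o (fun x => phi x * h x)).
  have [mh _] := integrableP _ _ _ ih.
  apply: (@le_integrable _ _ _ mu setT _ _ (fun x => (`|B|%:E * `|(h x)%:E|)%E)) => //.
  - by apply/measurable_EFinP; apply: measurable_funM => //; exact/measurable_EFinP.
  - move=> x _; rewrite /= lee_fin normrM [leRHS]ger0_norm ?mulr_ge0//.
    by rewrite ler_wpM2r// (le_trans (phiB x))// ler_norm.
  - apply: integrableZl => //; exact: integrable_abse ih.
have c1 := hP phi B mphi phiB.
have c2 : \int[mu]_x (phi x * u k x) @[k --> \oo] --> \int[mu]_x (phi x * h x).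
  rewrite /Rintegral; apply: fine_cvg; rewrite fineK//.
  exact: integrable_fin_num iphih.
have c3 : \int[mu]_x (phi x * u k x) @[k --> \oo] --> Lam phi.
  have bd k : `|Lam phi - \int[mu]_x (phi x * u k x)| <= (ip phi phi + 1) * 2^-1 ^+ k.
    have key (t : R) : 0 <= t ^+ 2 * ip phi phi + 2 * t * (ip phi (u k) - Lam phi) + dl k.
      have := I_le _ (D_lin t Dphi (Du k)); rewrite /J Lam_lin// ip_sqr//; last exact: D_bm.
      have := Ju k; rewrite /J.
      move: (ip phi phi) (ip phi (u k)) (ip (u k) (u k)) (Lam _) (Lam _) (dl k).
      by move=> a b c p q r; nra.
    have := key (2^-1 ^+ k); have := key (- 2^-1 ^+ k); have := h0 k.
    rewrite /dl ler_distlC -/(ip phi (u k)); move: (ip phi phi) (ip phi (u k)) (Lam phi) (2^-1 ^+ k).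
    move=> a b l e e0 k1 k2.
    have l1 : 0 <= e * (e * a + 2 * (b - l) + e) by apply: le_trans k2 _; lra.
    have l2 : 0 <= e * (e * a - 2 * (b - l) + e) by apply: le_trans k1 _; lra.
    rewrite !pmulr_rge0// in l1 l2.
    have i0 : 0 <= e * (a + 1) by lra.
    apply/andP; split; lra.
  apply/cvgrPdist_le => e e0.
  have : (ip phi phi + 1) * 2^-1 ^+ k @[k --> \oo] --> (0 : R).
    rewrite -[X in _ --> X](mulr0 (ip phi phi + 1)); apply: cvgM; first exact: cvg_cst.
    by apply: cvg_expr; rewrite ger0_norm// invf_lt1// ltr1n.
  move=> /cvgrPdist_le/(_ e e0); apply: filterS => k; rewrite sub0r normrN => hk.
  by rewrite (le_trans (bd k))// (le_trans (ler_norm _)).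
exact: (cvg_unique _ c3 c2).
Qed.

End riesz.

(** * Integration against charges with a density *)

Section density.
Context d (T : measurableType d) (R : realType).
Variable m : {finite_measure set T -> \bar R}.
Local Open Scope ereal_scope.

(** The Radon-Nikodym derivative of [nu] agrees with [k] almost everywhere. *)
Lemma integral_density (nu : {finite_measure set T -> \bar R}) (k f : T -> \bar R) E :
  m.-integrable setT k ->
  (forall A, measurable A -> nu A = \int[m]_(x in A) k x) ->
  measurable E -> nu.-integrable E f ->
  \int[nu]_(x in E) f x = \int[m]_(x in E) (f x * k x).
Proof.
move=> ik nuE mE iF.
have num : nu `<< m.
  apply/null_content_dominatesP => A mA A0; rewrite nuE// null_set_integral//.
  by apply: measurable_funTS; exact: measurable_int ik.
rewrite -(Radon_Nikodym_change_of_variables num mE iF).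
have num' : charge_of_finite_measure nu `<< m by [].
have mf : measurable_fun E f by exact: measurable_int iF.
have mk : measurable_fun setT k by exact: measurable_int ik.
have mrn : measurable_fun setT (Radon_Nikodym (charge_of_finite_measure nu) m).
  exact: measurable_int (Radon_Nikodym_integrable num').
apply: ae_eq_integral => //.
- by apply: emeasurable_funM => //; exact: measurable_funTS.
- by apply: emeasurable_funM => //; exact: measurable_funTS.
- apply: ae_eqe_mul2l; apply: integral_ae_eq => //.
  + by apply: (integrableS measurableT) => //; exact: Radon_Nikodym_integrable.
  + exact: measurable_funTS.
  + by move=> A AE mA; rewrite -Radon_Nikodym_integral// -nuE.
Qed.

End density.

Section charge_density.
Context {R : realType} {n : nat}.
Variable m : {finite_measure set 'rV[R]_n -> \bar R}.
Variables (h : 'rV[R]_n -> R) (ih : m.-integrable setT (EFin \o h)).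

(** On the positive part of a Hahn decomposition the density of the positive
    Jordan part is the restriction of [h], and similarly for the negative part. *)
Lemma charge_integral_density (D : set 'rV[R]_n) phi : measurable D ->
  bounded_measurable phi ->
  charge_integral (induced_charge ih) D phi = \int[m]_(x in D) (phi x * h x).
Proof.
move=> mD bphi; rewrite /charge_integral; case: cid => P hP; case: cid => N nuPN.
have [[mP _] [mN _] PNT PN0] := nuPN.
have [mphi [B phiB]] := bphi.
have ihr (Q : set 'rV[R]_n) : measurable Q -> m.-integrable setT ((EFin \o h) \_ Q).
  move=> mQ; apply/(integrable_mkcond _ mQ).
  exact: (integrableS measurableT mQ (@subsetT _ _) ih).
have iphih (Q : set 'rV[R]_n) : measurable Q ->
    m.-integrable D (EFin \o (fun x => phi x * (h \_ Q) x)).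
  move=> mQ; have iQ := ihr Q mQ.
  have mhQ : measurable_fun setT (h \_ Q).
    by apply/measurable_EFinP; rewrite -restrict_EFin; exact: measurable_int iQ.
  apply: (integrableS measurableT) => //.
  apply: (@le_integrable _ _ _ m setT _ _ (fun x => (`|B|%:E * `|((h \_ Q) x)%:E|)%E)) => //.
  - by apply/measurable_EFinP; apply: measurable_funM.
  - move=> x _; rewrite /= lee_fin normrM [leRHS]ger0_norm ?mulr_ge0//.
    by rewrite ler_wpM2r// (le_trans (phiB x))// ler_norm.
  - by apply: integrableZl => //; apply: integrable_abse; rewrite restrict_EFin in iQ.
have iN : m.-integrable setT (fun x => (- ((EFin \o h) \_ N) x)%E).
  by apply: integrableN; exact: ihr.
have posE : \int[jordan_pos nuPN]_(x in D) phi x =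
    \int[m]_(x in D) (phi x * (h \_ P) x).
  rewrite /Rintegral (@integral_density _ _ _ m _ _ _ _ (ihr P mP)) //.
  - congr fine; apply: eq_integral => x _; rewrite restrict_EFin /=.
    by rewrite EFinM.
  - move=> A mA; rewrite -integral_mkcondr [LHS]jordan_posE cjordan_posE.
    by rewrite /crestr0 mem_set.
  - exact: bounded_measurable_integrable.
have negE : \int[jordan_neg nuPN]_(x in D) phi x =
    - \int[m]_(x in D) (phi x * (h \_ N) x).
  rewrite /Rintegral (@integral_density _ _ _ m _ _ _ _ iN) //.
  - rewrite -fineN -integralN; last first.
      by apply: fin_num_adde_defr; apply: integrable_fin_num => //; apply: integrable_funepos => //; exact: iphih.
    congr fine; apply: eq_integral => x _; rewrite restrict_EFin /=.
    by rewrite -mulrN.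
  - move=> A mA; rewrite integralN; last first.
      apply: fin_num_adde_defr; apply: integrable_fin_num => //.
      by apply: integrable_funepos => //; exact: (integrableS measurableT mA (@subsetT _ _) (ihr N mN)).
    rewrite -integral_mkcondr [LHS]jordan_negE cjordan_negE.
    by rewrite /crestr0 mem_set.
  - exact: bounded_measurable_integrable.
rewrite posE negE opprK -RintegralD//; try exact: iphih.
apply: eq_Rintegral => x _; rewrite -mulrDr /patch; congr (_ * _).
have : (P `|` N) x by rewrite PNT.
have [xP|xP] := pselect (P x); have [xN|xN] := pselect (N x).
- by have : (P `&` N) x by []; rewrite PN0.
- by rewrite (mem_set xP) (memNset xN) addr0.
- by rewrite (memNset xP) (mem_set xN) add0r.
- by case.
Qed.

End charge_density.

(** * Euclidean norms and test functions *)

Section enorm_lemmas.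
Context {R : realType}.

Lemma enorm_coord_le p q (M : 'M[R]_(p, q)) i j : `|M i j| <= enorm M.
Proof.
rewrite -sqrtr_sqr ler_wsqrtr// (bigD1 i)//= (bigD1 j)//= -addrA lerDl.
by rewrite addr_ge0// sumr_ge0// => k _; rewrite ?sqr_ge0// sumr_ge0// => l _; rewrite sqr_ge0.
Qed.

Lemma enorm_ge0 p q (M : 'M[R]_(p, q)) : 0 <= enorm M.
Proof. exact: sqrtr_ge0. Qed.

Lemma enorm_le p q (M : 'M[R]_(p, q)) (B : R) : 0 <= B ->
  (forall i j, `|M i j| <= B) -> enorm M <= (p * q)%:R * B.
Proof.
move=> B0 MB; have pqB0 : 0 <= (p * q)%:R * B by rewrite mulr_ge0.
rewrite -[leRHS]ger0_norm// -sqrtr_sqr ler_wsqrtr//.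
apply: (@le_trans _ _ (\sum_(i < p) \sum_(j < q) B ^+ 2)).
  apply: ler_sum => i _; apply: ler_sum => j _.
  by rewrite -real_normK ?num_real// lerXn2r ?nnegrE.
under eq_bigr do rewrite sumr_const card_ord.
rewrite sumr_const card_ord -mulrnA mulnC -[leLHS]mulr_natl exprMn ler_wpM2r ?sqr_ge0//.
rewrite -natrX ler_nat; case: (p * q)%N => // k.
by rewrite expnS leq_pmulr.
Qed.

Lemma normr_le_enorm n (x : 'rV[R]_n) : `|x| <= enorm x.
Proof.
by rewrite rV_normr_le ?enorm_ge0//; apply/forallP => i; exact: enorm_coord_le.
Qed.

Lemma enorm_le_normr n (x : 'rV[R]_n) : enorm x <= n%:R * `|x|.
Proof.
rewrite -[X in X%:R]mul1n; apply: enorm_le => // i j.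
by rewrite (ord1 i) rV_coord_le.
Qed.

Lemma enorm_continuous n (c : 'rV[R]_n) : continuous (fun y : 'rV[R]_n => enorm (y - c)).
Proof.
have cs (s : seq 'I_n) :
    continuous (fun y : 'rV[R]_n => \sum_(j <- s) (y - c) ord0 j ^+ 2).
  elim: s => [|j s IH] y.
    under eq_fun do rewrite big_nil; exact: cst_continuous.
  under eq_fun do rewrite big_cons.
  suff cj : {for y, continuous (fun y : 'rV[R]_n => (y - c) ord0 j ^+ 2)}.
    exact: (continuousD cj (IH y)).
  have cq : continuous (fun t : R => (t - c ord0 j) ^+ 2).
    move=> t; apply: (continuous_comp (f := fun t : R => t - c ord0 j) (g := fun t : R => t ^+ 2)).
      by apply: continuousB => //; exact: cst_continuous.
    exact: exprn_continuous.
  rewrite (_ : (fun z : 'rV[R]_n => _) =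
      (fun t : R => (t - c ord0 j) ^+ 2) \o (fun z : 'rV[R]_n => z ord0 j)).
    exact: continuous_comp (@coord_continuous _ _ _ ord0 j y) (cq (y ord0 j)).
  by apply/funext => z; rewrite /= !mxE.
move=> y; rewrite /enorm; under eq_fun do rewrite big_ord1.
exact: continuous_comp (cs _ y) (@sqrt_continuous _ _).
Qed.

Lemma open_eball n (c : 'rV[R]_n) r : open (eball c r).
Proof.
apply: (@open_comp _ _ (fun y : 'rV[R]_n => enorm (y - c)) [set t | t < r]); last exact: open_lt.
by move=> y _; exact: enorm_continuous.
Qed.

Lemma eball_sub_cube n (c : 'rV[R]_n) r : eball c r `<=` cube c r.
Proof. by move=> y /ltW; apply: le_trans; exact: normr_le_enorm. Qed.

Lemma eball_center n (c : 'rV[R]_n) r : 0 < r -> eball c r c.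
Proof.
move=> r0; rewrite /eball /= subrr (le_lt_trans (enorm_le_normr _))//.
by rewrite normr0 mulr0.
Qed.

End enorm_lemmas.

Section test_functions.
Context {R : realType} {n : nat}.
Implicit Types (U : set 'rV[R]_n) (phi psi : 'rV[R]_n -> R).

Lemma smooth_lin a phi psi : smooth phi -> smooth psi ->
  smooth (fun x => a * phi x + psi x).
Proof.
move=> sphi spsi s /=.
have : foldr partial (fun x => a * phi x + psi x) s =
    fun x => a * foldr partial phi s x + foldr partial psi s x.
  elim: s => //= j s ->; apply/funext => x; rewrite /partial.
  have [_ d1] := sphi s; have [_ d2] := spsi s.
  rewrite (_ : (fun y : 'rV[R]_n => _) =
     (a \*: foldr partial phi s) + foldr partial psi s :> ('rV[R]_n -> R)) //.
  rewrite deriveD//; first by rewrite deriveZ.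
  exact: derivableZ.
move=> ->; have [c1 d1] := sphi s; have [c2 d2] := spsi s; split.
  move=> x; have ca : {for x, continuous (fun _ : 'rV[R]_n => a)}.
    exact: cst_continuous.
  exact: (continuousD (continuousM ca (c1 x)) (c2 x)).
move=> x j.
rewrite (_ : (fun y : 'rV[R]_n => _) =
   (a \*: foldr partial phi s) + foldr partial psi s :> ('rV[R]_n -> R)) //.
by apply: derivableD; [exact: derivableZ|].
Qed.

Lemma test_function_lin U a phi psi : test_function U phi -> test_function U psi ->
  test_function U (fun x => a * phi x + psi x).
Proof.
move=> [s1 [K1 [cK1 K1U z1]]] [s2 [K2 [cK2 K2U z2]]]; split; first exact: smooth_lin.
exists (K1 `|` K2); split; first exact: compactU.
  by move=> x [/K1U|/K2U].
by move=> x /not_orP[k1 k2]; rewrite z1// z2// mulr0 addr0.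
Qed.

Lemma partial_lin a phi psi j : smooth phi -> smooth psi ->
  partial j (fun x => a * phi x + psi x) = fun x => a * partial j phi x + partial j psi x.
Proof.
move=> /(_ [::])[_ d1] /(_ [::])[_ d2]; apply/funext => x; rewrite /partial.
rewrite (_ : (fun y : 'rV[R]_n => _) = (a \*: phi) + psi :> ('rV[R]_n -> R)) //.
by rewrite deriveD//; [rewrite deriveZ|exact: derivableZ].
Qed.

Lemma smooth0 : smooth (fun _ : 'rV[R]_n => 0 : R).
Proof.
move=> s /=; have -> : foldr partial (fun _ : 'rV[R]_n => 0 : R) s = fun=> 0.
  by elim: s => //= j s ->; apply/funext => x; rewrite /partial derive_cst.
by split; [exact: cst_continuous|move=> x j; exact: derivable_cst].
Qed.

Lemma test_function0 U : test_function U (fun=> 0).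
Proof. by split; [exact: smooth0|exists set0; split => //; exact: compact0]. Qed.

(** Off the compact set K the function vanishes on an open set, hence so do its
    derivatives. *)
Lemma test_functionP U phi : test_function U phi ->
  exists K, [/\ compact K, K `<=` U, continuous phi & forall x, ~ K x -> phi x = 0] /\
    forall j, [/\ continuous (partial j phi),
      (forall x, is_derive x (delta_mx ord0 j) phi (partial j phi x)) &
      forall x, ~ K x -> partial j phi x = 0].
Proof.
move=> [sphi [K [cK KU phi0]]]; exists K; have [c0 d0] := sphi [::].
split; first by [].
move=> j; split; first by have [] := sphi [:: j].
  by move=> x; apply: DeriveDef => //; exact: d0.
move=> x Kx; rewrite /partial (@near_eq_derive _ _ _ phi (fun=> 0)) ?derive_cst//.
have oK : open (~` K) by apply: closed_openC; exact: compact_closed.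
by move: oK; rewrite openE => /(_ _ Kx); apply: filterS => y /phi0.
Qed.

Lemma compact_support_bounded_measurable K phi : compact K -> continuous phi ->
  (forall x, ~ K x -> phi x = 0) -> bounded_measurable phi.
Proof.
move=> cK cphi phi0; split; first exact: continuous_measurable_R.
have [B B0 phiB] := continuous_compact_bounded cK (continuous_subspaceT cphi).
exists B => x; have [/phiB//|/phi0 ->] := pselect (K x).
by rewrite normr0 ltW.
Qed.

End test_functions.

(** * Mappings with a Lipschitz inverse *)

Section cvg_indic.
Context d (T : measurableType d) (R : realType).
Variables (D C : set T) (phi : nat -> T -> R).
Hypotheses (mD : measurable D) (mC : measurable C).
Hypothesis mphi : forall k, measurable_fun D (phi k).
Hypothesis phiC : forall x, D x -> phi k x @[k --> \oo] --> (\1_C x : R).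

Lemma integral_cvg_indic (mu : {measure set T -> \bar R}) (w : T -> R) :
  mu.-integrable D (EFin \o w) -> (forall k x, D x -> `|phi k x| <= w x) ->
  (\int[mu]_(x in D) (phi k x)%:E)%E @[k --> \oo] --> mu (C `&` D).
Proof.
move=> iw phiw; rewrite -integral_indic//.
have [|||||_ _ ] := @dominated_convergence _ _ _ mu D mD
  (fun k x => (phi k x)%:E) (fun x => (\1_C x)%:E) (EFin \o w) => //.
- by move=> k; exact/measurable_EFinP.
- by apply/measurable_EFinP; apply: measurable_funTS; exact: measurable_indic.
- by apply: aeW => x Dx; apply: cvg_EFin; [exact: nearW|exact: phiC].
- by apply: aeW => x k Dx; rewrite lee_fin; exact: phiw.
Qed.

Lemma Rintegral_cvg_indic (mu : {finite_measure set T -> \bar R}) : C `<=` D ->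
  (forall k x, 0 <= phi k x <= 1) ->
  \int[mu]_(x in D) phi k x @[k --> \oo] --> fine (mu C).
Proof.
move=> CD p01; rewrite -[in X in _ --> X](setIidl CD).
apply: fine_cvg; rewrite fineK ?fin_num_measure//; last exact: measurableI.
apply: (@integral_cvg_indic mu (cst 1)).
  exact: finite_measure_integrable_cst.
by move=> k x _; have /andP[p0 p1] := p01 k x; rewrite ger0_norm.
Qed.

End cvg_indic.

Section lipschitz_inverse.
Context {R : realType} {n : nat}.
Variables (Omega1 Omega2 : set 'rV[R]_n) (f g : 'rV[R]_n -> 'rV[R]_n) (L : R).
Hypotheses (oO1 : open Omega1) (oO2 : open Omega2) (L0 : 0 <= L).
Hypothesis lip_g : forall y z, Omega2 y -> Omega2 z -> `|g y - g z| <= L * `|y - z|.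
Hypothesis fO : forall x, Omega1 x -> Omega2 (f x).
Hypothesis gO : forall y, Omega2 y -> Omega1 (g y).
Hypothesis gf : forall x, Omega1 x -> g (f x) = x.
Hypothesis fg : forall y, Omega2 y -> f (g y) = y.

Local Notation pushforward_measure :=
  measure_function_pushforward__canonical__measure_function_Measure.
Let lambda := (@lebesgue_Rn R n).
Let C := @growth_const R n L.

Let mO2 : measurable Omega2. Proof. exact: open_measurable_rV. Qed.

Let mg : measurable_fun Omega2 g.
Proof. by apply: within_continuous_measurable_rV => //; exact: (lip_g_continuous L0 lip_g). Qed.

Lemma lipschitz_inverse_continuous : {within Omega1, continuous f}.
Proof.
rewrite (_ : Omega1 = g @` Omega2).
  exact: open_inverse_continuous oO2 (lip_g_continuous L0 lip_g) fg.
apply/seteqP; split => [x Ox|_ [y Oy <-]]; last exact: gO.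
by exists (f x); [exact: fO|exact: gf].
Qed.

Let cf := lipschitz_inverse_continuous.

(** The image under [f] of [E], in a form that is visibly measurable. *)
Definition pulled (E : set 'rV[R]_n) := Omega2 `&` g @^-1` E.

Lemma measurable_pulled E : measurable E -> measurable (pulled E).
Proof. by move=> mE; exact: mg. Qed.

Lemma pulled_compact_lty K : compact K -> K `<=` Omega1 -> (lambda (pulled K) < +oo)%E.
Proof.
move=> cK KO; have cfK : compact (f @` K).
  by apply: continuous_compact => //; exact: (continuous_subspaceW KO cf).
apply: le_lt_trans (lebesgue_compact_lty cfK); apply: le_measure; rewrite ?inE.
- by apply: measurable_pulled; exact: compact_measurable_rV.
- exact: compact_measurable_rV.
- by move=> y [Oy Ky]; exists (g y) => //; exact: fg.
Qed.

(** The image of the Lebesgue measure of [Omega2] under [g], cut off to [E]. *)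
Lemma pulled_measure (E : set 'rV[R]_n) : measurable E -> (lambda (pulled E) < +oo)%E ->
  exists m : {finite_measure set 'rV[R]_n -> \bar R},
    forall phi : 'rV[R]_n -> R, measurable_fun setT phi -> (forall x, ~ E x -> phi x = 0) ->
    (\int[lambda]_(y in Omega2) `|phi (g y)|%:E = \int[m]_x `|phi x|%:E)%E.
Proof.
move=> mE E_lty; pose gt y := if y \in Omega2 then g y else 0.
have mgt : measurable_fun setT gt.
  apply: measurable_fun_if => //.
  - by apply: measurable_fun_bool; rewrite setTI (_ : _ @^-1` _ = Omega2)//;
      apply/seteqP; split => y /=; [exact: set_mem|exact: mem_set].
  - rewrite setTI (_ : _ @^-1` _ = Omega2)//.
    by apply/seteqP; split => y /=; [exact: set_mem|exact: mem_set].
have gtE y : Omega2 y -> gt y = g y by move=> Oy; rewrite /gt mem_set.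
pose l2 := mrestr lambda mO2.
pose p := pushforward_measure l2 mgt.
have pE : (p E < +oo)%E.
  rewrite /p /= /pushforward /l2 /mrestr (_ : _ `&` _ = pulled E)//.
  by apply/seteqP; split => y [] /=; [move=> + Oy|move=> Oy]; rewrite gtE.
pose m : {finite_measure set 'rV[R]_n -> \bar R} := mfrestr mE pE.
exists m => phi mphi phi0.
have mphin : measurable_fun setT (fun x => `|phi x|%:E).
  by apply/measurable_EFinP; exact: measurableT_comp.
have -> : (\int[m]_x `|phi x|%:E = \int[m]_(x in E) `|phi x|%:E)%E.
  rewrite [RHS]integral_mkcond; apply: eq_integral => x _; rewrite /patch.
  by case: ifPn => // /negP; rewrite in_setE => /phi0 ->; rewrite normr0.
have -> : (\int[m]_(x in E) `|phi x|%:E = \int[p]_(x in E) `|phi x|%:E)%E.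
  by apply: eq_measure_integral => A mA AE; rewrite /m /= /mfrestr /mrestr setIidl.
have -> : (\int[p]_(x in E) `|phi x|%:E = \int[p]_x `|phi x|%:E)%E.
  rewrite [LHS]integral_mkcond; apply: eq_integral => x _; rewrite /patch.
  by case: ifPn => // /negP; rewrite in_setE => /phi0 ->; rewrite normr0.
rewrite [RHS](@ge0_integral_pushforward _ _ _ _ _ gt mgt l2)// preimage_setT -(setUv Omega2).
rewrite ge0_integral_setU//=.
- rewrite [X in (_ + X)%E](_ : _ = 0) ?adde0.
    rewrite [RHS](@eq_measure_integral _ _ _ _ lambda).
      by apply: eq_integral => y; rewrite in_setE => Oy /=; rewrite gtE.
    by move=> A mA AO; rewrite /l2 /= /mrestr setIidl.
  rewrite (@eq_measure_integral _ _ _ _ mzero) ?integral_measure_zero//.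
  move=> A mA AO; rewrite /l2 /= /mrestr (_ : A `&` Omega2 = set0) ?measure0//.
  by apply/seteqP; split => // y [/AO].
- exact: measurableC.
- apply: measurable_funTS; exact: (measurableT_comp mphin mgt).
- by rewrite /disj_set setICr eqxx.
Qed.

Lemma weak_derivative_test_bound U phi i j : open U -> U `<=` Omega1 ->
  test_function U phi ->
  (`|\int[lambda]_(x in U) (f x ord0 i * partial j phi x)|%:E <=
    C%:E * \int[lambda]_(y in Omega2) `|phi (g y)|%:E)%E.
Proof.
move=> oU UO /test_functionP[K [[cK KU cphi phi0] /(_ j)[cpsi dphi psi0]]].
rewrite Rintegral_support; last 2 first.
- exact: open_measurable_rV.
- by move=> x Ux; rewrite psi0 ?mulr0// => /KU.
apply: (weak_derivative_bound oO1 oO2 L0 lip_g fO gf cf i cK _ cphi cpsi dphi phi0 psi0).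
exact: subset_trans KU UO.
Qed.

(** The functional phi |-> - int f_i d_j phi is bounded by the L1 norm of the
    pulled measure, hence has a density with respect to it, and this density
    times the pulled measure is the distributional derivative. *)
Lemma component_BV U K i : open U -> U `<=` K -> compact K -> K `<=` Omega1 ->
  BV U (component f i).
Proof.
move=> oU UK cK KO; have UO := subset_trans UK KO.
have mU := open_measurable_rV oU.
have mfi : measurable_fun U (component f i).
  apply: (measurableT_comp (@coord_measurable R n i)).
  by apply: within_continuous_measurable_rV => //; exact: (continuous_subspaceW UO cf).
split.
  have [B B0 fB] : exists2 B, 0 < B & forall x, K x -> `|component f i x| <= B.
    apply: continuous_compact_bounded => //.
    have cfK := continuous_subspaceW KO cf.
    apply/within_continuous_epsP => x Kx e e0.
    have [d d0 H] := (within_continuous_epsP _ _).1 cfK x Kx e e0.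
    exists d => // y Ky xy; apply: le_lt_trans (H y Ky xy).
    by have := rV_coord_le (f x - f y) i; rewrite !mxE.
  have lU : (lambda U < +oo)%E.
    apply: le_lt_trans (lebesgue_compact_lty cK); apply: le_measure; rewrite ?inE//.
    exact: compact_measurable_rV.
  apply: (@le_integrable _ _ _ _ U mU _ (cst B%:E)).
  - exact/measurable_EFinP.
  - move=> x Ux /=; rewrite lee_fin [leRHS]ger0_norm ?(ltW B0)//.
    by apply: fB; exact: UK.
  - apply/integrableP; split; first exact: measurable_cst.
    rewrite (eq_integral (cst B%:E)); last first.
      by move=> x _ /=; rewrite ger0_norm// ltW.
    by rewrite integral_cst// lte_mul_pinfty// lee_fin ltW.
move=> j.
have lpU : (lambda (pulled U) < +oo)%E.
  apply: le_lt_trans (pulled_compact_lty cK KO); apply: le_measure; rewrite ?inE.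
  - exact: measurable_pulled.
  - by apply: measurable_pulled; exact: compact_measurable_rV.
  - by move=> y [Oy /UK].
have [m mP] := pulled_measure mU lpU.
pose Lam phi := - \int[lambda]_(x in U) (component f i x * partial j phi x).
have Dbm phi : test_function U phi -> bounded_measurable phi.
  move=> /test_functionP[K' [[cK' K'U cphi phi0] _]].
  exact: compact_support_bounded_measurable cK' cphi phi0.
have ifp phi : test_function U phi ->
    lambda.-integrable U (EFin \o (fun x => component f i x * partial j phi x)).
  move=> /test_functionP[K' [[cK' K'U cphi phi0] /(_ j)[cpsi dphi psi0]]].
  apply: (integrableS measurableT) => //.
  apply: (component_mul_integrable oO1 cf i cK' _ cpsi psi0).
  exact: subset_trans K'U UO.
have [h [ih hP]] : exists h, m.-integrable setT (EFin \o h) /\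
    forall phi, test_function U phi -> Lam phi = \int[m]_x (phi x * h x).
  apply: (bounded_functional_density (K := C) Dbm).
  - exact: test_function0.
  - by move=> a phi psi; exact: test_function_lin.
  - move=> a phi psi tphi tpsi; rewrite /Lam mulrN -opprD; congr (- _).
    rewrite -RintegralZl//; last exact: ifp.
    rewrite -RintegralD//; [|exact: (integrableZl mU a (ifp _ tphi))|exact: ifp].
    have [sphi _] := tphi; have [spsi _] := tpsi.
    by apply: eq_Rintegral => x _; rewrite partial_lin//; ring.
  - move=> phi tphi; rewrite /Lam normrN -lee_fin EFinM.
    apply: le_trans (weak_derivative_test_bound i j oU UO tphi) _.
    have [mphi [B phiB]] := Dbm _ tphi.
    have [_ [K' [_ K'U phi0]]] := tphi.
    rewrite mP//; last by move=> x Ux; apply: phi0 => /K'U.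
    rewrite /Rintegral fineK// integrable_fin_num//.
    apply: bounded_measurable_integrable => //; split; first exact: measurableT_comp.
    by exists B => x; rewrite normr_id.
exists (induced_charge ih) => phi tphi.
rewrite charge_integral_density//; last exact: Dbm.
have [_ [K' [_ K'U phi0]]] := tphi.
rewrite [in RHS]Rintegral_support//; last by move=> x Ux; rewrite phi0 ?mul0r// => /K'U.
by rewrite -hP// /Lam opprK.
Qed.

Lemma lipschitz_inverse_BV_loc : BV_loc Omega1 f.
Proof.
move=> x Ox; have := oO1; rewrite openE => /(_ _ Ox)/nbhs_ballP[r /= r0 rO].
have r20 : 0 < r / 2 by rewrite divr_gt0.
have cO : cube x (r / 2) `<=` Omega1.
  move=> y xy; apply: rO; rewrite -ball_normE /ball_/= distrC.
  by apply: le_lt_trans xy _; rewrite ltr_pdivrMr// ltr_pMr// ltr1n.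
have eO := @eball_sub_cube _ _ x (r / 2).
exists x, (r / 2); split; first exact: eball_center.
- exact: subset_trans eO cO.
- move=> i; apply: (component_BV i _ eO) => //; first exact: open_eball.
  exact: cube_compact.
Qed.

(** Test functions converging to the indicator of a compact set turn the
    estimate for the functional into one for the measure; both sides pass to the
    limit by dominated convergence. *)
Lemma charge_compact_le U (nu : {charge set 'rV[R]_n -> \bar R}) i j C0 :
  open U -> U `<=` Omega1 -> distr_partial U (component f i) j nu ->
  compact C0 -> C0 `<=` U -> (`|nu C0| <= C%:E * lambda (pulled C0))%E.
Proof.
move=> oU UO nuP cC CU; have mU := open_measurable_rV oU.
have mC := compact_measurable_rV cC.
have [phi [K [cK KU phiP phiC]]] := test_functions_cvg_indic cC oU CU.
have lK := pulled_compact_lty cK (subset_trans KU UO).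
have mK : measurable (pulled K) by apply: measurable_pulled; exact: compact_measurable_rV.
have bm k : bounded_measurable (phi k).
  have [/test_functionP[K' [[cK' _ cphi phi0] _]] _ _] := phiP k.
  exact: compact_support_bounded_measurable cK' cphi phi0.
have cl : charge_integral nu U (phi k) @[k --> \oo] --> fine (nu C0).
  rewrite /charge_integral; case: cid => P hP; case: cid => N nuPN.
  rewrite (jordan_decomp nuPN mC) /cadd /= cscaleN1 fineB; last 2 first.
  - by rewrite fin_num_measure.
  - by rewrite fin_num_measure.
  have mphi k : measurable_fun U (phi k) by apply: measurable_funTS; exact: (bm k).1.
  have p01 k x : 0 <= phi k x <= 1 by have [_ + _] := phiP k; apply.
  by apply: cvgB; exact: Rintegral_cvg_indic.
have cr : (\int[lambda]_(y in Omega2) `|phi k (g y)|%:E)%E @[k --> \oo] -->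
    lambda (pulled C0).
  rewrite -[X in _ --> lambda X](setIidl (@subIsetl _ _ _ : pulled C0 `<=` Omega2)).
  apply: (@integral_cvg_indic _ _ _ Omega2 (pulled C0) (fun k y => `|phi k (g y)|)
    _ _ _ _ _ (\1_(pulled K))) => //.
  - exact: measurable_pulled.
  - move=> k; apply: measurableT_comp => //.
    by apply: (measurableT_comp (bm k).1).
  - move=> y Oy; have := cvg_norm (phiC (g y)).
    rewrite !indicE (_ : (y \in pulled C0) = (g y \in C0)).
      by rewrite ger0_norm//; apply.
    by apply/idP/idP; rewrite !in_setE; [case|].
  - apply: (integrableS measurableT) => //.
    apply: (integrable_support (D := pulled K) (B := 1)) => //.
    + by move=> y; rewrite indicE; case: (_ \in _); rewrite ?normr1 ?normr0.
    + by move=> y Ky; rewrite indicE memNset.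
  - move=> k y Oy; rewrite normr_id; have [_ p01 p0] := phiP k.
    rewrite indicE; have [yK|yK] := boolP (y \in pulled K).
      by have /andP[p1 p2] := p01 (g y); rewrite ger0_norm.
    rewrite p0 ?normr0// => Ky; move/negP : yK; apply; exact: mem_set.
have le k : (`|charge_integral nu U (phi k)|%:E <=
    C%:E * \int[lambda]_(y in Omega2) `|phi k (g y)|%:E)%E.
  have [tphi _ _] := phiP k; have := weak_derivative_test_bound i j oU UO tphi.
  by rewrite (nuP _ tphi) normrN.
have -> : (`|nu C0| = `|fine (nu C0)|%:E)%E by rewrite -abse_EFin fineK// fin_num_measure.
have cl' : (`|charge_integral nu U (phi k)|%:E)%E @[k --> \oo] --> (`|fine (nu C0)|%:E)%E.
  by apply: cvg_EFin; [near=> k|exact: cvg_norm].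
have cr' : (C%:E * \int[lambda]_(y in Omega2) `|phi k (g y)|%:E)%E @[k --> \oo] -->
    (C%:E * lambda (pulled C0))%E.
  by apply: cvgeZl.
rewrite -(cvg_lim _ cl')// -(cvg_lim _ cr')//; apply: lee_lim.
- by apply/cvg_ex; eexists; exact: cl'.
- by apply/cvg_ex; eexists; exact: cr'.
- by apply: nearW.
Unshelve. all: by end_near. Qed.

(** Inner regularity of the total variation of [nu] reduces the estimate to
    compact sets. *)
Lemma charge_le U (nu : {charge set 'rV[R]_n -> \bar R}) i j E :
  open U -> U `<=` Omega1 -> distr_partial U (component f i) j nu ->
  measurable E -> E `<=` U -> (`|nu E| <= C%:E * lambda (pulled E))%E.
Proof.
move=> oU UO nuP mE EU; have [P [N nuPN]] := Hahn_decomposition nu.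
apply/lee_addgt0Pr => e e0.
have tvT : (charge_variation nuPN setT < +oo)%E.
  rewrite -ge0_fin_numE ?adde_ge0// fin_numD.
  by apply/andP; split; rewrite fin_num_measure.
pose tv : {finite_measure set 'rV[R]_n -> \bar R} := mfrestr measurableT tvT.
have [K [cK KE tvK]] := compact_inner_regular tv mE e0.
rewrite [tv _](_ : _ = charge_variation nuPN (E `\` K)) in tvK; last first.
  by rewrite /tv /= /mfrestr /mrestr setIT.
have mK := compact_measurable_rV cK.
rewrite (chargeDI nu mE mK) setIidr// addeC.
apply: le_trans (lee_abs_add _ _) _; apply: leeD.
  apply: le_trans (charge_compact_le oU UO nuP cK (subset_trans KE EU)) _.
  rewrite lee_pmul2l ?lte_fin ?growth_const_gt0//.
  apply: le_measure; rewrite ?inE; try exact: measurable_pulled.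
  by move=> y [Oy /KE].
apply: le_trans (abse_charge_variation nuPN _) (ltW tvK).
exact: measurableD.
Qed.

Definition variation_const : R := (n * n)%:R * C + 1.

Lemma variation_const_gt0 : 0 < variation_const.
Proof. by rewrite ltr_wpDl// mulr_ge0// ltW// growth_const_gt0. Qed.

Lemma Df_value_le E (M : 'M[R]_n) : Df_value Omega1 f E M ->
  ((enorm M)%:E <= variation_const%:E * lambda (pulled E))%E.
Proof.
move=> [U [nu [[oU UO mE EU] [_ nuP ->]]]].
have : (0 <= lambda (pulled E))%E by exact: measure_ge0.
have nuE i j := charge_le oU UO (nuP i j) mE EU.
move: nuE; case: (lambda (pulled E)) => [l| |] nuE; last 2 first.
- by move=> _; rewrite gt0_muley ?leey// lte_fin variation_const_gt0.
- by [].
rewrite lee_fin => l0; rewrite -EFinM lee_fin.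
have C0 : 0 <= C by rewrite ltW// growth_const_gt0.
apply: le_trans (enorm_le (mulr_ge0 C0 l0) _) _.
  move=> i j; rewrite mxE -lee_fin EFinM; apply: le_trans _ (nuE i j).
  by rewrite -abse_EFin fineK// fin_num_measure.
by rewrite mulrA /variation_const mulrDl mul1r lerDl.
Qed.

Lemma Df_variation_le A : measurable A -> A `<=` Omega2 ->
  (Df_variation Omega1 f (g @` A) <= variation_const%:E * lambda A)%E.
Proof.
move=> mA AO; apply: ge_ereal_sup => _ [F [M [tF FA FM ->]]].
have mF k : measurable (F k) by have [U [nu [[_ _ ? _] _]]] := FM k.
have -> : A = \bigcup_k pulled (F k).
  apply/seteqP; split => [y Ay|y [k _ [Oy Fy]]].
    have : (\bigcup_k F k) (g y) by rewrite FA; exists y.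
    by move=> [k _ Fk]; exists k => //; split => //; exact: AO.
  have : (g @` A) (g y) by rewrite -FA; exists k.
  by move=> [z Az zy]; rewrite -(fg Oy) -zy fg//; exact: AO.
have -> : lambda (\bigcup_k pulled (F k)) = (\sum_(k <oo) lambda (pulled (F k)))%E.
  apply: measure_semi_bigcup.
  - by move=> k; exact: measurable_pulled.
  - move/trivIsetP : tF => tF; apply/trivIsetP => k l _ _ kl.
    by rewrite /pulled setIACA setIid -preimage_setI tF// preimage_set0 setI0.
  - by apply: bigcup_measurable => k _; exact: measurable_pulled.
rewrite -nneseriesZl; last by move=> k _; exact: measure_ge0.
apply: lee_nneseries => k; first by rewrite lee_fin enorm_ge0.
by move=> _; exact: Df_value_le.
Qed.

End lipschitz_inverse.

Theorem lemma4p7 (R : realType) (n : nat) (Omega1 Omega2 : set 'rV[R]_n)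
    (f : 'rV[R]_n -> 'rV[R]_n)
    (openOmega1 : open Omega1) (openOmega2 : open Omega2)
    (bij_f : set_bij Omega1 Omega2 f)
    (lip_finv : elipschitz_on Omega2 (pinv Omega1 f)) :
  BV_loc Omega1 f /\
  exists K : R, 0 < K /\
    forall A : set 'rV[R]_n, measurable A -> A `<=` Omega2 ->
      (Df_variation Omega1 f (pinv Omega1 f @` A) <= K%:E * lebesgue_Rn A)%E.
Proof.
have [fO injf surjf] := bij_f; have [L lipL] := lip_finv.
pose g := pinv Omega1 f; pose L' := `|L| * n%:R.
have gf x : Omega1 x -> g (f x) = x.
  by move=> Ox; rewrite /g pinvKV ?inE.
have gfO y : Omega2 y -> exists2 x, Omega1 x & y = f x.
  by move=> /surjf[x Ox <-]; exists x.
have gO y : Omega2 y -> Omega1 (g y) by move=> /gfO[x Ox ->]; rewrite gf.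
have fg y : Omega2 y -> f (g y) = y by move=> /gfO[x Ox ->]; rewrite gf.
have L0 : 0 <= L' by rewrite mulr_ge0.
have lip_g y z : Omega2 y -> Omega2 z -> `|g y - g z| <= L' * `|y - z|.
  move=> Oy Oz; apply: le_trans (normr_le_enorm _) _.
  apply: le_trans (lipL y z Oy Oz) _; rewrite -mulrA.
  apply: le_trans (ler_wpM2r (enorm_ge0 _) (ler_norm L)) _.
  by rewrite ler_wpM2l// enorm_le_normr.
split; first exact: (lipschitz_inverse_BV_loc openOmega1 openOmega2 L0 lip_g fO gO gf fg).
exists (@variation_const R n L'); split; first exact: variation_const_gt0.
move=> A mA AO.
exact: (Df_variation_le openOmega1 openOmega2 L0 lip_g fO gO gf fg mA AO).
Qed.
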